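(* Let $Y=g(A^\top X)+\zeta$, where $X$ is a sub-Gaussian random vector in $\mathbb{R}^D$, $A\in\mathbb{R}^{D\times d}$ has orthonormal columns, $P=AA^\top$, $\mathbb{E}[\zeta\mid X]=0$ almost surely, and $\operatorname{Var}(\zeta\mid X)\le\sigma_\zeta^2$ almost surely. Let $f(x)=g(A^\top x)$ and assume $|f(X)|\le1$ almost surely. Let $\hat P=\hat A\hat A^\top$ be a deterministic orthogonal projection, where $\hat A\in\mathbb{R}^{D\times d}$ has orthonormal columns, with $\|\hat P-P\|<1$. Let $g$ be $(L,s)$-smooth with $s=s_1+s_2$, $s_1\in\mathbb{N}_0$, $s_2\in(0,1]$. Let $N\ge2$ and let $\hat f$ be the truncated piecewise polynomial empirical risk minimizer over $\mathcal{F}(\hat A,l,k,R)$ based on $N$ i.i.d. copies of $(X,Y)$. Choosing $l=\lceil\log_2(N)/(2s+d)\rceil$, $R^2=D\|X\|_{\psi_2}^2\log(N)$ and $k=s_1$, one has $$\mathbb{E}\big(\hat f(X)-f(X)\big)^2\le C_1\log^{1\vee\frac d2}(N)\,N^{-\frac{2s}{2s+d}}+C_2\log(N)^{1\wedge s}\,\|\hat P-P\|^{2\wedge2s},$$ where the constants $C_1,C_2$ grow with $\sigma_\zeta,d,s$ and $L^*:=Ld^{s_1/2}(1-\|\hat P-P\|^2)^{-s/2}$, and $C_1$ depends linearly on $(D\|X\|_{\psi_2}^2)^{d/2}$, and $C_2$ linearly on $(D\|X\|_{\psi_2}^2)^{1\wedge s}$.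
   Context: $a\vee b=\max\{a,b\}$, $a\wedge b=\min\{a,b\}$; $\|\cdot\|$ is the Euclidean norm of vectors and the spectral norm of matrices. For a real random variable $\|Z\|_{\psi_2}:=\inf\{t>0:\mathbb{E}\exp(Z^2/t^2)\le2\}$; for a random vector $\|Z\|_{\psi_2}:=\sup_{\|v\|=1}\|v^\top Z\|_{\psi_2}$; sub-Gaussian means this norm is finite. Function class: let $\Delta_l$ be the set of dyadic cubes of $\mathbb{R}^d$, i.e. the partition of $\mathbb{R}^d$ into cubes with side length $2^{-l}$ and corners in $\{2^{-l}(v_1,\dots,v_d):v_j\in\mathbb{Z}\}$; let $B_R=\{x\in\mathbb{R}^D:\|x\|\le R\}$, and let $\Delta_l(R)\subseteq\Delta_l$ be the subset of cubes having non-empty intersection with $\{\hat A^\top z:z\in B_R\}$. Let $\mathcal{P}_k$ be the space of polynomials of degree (at most) $k$ on $\mathbb{R}^d$ and $1_S$ the indicator function of $S$. Then $$\mathcal{F}(\hat A,l,k,R):=\Big\{h:\ h(x)=1_{B_R}(x)\sum_{c\in\Delta_l(R)}1_c(\hat A^\top x)\,p_c(\hat A^\top x),\ p_c\in\mathcal{P}_k\Big\}.$$ Estimator: with $(X_i,Y_i)$, $i=1,\dots,N$, i.i.d. copies of $(X,Y)$, $\tilde f\in\operatorname{argmin}_{h\in\mathcal{F}(\hat A,l,k,R)}\sum_{i=1}^N(h(X_i)-Y_i)^2$ and $\hat f(x):=T_{[-1,1]}(\tilde f(x))$, where $T_{[-1,1]}(u):=\operatorname{sign}(u)(|u|\wedge1)$.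 In the expectation, $X$ is independent of the sample. Smoothness: for $s=s_1+s_2$ with $s_1\in\mathbb{N}_0$, $s_2\in(0,1]$, a function $\phi:\mathbb{R}^m\to\mathbb{R}$ is $(L,s)$-smooth if the partial derivatives $\partial^\alpha\phi$ exist for all $\alpha\in\mathbb{N}_0^m$ with $\sum_i\alpha_i\le s_1$, and for all $\alpha$ with $\sum_i\alpha_i=s_1$ one has $|\partial^\alpha\phi(z)-\partial^\alpha\phi(z')|\le L\|z-z'\|^{s_2}$ for all $z,z'$. Here $g:\mathbb{R}^d\to\mathbb{R}$.
   Formalization: C_2 may also grow with the largest fourth moment of the partial derivatives of g of orders 1 to s_1 at A^T X (0 if s≤1), as the claim is false for s>1 otherwise; C_1 is affine, proportional to 1+(D‖X‖²)^{d/2}, since strict proportionality fails for X=0. *)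

(* Defs.v *)
From HB Require Import structures.
From mathcomp Require Import all_boot all_order all_algebra.
From mathcomp Require Import all_classical all_reals all_analysis.
From mathcomp Require mpoly.
(* mpoly's notations cannot be loaded together with those of the analysis
   library, its constants and structures can. *)
Import -(notations) mpoly.

Set Implicit Arguments.
Unset Strict Implicit.
Unset Printing Implicit Defensive.

Import Order.TTheory GRing.Theory Num.Theory.
Import numFieldNormedType.Exports.

Local Open Scope classical_set_scope.
Local Open Scope ring_scope.

Section Euclidean.
Context {R : realType}.

Definition enorm n (x : 'cV[R]_n) : R := Num.sqrt (\sum_i x i 0 ^+ 2).

(* Spectral norm, as the operator norm of [enorm]. *)
Definition opnorm m n (M : 'M[R]_(m, n)) : R :=
  sup [set enorm (M *m x) | x in [set x : 'cV[R]_n | enorm x <= 1]].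

Definition eball n (r : R) : set 'cV[R]_n := [set x | enorm x <= r].

Definition orthonormal_cols m n (M : 'M[R]_(m, n)) : Prop := M^T *m M = 1%:M.

End Euclidean.

(* 'cV[R]_n carries the product (i.e. Borel) sigma-algebra of R^n, exactly as
   the library does for n.-tuple R. *)
Section MeasurableColumn.
Context {R : realType} (n : nat).

Let coord (i : 'I_n) (x : 'cV[R]_n) : R := x i 0.

Let column_set0 : g_sigma_preimage coord set0.
Proof. exact: sigma_algebra0. Qed.

Let column_setC A : g_sigma_preimage coord A -> g_sigma_preimage coord (~` A).
Proof. exact: sigma_algebraC. Qed.

Let column_bigcup (F : (set 'cV[R]_n)^nat) :
  (forall i, g_sigma_preimage coord (F i)) ->
  g_sigma_preimage coord (\bigcup_i F i).
Proof. exact: sigma_algebra_bigcup. Qed.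

Definition column_display : measure_display.
Proof. exact. Qed.

HB.instance Definition _ := @isMeasurable.Build column_display
  'cV[R]_n (g_sigma_preimage coord) column_set0 column_setC column_bigcup.

End MeasurableColumn.

Section Smoothness.
Context {R : realType} {m : nat}.
Implicit Types (phi : 'cV[R]_m -> R) (r : seq 'I_m) (a : {ffun 'I_m -> nat}).

Definition iter_partial r phi : 'cV[R]_m -> R :=
  foldr (fun j psi => 'D_(delta_mx j 0) psi) phi r.

Fixpoint iter_partial_exists r phi : Prop :=
  if r is j :: r' then
    iter_partial_exists r' phi /\
    forall z, derivable (iter_partial r' phi) z (delta_mx j 0)
  else True.

(* The multi-index a as the list of directions 0, ..., 0, 1, ..., 1, ...;
   the last direction of the list is differentiated first. *)
Definition directions a : seq 'I_m := flatten [seq nseq (a j) j | j <- enum 'I_m].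

Definition pderiv a phi := iter_partial (directions a) phi.
Definition pderiv_exists a phi := iter_partial_exists (directions a) phi.

Definition mdegree a : nat := (\sum_j a j)%N.

Definition smooth (L : R) (s1 : nat) (s2 : R) phi : Prop :=
  (forall a, (mdegree a <= s1)%N -> pderiv_exists a phi) /\
  (forall a, mdegree a = s1 -> forall z z',
     `|pderiv a phi z - pderiv a phi z'| <= L * enorm (z - z') `^ s2).

End Smoothness.

Section SubGaussian.
Context {disp : measure_display} {T : measurableType disp} {R : realType}.
Variable P : probability T R.

(* Both norms live in \bar R: +oo means "not sub-Gaussian". *)
Definition psi2 (Z : T -> R) : \bar R :=
  ereal_inf [set t%:E | t in
    [set t : R | 0 < t /\ ('E_P[fun w => expR (Z w ^+ 2 / t ^+ 2)%R] <= 2%:E)%E]].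

Definition psi2_vec n (Z : T -> 'cV[R]_n) : \bar R :=
  ereal_sup [set psi2 (fun w => (v^T *m Z w) 0 0) | v in
    [set v : 'cV[R]_n | enorm v = 1]].

Definition sub_gaussian n (Z : T -> 'cV[R]_n) : Prop := (psi2_vec Z < +oo)%E.

End SubGaussian.

Section Conditioning.
Context {disp disp' : measure_display} {T : measurableType disp}.
Context {T' : measurableType disp'} {R : realType} (P : probability T R).

(* V is a version of E[W | X]. *)
Definition is_cond_exp (X : T -> T') (W V : T -> R) : Prop :=
  [/\ P.-integrable setT (EFin \o W), P.-integrable setT (EFin \o V),
      (forall B : set R, measurable B -> g_sigma_algebra_preimage X (V @^-1` B)) &
      forall A, g_sigma_algebra_preimage X A ->
        (\int[P]_(w in A) (V w)%:E = \int[P]_(w in A) (W w)%:E)%E].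

(* V is a version of Var(W | X) = E[(W - E[W | X])^2 | X]. *)
Definition is_cond_var (X : T -> T') (W V : T -> R) : Prop :=
  exists2 M, is_cond_exp X W M &
    is_cond_exp X (fun w => (W w - M w) ^+ 2) V.

Definition mutually_independent n (Z : 'I_n -> T -> T') : Prop :=
  forall (J : {set 'I_n}) (B : 'I_n -> set T'), (forall i, measurable (B i)) ->
    fine (P (\bigcap_(i in [set i | i \in J]) (Z i @^-1` B i))) =
    \prod_(i in J) fine (P (Z i @^-1` B i)).

Definition same_law (Z Z' : T -> T') : Prop :=
  forall B, measurable B -> P (Z @^-1` B) = P (Z' @^-1` B).

End Conditioning.

Definition independent_pair (disp disp1 disp2 : measure_display)
    (T : measurableType disp) (T1 : measurableType disp1)
    (T2 : measurableType disp2) (R : realType) (P : probability T R)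
    (Z1 : T -> T1) (Z2 : T -> T2) : Prop :=
  forall B1 B2, measurable B1 -> measurable B2 ->
    (P ((Z1 @^-1` B1) `&` (Z2 @^-1` B2)) =
     P (Z1 @^-1` B1) * P (Z2 @^-1` B2))%E.

Section Estimator.
Context {R : realType} {D d : nat}.

(* The dyadic cubes of side 2^-l are indexed by their lowest corner 2^-l v with
   v an integer vector; they are half-open, so that they partition R^d. *)
Definition dyadic_cube (l : int) (v : 'cV[int]_d) : set 'cV[R]_d :=
  [set y | forall j, 2 ^ (- l) * (v j 0)%:~R <= y j 0 < 2 ^ (- l) * (v j 0 + 1)%:~R].

Definition cubes_meeting (Ahat : 'M[R]_(D, d)) (l : int) (r : R) :
    set 'cV[int]_d :=
  [set v | exists2 z, eball r z & dyadic_cube l v (Ahat^T *m z)].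

(* [msize] is the total degree plus one. For each x at most one summand is
   nonzero, so the finitely supported sum over cubes is the intended one. *)
Definition piecewise_poly (Ahat : 'M[R]_(D, d)) (l : int) (k : nat) (r : R) :
    set ('cV[R]_D -> R) :=
  [set h | exists2 p : 'cV[int]_d -> mpoly d R,
     forall c, (msize (p c) <= k.+1)%N &
     forall x, h x = \1_(eball r) x *
       \sum_(c \in cubes_meeting Ahat l r)
         \1_(dyadic_cube l c) (Ahat^T *m x) *
         meval (fun j => (Ahat^T *m x) j 0) (p c)].

Definition empirical_risk N (S : N.-tuple ('cV[R]_D * R)) (h : 'cV[R]_D -> R) : R :=
  \sum_(i < N) (h (tnth S i).1 - (tnth S i).2) ^+ 2.

Definition clip1 (u : R) : R := Num.sg u * Num.min `|u| 1.

End Estimator.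

Definition argmin (R : realType) (U : Type) (F : set U) (J : U -> R) : set U :=
  [set h | F h /\ forall h', F h' -> J h <= J h'].

(* sup of the fourth moments E[(d^a g (Z))^4] over 1 <= |a| <= s1: the size,
   along Z, of the derivatives of g between the value (which the regression
   problem normalizes by |g (Z)| <= 1) and the Hoelder constant of order s.
   It is finite for smooth g and sub-Gaussian Z, and it is 0 (an empty sup)
   when s1 = 0.
   The constant in front of the projection error has to grow with it once
   s > 1.  Take D = 2, d = 1, A = e1, Ahat = (sqrt (1 - t^2), t), no noise,
   X = (t U1, U2) with U1, U2 independent and uniform on [-1, 1], g y = y / t:
   g is (0, 2)-smooth, |g (A^T X)| <= 1 and the psi2 norm of X stays bounded,
   but an estimator that only sees Ahat^T X = t (sqrt (1 - t^2) U1 + U2) has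
   an error bounded away from 0, whereas for t = 1 / N a bound
   C1 log N N^(-4/5) + C2 log N t^2 with C1, C2 not depending on g vanishes as
   N grows. *)
Definition deriv_moment (disp : measure_display) (T : measurableType disp)
    (R : realType) (P : probability T R) (m s1 : nat) (g : 'cV[R]_m -> R)
    (Z : T -> 'cV[R]_m) : R :=
  sup [set fine 'E_P[fun w => (pderiv a g (Z w) ^+ 4)%R] | a in
    [set a : {ffun 'I_m -> nat} | (0 < mdegree a <= s1)%N]].

(* Main.v *)
Require Import Defs.
From HB Require Import structures.
From mathcomp Require Import all_boot all_order all_algebra.
From mathcomp Require Import all_classical all_reals all_analysis.
From mathcomp Require Import measurable_realfun ring lra.
From mathcomp Require mpoly.
Import -(notations) mpoly.

Set Implicit Arguments.
Unset Strict Implicit.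
Unset Printing Implicit Defensive.

Import Order.TTheory GRing.Theory Num.Theory.
Import numFieldNormedType.Exports.

Local Open Scope classical_set_scope.
Local Open Scope ring_scope.

(** The rate comes from an exact formula for leaving one observation out of a
least squares fit, which replaces the usual covering or dimension arguments for
the class and costs no logarithm.

Let n = N + 1 observations y = f + zeta be given and let H be the orthogonal
projection onto the vectors of values, at the n design points, of the functions
of a K-dimensional linear class. If u_i is the prediction at point i of the fit
to the other N observations, then u_i (1 - H_ii) = (H y)_i - H_ii y_i
([leave_one_out_prediction]). Truncation takes care of the points with
H_ii > 1/2, of which there are at most 2 K, so that the truncated error at i is
at most 8 H_ii + 8 (H y - f)_i^2 + 8 H_ii zeta_i^2 ([leave_one_out_risk]).
Summing over i, the in-sample error |H y - f|^2 is at most |h - f|^2 for any h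
in the class plus the quadratic form zeta^T H zeta ([proj_in_sample_risk]).
In expectation the off-diagonal terms of that form vanish, because the noise is
centred given the design, and its diagonal is at most sigma^2 tr H. Since the
n observations are exchangeable, each of the n leave-one-out errors has the
expectation of the error of a fit to N observations at a new point. As
tr H <= K, the risk is at most
8 E (h (X) - f (X))^2 + (8 + 16 sigma^2) K / (N + 1)
([truncated_least_squares_risk], [regression_risk]). The projection is built by
Gram-Schmidt so that it is visibly measurable in the design.

It remains to choose h and to count K. On each dyadic cell h is a Taylor
polynomial of g composed with the linear map A^T Ahat, which sends estimated
coordinates Ahat^T x to true coordinates A^T x up to an error of at most
delta |x|, with delta the distance of the two projections. On the ball of radius
r this gives a bias of order 2^(- l s) from Taylor's formula
([piecewise_poly_approximation]) and one of order (delta r)^(min 1 s) from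
moving the argument of g ([projection_increment]). In the second one the
derivatives of g of orders 1 to k appear at the random point A^T X; they are
measurable and have finite fourth moments because they grow polynomially, which
follows from bounding the coefficients of a Taylor polynomial by its values on
a box ([pderiv_growth], [gradient_size_moment]). If delta r > 1 the Taylor bound
is of no use, but then the projection term of the claim exceeds the trivial
error bound 4. Outside the ball the class vanishes and |f| <= 1, while the
radius is such that this happens with probability at most 2 / N: by Jensen's
inequality over the coordinates, exp (|X|^2 / (D t^2)) has expectation at most
2 for every t > psi, psi being the psi_2 norm of X ([sub_gaussian_tail]).

Only about (2^l r)^d cells meet the ball, so K / N and the squared bias
2^(- 2 l s) balance at 2^l = N^(1 / (2 s + d)) up to rounding ([cells_rate],
[bias_rate]). *)

(** * Orthogonal projections and leave-one-out least squares *)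

Section Projector.
Context {R : realType} {n : nat}.
Implicit Types (u v w y f b : 'cV[R]_n) (vs : seq 'cV[R]_n) (H : 'M[R]_n).

Definition sqnorm u : R := \sum_i u i 0 ^+ 2.

Lemma sqnormE u : (u^T *m u) 0 0 = sqnorm u.
Proof. by rewrite mxE; apply: eq_bigr => i _; rewrite mxE expr2. Qed.

Lemma sqnorm_ge0 u : 0 <= sqnorm u.
Proof. by apply: sumr_ge0 => i _; rewrite sqr_ge0. Qed.

Lemma sqnorm_eq0 u : sqnorm u = 0 -> u = 0.
Proof.
move/eqP; rewrite psumr_eq0; last by move=> i _; rewrite sqr_ge0.
move=> /allP u0; apply/matrixP => i j; rewrite ord1 mxE.
by have := u0 i (mem_index_enum _); rewrite sqrf_eq0 => /eqP.
Qed.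

(** Given by arithmetic operations on the vectors, hence measurable in them. A
vector in the span of the later ones has q = 0 and adds nothing, as 0^-1 = 0. *)
Fixpoint gram_schmidt_proj vs : 'M[R]_n :=
  if vs is v :: vs' then
    let H := gram_schmidt_proj vs' in
    let q := v - H *m v in
    H + (sqnorm q)^-1 *: (q *m q^T)
  else 0.

Lemma gram_schmidt_proj_sym vs : (gram_schmidt_proj vs)^T = gram_schmidt_proj vs.
Proof.
elim: vs => [|v vs IH] /=; first by rewrite trmx0.
by rewrite linearD /= linearZ /= trmx_mul trmxK IH.
Qed.

Lemma outer_mul (q : 'cV[R]_n) : q *m q^T *m q = sqnorm q *: q.
Proof.
rewrite -mulmxA; have -> : q^T *m q = (sqnorm q)%:M.
  by apply/matrixP => i j; rewrite !ord1 sqnormE !mxE eqxx.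
by rewrite mul_mx_scalar.
Qed.

Lemma gram_schmidt_proj_idem vs :
  gram_schmidt_proj vs *m gram_schmidt_proj vs = gram_schmidt_proj vs.
Proof.
elim: vs => [|v vs IH] /=; first by rewrite mul0mx.
set H := gram_schmidt_proj vs in IH *; set q := v - H *m v; set c := (sqnorm q)^-1.
have Hq : H *m q = 0 by rewrite mulmxBr mulmxA IH subrr.
have qH : q^T *m H = 0.
  by rewrite -[H]gram_schmidt_proj_sym -trmx_mul Hq trmx0.
rewrite mulmxDl !mulmxDr IH -!scalemxAl -!scalemxAr mulmxA Hq mul0mx scaler0 addr0.
rewrite -mulmxA qH mulmx0 scaler0 add0r mulmxA outer_mul -scalemxAl !scalerA.
congr (_ + _ *: _); rewrite /c.
by have [->|q0] := eqVneq (sqnorm q) 0; [rewrite invr0 !mul0r | field].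
Qed.

Lemma gram_schmidt_proj_id vs v : v \in vs -> gram_schmidt_proj vs *m v = v.
Proof.
elim: vs v => [//|w vs IH] v; rewrite inE /=.
set H := gram_schmidt_proj vs in IH *; set q := w - H *m w.
have Hq : H *m q = 0 by rewrite mulmxBr mulmxA gram_schmidt_proj_idem subrr.
have qH : q^T *m H = 0 by rewrite -[H]gram_schmidt_proj_sym -trmx_mul Hq trmx0.
move=> /predU1P[->|vvs]; last first.
  by rewrite mulmxDl -scalemxAl -mulmxA -{2}[v]IH // [q^T *m _]mulmxA qH mul0mx
     mulmx0 scaler0 addr0 IH.
have wE : w = q + H *m w by rewrite subrK.
rewrite mulmxDl -scalemxAl {2}wE mulmxDr outer_mul -mulmxA [q^T *m _]mulmxA qH.
rewrite mul0mx mulmx0 addr0 scalerA.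
have [q0|q0] := eqVneq (sqnorm q) 0; last by rewrite mulVf // scale1r addrC -wE.
have /subr0_eq <- := sqnorm_eq0 q0.
by rewrite q0 mulr0 scale0r addr0.
Qed.

Lemma gram_schmidt_proj_range vs (S : 'cV[R]_n -> Prop) :
  S 0 -> (forall a u v, S u -> S v -> S (a *: u + v)) ->
  (forall v, v \in vs -> S v) -> forall u, S (gram_schmidt_proj vs *m u).
Proof.
move=> S0 SD; elim: vs => [|v vs IH] Svs u /=; first by rewrite mul0mx.
have {}IH w : S (gram_schmidt_proj vs *m w).
  by apply: IH => w' w'vs; apply: Svs; rewrite inE w'vs orbT.
have SN w : S w -> S (- w) by move=> Sw; rewrite -[- w]addr0 -scaleN1r; exact: (SD).
have Sadd w w' : S w -> S w' -> S (w + w').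
  by move=> Sw; rewrite -[w]scale1r; exact: (SD).
rewrite mulmxDl -scalemxAl -mulmxA addrC; apply: (Sadd) => //.
set q := v - _.
have -> : q *m (q^T *m u) = (q^T *m u) 0 0 *: q.
  by rewrite [q^T *m u in LHS]mx11_scalar mul_mx_scalar.
rewrite scalerA -[_ *: q]addr0; apply: (SD) => //; apply: (Sadd); last exact: SN.
by apply: Svs; rewrite mem_head.
Qed.

Lemma gram_schmidt_proj_trace vs : \tr (gram_schmidt_proj vs) <= (size vs)%:R.
Proof.
elim: vs => [|v vs IH] /=; first by rewrite mxtrace0.
rewrite mxtraceD mxtraceZ mxtrace_mulC -natr1 lerD //.
rewrite /mxtrace big_ord1 sqnormE.
by have [->|q0] := eqVneq (sqnorm (v - gram_schmidt_proj vs *m v)) 0;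
  rewrite ?mulr0 ?mulVf.
Qed.

Definition orthogonal_projection H := H^T = H /\ H *m H = H.

Lemma gram_schmidt_projP vs : orthogonal_projection (gram_schmidt_proj vs).
Proof.
by split; [exact: gram_schmidt_proj_sym | exact: gram_schmidt_proj_idem].
Qed.

Section OrthogonalProjection.
Context {H : 'M[R]_n}.
Hypothesis projH : orthogonal_projection H.

Let symH : H^T = H. Proof. by case: projH. Qed.
Let idemH : H *m H = H. Proof. by case: projH. Qed.

Lemma proj_diagE i : H i i = \sum_k H k i ^+ 2.
Proof.
rewrite -{1}idemH mxE; apply: eq_bigr => k _.
by rewrite -{1}symH mxE expr2.
Qed.

Lemma proj_entry_le k i : H k i ^+ 2 <= H i i.
Proof.
rewrite (proj_diagE i) (bigD1 k) //= lerDl.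
by apply: sumr_ge0 => j _; rewrite sqr_ge0.
Qed.

Lemma proj_diag_ge0 i : 0 <= H i i.
Proof. by apply: le_trans (proj_entry_le i i); rewrite sqr_ge0. Qed.

Lemma proj_diag_le1 i : H i i <= 1.
Proof. by have := proj_entry_le i i; have := proj_diag_ge0 i; nra. Qed.

Lemma proj_entry_le1 k i : `|H k i| <= 1.
Proof.
rewrite -(@expr_le1 _ 2) // real_normK ?num_real //.
exact: le_trans (proj_entry_le k i) (proj_diag_le1 i).
Qed.

End OrthogonalProjection.

Definition dot u v : R := \sum_i u i 0 * v i 0.

Lemma dotE u v : (u^T *m v) 0 0 = dot u v.
Proof. by rewrite mxE; apply: eq_bigr => i _; rewrite mxE. Qed.

Lemma dotC u v : dot u v = dot v u.
Proof. by apply: eq_bigr => i _; rewrite mulrC. Qed.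

Lemma sqnormD u v : sqnorm (u + v) = sqnorm u + 2 * dot u v + sqnorm v.
Proof.
rewrite /sqnorm /dot mulr_sumr -!big_split /=; apply: eq_bigr => i _.
by rewrite mxE; ring.
Qed.

Lemma dotNr u v : dot u (- v) = - dot u v.
Proof.
by rewrite /dot -sumrN; apply: eq_bigr => j _; rewrite [(- v) j 0]mxE mulrN.
Qed.

Lemma sqnormN u : sqnorm (- u) = sqnorm u.
Proof. by apply: eq_bigr => j _; rewrite mxE sqrrN. Qed.

Lemma dot_proj H u v : orthogonal_projection H -> dot (H *m u) v = dot u (H *m v).
Proof. by move=> [symH _]; rewrite -!dotE trmx_mul symH mulmxA. Qed.

(** The in-sample risk of least squares: projecting y = f + z onto a space that
contains b costs the distance from f to that space, at most |f - b|^2, plus the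
projected noise |H z|^2 = z^T H z, and the two parts are orthogonal. *)
Lemma proj_in_sample_risk H f y b : orthogonal_projection H -> H *m b = b ->
  sqnorm (H *m y - f) <=
    sqnorm (b - f) + \sum_i \sum_j H i j * (y - f) i 0 * (y - f) j 0.
Proof.
move=> projH Hb; have [_ idemH] := projH; set z := y - f.
have -> : H *m y - f = (H *m f - f) + H *m z.
  by rewrite /z mulmxBr [RHS]addrC addrA subrK.
have orth w : dot (H *m f - f) (H *m w) = 0.
  by rewrite -dot_proj // mulmxBr mulmxA idemH subrr /dot big1 // => i _;
    rewrite mxE mul0r.
rewrite (sqnormD (_ - _) (H *m z)) orth mulr0 addr0 lerD //.
  have -> : b - f = (H *m f - f) + H *m (b - f).
    by rewrite mulmxBr Hb [RHS]addrC addrA subrK.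
  by rewrite (sqnormD (_ - _) (H *m _)) orth mulr0 addr0 lerDl sqnorm_ge0.
have -> : sqnorm (H *m z) = dot z (H *m z).
  by rewrite -dot_proj // -sqnormE dotE dot_proj // mulmxA idemH -dot_proj // dotC.
rewrite /dot le_eqVlt; apply/orP; left; apply/eqP; apply: eq_bigr => i _.
by rewrite [(H *m z) i 0]mxE mulr_sumr; apply: eq_bigr => j _; ring.
Qed.

(** First-order condition for a minimum along a line. *)
Lemma quadratic_ge0_linear0 (a b : R) :
  (forall t, 0 <= 2 * t * b + t ^+ 2 * a) -> b = 0.
Proof.
move=> h; apply/eqP/negPn/negP => b0.
have a0 : 0 <= a by have := h 1; have := h (-1); nra.
have := h (- b / (a + 1)).
have a1 : a + 1 != 0 by rewrite gt_eqF // ltr_wpDl.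
have -> : 2 * (- b / (a + 1)) * b + (- b / (a + 1)) ^+ 2 * a
          = - (b ^+ 2 * (a + 2) / (a + 1) ^+ 2) by field.
rewrite oppr_ge0 leNgt => /negP; apply.
apply: divr_gt0; last by rewrite exprn_gt0 // ltr_wpDl.
by apply: mulr_gt0; [rewrite exprn_even_gt0 | rewrite ltr_wpDl].
Qed.

(** The residuals of the fit u away from i are orthogonal to the space, so H
annihilates u - y up to its entry at i: replacing y_i by u_i turns u into the
full projection. *)
Lemma leave_one_out_prediction H u y i : orthogonal_projection H -> H *m u = u ->
  (forall v, H *m v = v ->
     \sum_(j | j != i) (u j 0 - y j 0) ^+ 2 <= \sum_(j | j != i) (v j 0 - y j 0) ^+ 2) ->
  u i 0 * (1 - H i i) = (H *m y) i 0 - H i i * y i 0.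
Proof.
move=> projH Hu umin; have [symH idemH] := projH.
have normal v : H *m v = v -> \sum_(j | j != i) (u j 0 - y j 0) * v j 0 = 0.
  move=> Hv; apply: (@quadratic_ge0_linear0 (\sum_(j | j != i) v j 0 ^+ 2)) => t.
  have /umin : H *m (u + t *: v) = u + t *: v by rewrite mulmxDr -scalemxAr Hu Hv.
  rewrite -subr_ge0 -sumrB => /le_trans; apply.
  rewrite !mulr_sumr -big_split /= le_eqVlt; apply/orP; left; apply/eqP.
  by apply: eq_bigr => j _; rewrite !mxE; ring.
have := normal (H *m delta_mx i 0).
rewrite mulmxA idemH => /(_ erefl).
have Hd j : (H *m delta_mx i 0 : 'cV_n) j 0 = H j i.
  by rewrite -colE mxE.
under eq_bigr do rewrite Hd.
move=> away.
have : \sum_j (u j 0 - y j 0) * H j i = (u i 0 - y i 0) * H i i.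
  by rewrite (bigD1 i) //= away addr0.
have -> : \sum_j (u j 0 - y j 0) * H j i = u i 0 - (H *m y) i 0.
  rewrite -{2}Hu !mxE -sumrB; apply: eq_bigr => j _.
  by rewrite -{2 3}symH !mxE; ring.
by move=> e; lra.
Qed.

Lemma clip1_le1 (t : R) : `|clip1 t| <= 1.
Proof.
have m0 : 0 <= Num.min `|t| 1 by rewrite le_min normr_ge0 ler01.
rewrite /clip1 normrM (ger0_norm m0).
have [->|t0] := eqVneq t 0; first by rewrite sgr0 normr0 mul0r.
by rewrite normr_sg t0 mul1r ge_min lexx orbT.
Qed.

Lemma clip1E (t : R) : clip1 t = Num.max (-1) (Num.min 1 t).
Proof.
rewrite /clip1; have [t0|t0|->] := ltrgtP t 0.
- rewrite ltr0_sg // ltr0_norm // mulN1r.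
  have -> : Num.min 1 t = t by rewrite min_r // (le_trans (ltW t0)).
  by case: (leP (- t) 1) => h; case: (leP (-1) t) => h'; lra.
- rewrite gtr0_sg // gtr0_norm // mul1r minC max_r // le_min.
  by apply/andP; split; lra.
- by rewrite sgr0 mul0r min_r ?ler01 // max_r // lerN10.
Qed.

Lemma clip1_id (t : R) : `|t| <= 1 -> clip1 t = t.
Proof.
by rewrite ler_norml clip1E => /andP[h1 h2]; rewrite min_r // max_r.
Qed.

Lemma clip1_closer (t a : R) : `|a| <= 1 -> (clip1 t - a) ^+ 2 <= (t - a) ^+ 2.
Proof.
rewrite ler_norml clip1E => /andP[h1 h2].
by case: (leP 1 t) => h; [case: (leP (-1) 1) => h' | case: (leP (-1) t) => h']; nra.
Qed.

Lemma clip1_dist (t a : R) : `|a| <= 1 -> (clip1 t - a) ^+ 2 <= 4.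
Proof.
have := clip1_le1 t; rewrite !ler_norml => /andP[h1 h2] /andP[h3 h4]; nra.
Qed.

(** At most 2 tr H observations have a leverage H_ii above 1/2, and there the
truncation bounds the error by 4; elsewhere the formula for the left-out
prediction loses at most a factor 2 with respect to the full fit H y. *)
Lemma leave_one_out_risk H u y f i : orthogonal_projection H -> H *m u = u ->
  (forall v, H *m v = v ->
     \sum_(j | j != i) (u j 0 - y j 0) ^+ 2 <= \sum_(j | j != i) (v j 0 - y j 0) ^+ 2) ->
  `|f i 0| <= 1 ->
  (clip1 (u i 0) - f i 0) ^+ 2 <=
    8 * H i i + 8 * (H *m y - f) i 0 ^+ 2 + 8 * (H i i * (y - f) i 0 ^+ 2).
Proof.
move=> projH Hu umin fi.
have e := leave_one_out_prediction projH Hu umin.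
rewrite [(H *m y - f) i 0]mxE [(y - f) i 0]mxE [(- f) i 0]mxE.
move: e fi; set h := H i i; set a := (H *m y) i 0; set ui := u i 0.
set yi := y i 0; set fi := f i 0 => e fi1.
have h0 : 0 <= h := proj_diag_ge0 projH i.
have h1 : h <= 1 := proj_diag_le1 projH i.
have [h2|h2] := leP h 2^-1; last first.
  apply: (le_trans (clip1_dist _ fi1)).
  have : 0 <= (a - fi) ^+ 2 by rewrite sqr_ge0.
  have : 0 <= h * (yi - fi) ^+ 2 by rewrite mulr_ge0 ?sqr_ge0.
  by move=> ? ?; lra.
apply: (le_trans (clip1_closer _ fi1)).
set p := a - fi; set q := yi - fi.
have e2 : (ui - fi) * (1 - h) = p - h * q by rewrite /p /q; nra.
have k1 : (ui - fi) ^+ 2 <= 4 * ((ui - fi) * (1 - h)) ^+ 2.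
  have h3 : 1 <= 4 * (1 - h) ^+ 2 by nra.
  by rewrite exprMn mulrCA -[leLHS]mulr1 ler_wpM2l ?sqr_ge0.
apply: (le_trans k1); rewrite e2.
have k2 : (p - h * q) ^+ 2 <= 2 * p ^+ 2 + 2 * (h * q) ^+ 2.
  by set w := h * q; have := sqr_ge0 (p + w); rewrite !sqrrD; lra.
have k3 : (h * q) ^+ 2 <= h * q ^+ 2.
  by rewrite exprMn ler_wpM2r ?sqr_ge0 // expr2 ler_piMr.
by lra.
Qed.

End Projector.

(** * Exchangeability and expectations over samples *)

Section Transfer.
Local Open Scope ereal_scope.
Context {R : realType} {d1 d2 d3 : measure_display}.
Context {T1 : measurableType d1} {T2 : measurableType d2} {T3 : measurableType d3}.
Context (m1 : {measure set T1 -> \bar R}) (m2 : {measure set T2 -> \bar R}).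
Context (f1 : T1 -> T3) (f2 : T2 -> T3).
Hypotheses (mf1 : measurable_fun setT f1) (mf2 : measurable_fun setT f2).
Hypothesis f12 : forall A, measurable A -> m1 (f1 @^-1` A) = m2 (f2 @^-1` A).

Lemma ge0_integral_transfer (F : T3 -> \bar R) :
  measurable_fun setT F -> (forall x, 0 <= F x) ->
  \int[m1]_x F (f1 x) = \int[m2]_x F (f2 x).
Proof.
move=> mF F0.
have h1 := ge0_integral_pushforward mf1 m1 (f := F) measurableT mF (fun y _ => F0 y).
have h2 := ge0_integral_pushforward mf2 m2 (f := F) measurableT mF (fun y _ => F0 y).
rewrite preimage_setT in h1; rewrite preimage_setT in h2.
rewrite -[LHS]h1 -[RHS]h2; apply: eq_measure_integral => A mA _ /=.
exact: f12.
Qed.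

Lemma integral_transfer (F : T3 -> \bar R) :
  measurable_fun setT F ->
  \int[m1]_x F (f1 x) = \int[m2]_x F (f2 x).
Proof.
move=> mF; rewrite integralE [RHS]integralE.
congr (_ - _).
  under eq_integral do rewrite (funepos_comp F).
  under [RHS]eq_integral do rewrite (funepos_comp F).
  exact: (ge0_integral_transfer (measurable_funepos mF) (funepos_ge0 F)).
under eq_integral do rewrite (funeneg_comp F).
under [RHS]eq_integral do rewrite (funeneg_comp F).
exact: (ge0_integral_transfer (measurable_funeneg mF) (funeneg_ge0 F)).
Qed.

End Transfer.

Section TupleLaw.
Context {R : realType} {disp : measure_display} {Z : measurableType disp}.

Definition box n (B : 'I_n -> set Z) : set (n.-tuple Z) :=
  [set t | forall k, B k (tnth t k)].

Lemma measurable_box n (B : 'I_n -> set Z) :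
  (forall k, measurable (B k)) -> measurable (box B).
Proof.
move=> mB; have -> : box B = \bigcap_(k in [set: 'I_n]) [set t | B k (tnth t k)].
  by apply/seteqP; split => [t Bt k _|t Bt k]; [exact: Bt|exact: Bt].
apply: fin_bigcap_measurable; first exact: finite_finset.
move=> k _.
by rewrite -[X in measurable X]setTI; exact: measurable_tnth.
Qed.

(** Boxes are closed under intersection and generate the sigma-algebra. *)
Lemma tuple_law_unique n (m1 m2 : {measure set (n.-tuple Z) -> \bar R}) :
  (m1 setT < +oo)%E ->
  (forall B, (forall k, measurable (B k)) -> m1 (box B) = m2 (box B)) ->
  forall A, measurable A -> m1 A = m2 A.
Proof.
move=> m1oo m12; pose G : set (set (n.-tuple Z)) :=
  [set box B | B in [set B : 'I_n -> set Z | forall k, measurable (B k)]].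
have setTbox : setT = box (fun=> setT : set Z) :> set (n.-tuple Z).
  by apply/seteqP; split.
move=> A mA; apply: (measure_unique G (fun=> setT)) => //.
- apply/seteqP; split.
    apply: smallest_sub; first exact: smallest_sigma_algebra.
    move=> E; rewrite -bigcup_seq => -[i _ [B mB <-]].
    apply: sub_sigma_algebra; exists (fun k => if k == i then B else setT).
      by move=> k /=; case: ifP.
    rewrite setTI; apply/seteqP; split => [t Bt|t Bt k] /=.
      by have := Bt i; rewrite eqxx.
    by case: eqP => // ->.
  apply: smallest_sub; first exact: sigma_algebra_measurable.
  by move=> _ [B mB <-]; exact: measurable_box.
- move=> _ _ [B mB <-] [C mC <-]; exists (fun k => B k `&` C k).
    by move=> k; exact: measurableI.
  by apply/seteqP; split => [t BC|t [Bt Ct] k]; [split => k; case: (BC k)|].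
- by move=> _; exists (fun=> setT); rewrite // setTbox.
- by rewrite bigcup_const //; exists 0%N.
- by move=> _ [B mB <-]; exact: m12.
Qed.

End TupleLaw.

Section MeasurableProjector.
Context {R : realType} {disp : measure_display} {W : measurableType disp}.

Lemma measurable_fun_inv_ge0 (h : W -> R) : (forall w, 0 <= h w) ->
  measurable_fun setT h -> measurable_fun setT (fun w => (h w)^-1).
Proof.
move=> h0 mh; have -> : (fun w => (h w)^-1) = (fun w => h w `^ (-1)).
  by apply/funext => w; rewrite powR_inv1.
exact: measurableT_comp (measurable_powR _) mh.
Qed.

Definition entrywise_measurable m n (M : W -> 'M[R]_(m, n)) :=
  forall i j, measurable_fun setT (fun w => M w i j).

(** The recursion only adds, multiplies and inverts (with inverse 0 at 0), so
it is measurable in the vectors even though their span may change dimension. *)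
Lemma measurable_gram_schmidt_proj n (vs : seq (W -> 'cV[R]_n)) :
  List.Forall (@entrywise_measurable n 1) vs ->
  entrywise_measurable (fun w => gram_schmidt_proj [seq v w | v <- vs]).
Proof.
elim: vs => [|v vs IH] mvs i j /=.
  by under eq_fun do rewrite mxE; exact: measurable_cst.
have [mv {}mvs] := (List.Forall_inv mvs, List.Forall_inv_tail mvs).
set q := fun w => v w - gram_schmidt_proj [seq u w | u <- vs] *m v w.
have mq : entrywise_measurable q.
  move=> k l; rewrite /q; under eq_fun do rewrite !mxE.
  apply: measurable_funB => //; apply: measurable_sum => k'.
  by apply: measurable_funM => //; exact: IH.
rewrite (_ : (fun w => _) = (fun w => gram_schmidt_proj [seq u w | u <- vs] i j +
    (sqnorm (q w))^-1 * \sum_k q w i k * q w j k)); last first.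
  apply/funext => w; rewrite [LHS]mxE; congr (_ + _).
  rewrite [LHS]mxE [X in _ * X = _]mxE; congr (_ * _).
  by apply: eq_bigr => k _; rewrite [_^T _ _]mxE.
apply: measurable_funD; first exact: IH.
apply: measurable_funM.
  apply: measurable_fun_inv_ge0; first by move=> w; exact: sqnorm_ge0.
  by apply: measurable_sum => k; apply: measurable_funX; exact: mq.
apply: measurable_sum => k; apply: measurable_funM; exact: mq.
Qed.

End MeasurableProjector.

(** * Prediction risk of truncated least squares *)

Section DesignProjection.
Context {R : realType} {U : Type} {K : nat}.
Variable phi : 'I_K -> U -> R.

Definition lincomb (c : 'I_K -> R) (x : U) : R := \sum_j c j * phi j x.

Definition design_proj n (x : 'I_n -> U) : 'M[R]_n :=
  gram_schmidt_proj [seq (\col_i phi j (x i)) | j <- enum 'I_K].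

Lemma design_projP n (x : 'I_n -> U) : orthogonal_projection (design_proj x).
Proof. exact: gram_schmidt_projP. Qed.

Lemma design_proj_lincomb n (x : 'I_n -> U) c :
  design_proj x *m (\col_i lincomb c (x i)) = \col_i lincomb c (x i).
Proof.
have -> : \col_i lincomb c (x i) = \sum_j c j *: (\col_i phi j (x i)) :> 'cV[R]_n.
  by apply/colP => i; rewrite mxE summxE; apply: eq_bigr => j _; rewrite !mxE.
rewrite mulmx_sumr; apply: eq_bigr => j _; rewrite -scalemxAr.
by rewrite gram_schmidt_proj_id //; apply: map_f; rewrite mem_enum.
Qed.

Lemma design_proj_fixedP n (x : 'I_n -> U) (v : 'cV[R]_n) :
  design_proj x *m v = v -> exists c, v = \col_i lincomb c (x i).
Proof.
move=> <-; apply: (gram_schmidt_proj_range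
  (S := fun v : 'cV[R]_n => exists c, v = \col_i lincomb c (x i))).
- exists (fun=> 0); apply/colP => i; rewrite !mxE /lincomb big1 // => j _.
  by rewrite mul0r.
- move=> a u w [c ->] [c' ->]; exists (fun j => a * c j + c' j).
  apply/colP => i; rewrite !mxE /lincomb mulr_sumr -big_split.
  by apply: eq_bigr => j _; rewrite mulrDl mulrA.
- move=> w /mapP[j _ ->]; exists (fun j' => (j' == j)%:R).
  apply/colP => i; rewrite !mxE /lincomb (bigD1 j) //= eqxx mul1r big1 ?addr0 //.
  by move=> j' /negbTE ->; rewrite mul0r.
Qed.

Lemma design_proj_trace n (x : 'I_n -> U) : \tr (design_proj x) <= K%:R.
Proof.
by apply: (le_trans (gram_schmidt_proj_trace _)); rewrite size_map size_enum_ord.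
Qed.

End DesignProjection.

Section InsertRemove.
Context {disp : measure_display} {Z : measurableType disp} {N : nat}.
Implicit Types (i : 'I_N.+1) (q : (N.-tuple Z * Z)%type) (t : N.+1.-tuple Z).

Definition insert_at i q : N.+1.-tuple Z :=
  [tuple if unlift i k is Some j then tnth q.1 j else q.2 | k < N.+1].

Definition remove_at i t : N.-tuple Z := [tuple tnth t (lift i j) | j < N].

Lemma tnth_insert_at i q : tnth (insert_at i q) i = q.2.
Proof. by rewrite tnth_mktuple unlift_none. Qed.

Lemma tnth_insert_at_lift i q j : tnth (insert_at i q) (lift i j) = tnth q.1 j.
Proof. by rewrite tnth_mktuple liftK. Qed.

Lemma insert_atK i q : remove_at i (insert_at i q) = q.1.
Proof. by apply: eq_from_tnth => j; rewrite tnth_mktuple tnth_insert_at_lift. Qed.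

Lemma measurable_insert_at i : measurable_fun setT (insert_at i).
Proof.
apply/measurable_fun_tnthP => k; rewrite /comp.
under eq_fun do rewrite tnth_mktuple.
case: unliftP => [j _|_]; last exact: measurable_snd.
exact: measurableT_comp (measurable_tnth j) measurable_fst.
Qed.

Lemma measurable_remove_at i : measurable_fun setT (remove_at i).
Proof.
apply/measurable_fun_tnthP => j; rewrite /comp.
under eq_fun do rewrite tnth_mktuple.
exact: measurable_tnth.
Qed.

Context {R : realType}.
Variables (m1 : probability (N.-tuple Z) R) (m2 : probability Z R).
Hypothesis m1_iid : forall B, (forall k, measurable (B k)) ->
  fine (m1 (box B)) = \prod_k fine (m2 (B k)).

(** Under independence and equality of the laws, the position at which the new
observation enters the sample is irrelevant. *)
Lemma insert_at_law i i' A : measurable A ->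
  (m1 \x m2)%E (insert_at i @^-1` A) = (m1 \x m2)%E (insert_at i' @^-1` A).
Proof.
have insert_box (k : 'I_N.+1) (B : 'I_N.+1 -> set Z) :
    (forall j, measurable (B j)) ->
    (m1 \x m2)%E (insert_at k @^-1` box B) = (\prod_j fine (m2 (B j)))%:E.
  move=> mB; have -> : insert_at k @^-1` box B = box (fun j : 'I_N => B (lift k j)) `*` B k.
    apply/seteqP; split => [q Bq|q [Bq1 Bq2] j] /=.
      split => /=; last by have := Bq k; rewrite tnth_insert_at.
      by move=> j; have := Bq (lift k j); rewrite tnth_insert_at_lift.
    by rewrite tnth_mktuple; case: unliftP => [j' ->|->] //; exact: (Bq1 j').
  rewrite product_measure1E //; last exact: measurable_box.
  have mbox : measurable (box (fun j : 'I_N => B (lift k j))) by exact: measurable_box.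
  rewrite -[X in (X * _)%E]fineK; last exact: fin_num_measure.
  rewrite -[X in (_ * X)%E]fineK; last exact: fin_num_measure.
  by rewrite -EFinM m1_iid // [in RHS](bigD1_ord k) //= mulrC.
move=> mA.
apply: (tuple_law_unique (m1 := pushforward (m1 \x m2)%E (insert_at i))
  (m2 := pushforward (m1 \x m2)%E (insert_at i'))) => //.
- exact: measurable_insert_at.
- exact: measurable_insert_at.
- move=> mi; apply: (@le_lt_trans _ _ ((m1 \x m2)%E (setT `*` setT))).
    by rewrite /pushforward setXTT.
  rewrite product_measure1E //.
  by rewrite [X in (X * _)%E](probability_setT m1) [X in (_ * X)%E](probability_setT m2) mul1e ltry.
- by move=> mi mi' B mB; apply: etrans (insert_box i B mB) (esym (insert_box i' B mB)).
Qed.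

End InsertRemove.

Section TruncatedLeastSquaresRisk.
Context {R : realType} {disp : measure_display} {U : measurableType disp}.
Context {N K : nat}.
Local Notation Z := (U * R)%type.
Variables (phi : 'I_K -> U -> R) (f0 : U -> R) (sig2 : R).
Variables (m1 : probability (N.-tuple Z) R) (m2 : probability Z R).
Variable ft : N.-tuple Z -> U -> R.
Hypothesis mphi : forall j, measurable_fun setT (phi j).
Hypotheses (mf0 : measurable_fun setT f0) (f0_le1 : forall x, `|f0 x| <= 1).
Hypothesis m1_iid : forall B, (forall k, measurable (B k)) ->
  fine (m1 (box B)) = \prod_k fine (m2 (B k)).

Let zeta (z : Z) : R := z.2 - f0 z.1.

Hypothesis noise_mean : forall (psi : U -> R) (C : R), measurable_fun setT psi ->
  (forall x, `|psi x| <= C) -> (\int[m2]_z (psi z.1 * zeta z)%:E = 0)%E.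
Hypothesis noise_var : forall psi : U -> R, measurable_fun setT psi ->
  (forall x, 0 <= psi x) ->
  (\int[m2]_z (psi z.1 * zeta z ^+ 2)%:E <= sig2%:E * \int[m2]_z (psi z.1)%:E)%E.
Hypothesis mft : measurable_fun setT (fun q : N.-tuple Z * U => ft q.1 q.2).
Hypothesis ft_span : forall s, exists c, forall x, ft s x = lincomb phi c x.
Hypothesis ft_min : forall (s : N.-tuple Z) c,
  \sum_j (ft s (tnth s j).1 - (tnth s j).2) ^+ 2 <=
  \sum_j (lincomb phi c (tnth s j).1 - (tnth s j).2) ^+ 2.
Variable c0 : 'I_K -> R.

Local Notation mu := (m1 \x m2)%E.
Local Notation points t := (fun k => (tnth t k).1).
Let loss (q : N.-tuple Z * Z) : R := (clip1 (ft q.1 q.2.1) - f0 q.2.1) ^+ 2.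
Let lev (t : N.+1.-tuple Z) i j : R := design_proj phi (points t) i j.
Let bias (z : Z) : R := (lincomb phi c0 z.1 - f0 z.1) ^+ 2.

(* The terms into which the upper bound for the sum of the losses splits. *)
Let term (t : N.+1.-tuple Z) (i j : 'I_N.+1) : R :=
  8 * lev t i j * zeta (tnth t i) * zeta (tnth t j) +
  (i == j)%:R * (8 * lev t i i + 8 * bias (tnth t i)
                 + 8 * (lev t i i * zeta (tnth t i) ^+ 2)).

Let sum_lift (F : 'I_N.+1 -> R) i :
  \sum_(j | j != i) F j = \sum_(j < N) F (lift i j).
Proof.
apply: (@addrI _ (F i)); transitivity (\sum_j F j).
  by rewrite [RHS](bigD1 i).
by rewrite (bigD1_ord i).
Qed.

Let loss_sum_le t : \sum_i loss (remove_at i t, tnth t i) <= \sum_i \sum_j term t i j.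
Proof.
pose y : 'cV[R]_N.+1 := \col_k (tnth t k).2.
pose f : 'cV[R]_N.+1 := \col_k f0 (tnth t k).1.
pose b : 'cV[R]_N.+1 := \col_k lincomb phi c0 (tnth t k).1.
pose H := design_proj phi (points t).
have projH : orthogonal_projection H by exact: design_projP.
have yf i : (y - f) i 0 = zeta (tnth t i) by rewrite !mxE.
have bE i : (b - f) i 0 ^+ 2 = bias (tnth t i) by rewrite !mxE.
have levE i j : lev t i j = H i j by [].
have loss_le i : loss (remove_at i t, tnth t i) <=
    8 * H i i + 8 * (H *m y - f) i 0 ^+ 2 + 8 * (H i i * zeta (tnth t i) ^+ 2).
  rewrite -yf; have [c ftE] := ft_span (remove_at i t).
  pose u : 'cV[R]_N.+1 := \col_k lincomb phi c (tnth t k).1.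
  have -> : loss (remove_at i t, tnth t i) = (clip1 (u i 0) - f i 0) ^+ 2.
    by rewrite /loss /= ftE !mxE.
  apply: leave_one_out_risk => //; first exact: design_proj_lincomb; last first.
    by rewrite mxE.
  move=> v /design_proj_fixedP[c' ->].
  rewrite !sum_lift; have := ft_min (remove_at i t) c'.
  under eq_bigr do rewrite tnth_mktuple ftE.
  under [X in _ <= X -> _]eq_bigr do rewrite tnth_mktuple.
  by under [X in _ -> X <= _]eq_bigr do rewrite !mxE;
     under [X in _ -> _ <= X]eq_bigr do rewrite !mxE.
apply: (le_trans (ler_sum _ (fun i _ => loss_le i))).
have := proj_in_sample_risk f y projH (design_proj_lincomb phi (points t) c0).
rewrite -/b => in_sample.
have -> : \sum_i \sum_j term t i j =
    \sum_i (8 * H i i + 8 * (H i i * zeta (tnth t i) ^+ 2))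
    + 8 * (sqnorm (b - f) + \sum_i \sum_j H i j * (y - f) i 0 * (y - f) j 0).
  rewrite mulrDr /sqnorm !mulr_sumr addrA -!big_split /=; apply: eq_bigr => i _.
  rewrite big_split /= [X in _ + X](bigD1 i) //= eqxx mul1r [X in _ + (_ + X)]big1.
    rewrite addr0 addrC; congr (_ + _).
      by rewrite bE /term !levE; ring.
    by rewrite mulr_sumr; apply: eq_bigr => j _; rewrite !yf levE; ring.
  by move=> j; rewrite eq_sym => /negbTE ->; rewrite mul0r.
have -> : \sum_i (8 * H i i + 8 * (H *m y - f) i 0 ^+ 2 + 8 * (H i i * zeta (tnth t i) ^+ 2))
   = \sum_i (8 * H i i + 8 * (H i i * zeta (tnth t i) ^+ 2)) + 8 * sqnorm (H *m y - f).
  by rewrite /sqnorm mulr_sumr -big_split /=; apply: eq_bigr => i _; ring.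
by rewrite lerD2l ler_wpM2l.
Qed.


Hypothesis sig2_ge0 : 0 <= sig2.

Let mzeta : measurable_fun setT zeta.
Proof.
apply: measurable_funB; first exact: measurable_snd.
exact: measurableT_comp mf0 measurable_fst.
Qed.

Let mlincomb c : measurable_fun setT (lincomb phi c).
Proof. by apply: measurable_sum => j; exact: measurable_funM. Qed.

Let mbias : measurable_fun setT bias.
Proof.
apply: measurable_funX; apply: measurable_funB.
  exact: measurableT_comp (mlincomb c0) measurable_fst.
exact: measurableT_comp mf0 measurable_fst.
Qed.

Let mdesign d' (W : measurableType d') (x : W -> 'I_N.+1 -> U) i j :
  (forall k, measurable_fun setT (fun w => x w k)) ->
  measurable_fun setT (fun w => design_proj phi (x w) i j).
Proof.
move=> mx; rewrite /design_proj.
pose vs : seq (W -> 'cV[R]_N.+1) := [seq (fun w => \col_k phi j (x w k)) | j <- enum 'I_K].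
have := measurable_gram_schmidt_proj (vs := vs).
suff mvs : List.Forall (@entrywise_measurable _ _ _ _ 1) vs.
  move=> /(_ mvs i j); congr measurable_fun; apply/funext => w.
  by rewrite /vs -map_comp.
rewrite /vs; elim: (enum 'I_K) => [|a l IH]; constructor => // k k'.
by under eq_fun do rewrite mxE; exact: measurableT_comp (mphi a) (mx k).
Qed.

Let mlev i j : measurable_fun setT (fun t => lev t i j).
Proof.
by apply: mdesign => k; exact: measurableT_comp measurable_fst (measurable_tnth k).
Qed.

Let mcoord (a : Z -> R) i : measurable_fun setT a ->
  measurable_fun setT (fun t : N.+1.-tuple Z => a (tnth t i)).
Proof. by move=> ma; exact: measurableT_comp ma (measurable_tnth i). Qed.

Let mterm i j : measurable_fun setT (fun t => term t i j).
Proof.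
have mz k := mcoord k mzeta.
apply: measurable_funD.
  by apply: measurable_funM => //; apply: measurable_funM => //; exact: measurable_funM.
apply: measurable_funM => //; apply: measurable_funD.
  by apply: measurable_funD; apply: measurable_funM => //; exact: mcoord.
apply: measurable_funM => //; apply: measurable_funM => //.
by apply: measurable_funX.
Qed.

Let mloss : measurable_fun setT loss.
Proof.
have mp : measurable_fun setT (fun q : N.-tuple Z * Z => q.2.1).
  exact: measurableT_comp measurable_fst measurable_snd.
apply: measurable_funX; apply: measurable_funB; last exact: measurableT_comp mf0 mp.
have mt : measurable_fun setT (fun q : N.-tuple Z * Z => ft q.1 q.2.1).
  exact: measurableT_comp mft (measurable_fun_pair measurable_fst mp).
under eq_fun do rewrite clip1E.
apply: measurable_maxr; first exact: measurable_cst.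
by apply: measurable_minr; first exact: measurable_cst.
Qed.

Local Open Scope ereal_scope.

Let mu_snd (a : Z -> R) : measurable_fun setT a -> (forall z, (0 <= a z)%R) ->
  \int[mu]_q (a q.2)%:E = \int[m2]_z (a z)%:E.
Proof.
move=> ma a0; rewrite fubini_tonelli1 /=; last 2 first.
- by apply/measurable_EFinP; exact: measurableT_comp ma measurable_snd.
- by move=> q; rewrite lee_fin.
rewrite /fubini_F /= integral_cst //.
by rewrite [X in _ * X](probability_setT m1) mule1.
Qed.

Let mu_coord (a : Z -> R) k i : measurable_fun setT a -> (forall z, (0 <= a z)%R) ->
  \int[mu]_q (a (tnth (insert_at k q) i))%:E = \int[m2]_z (a z)%:E.
Proof.
move=> ma a0.
rewrite (ge0_integral_transfer (measurable_insert_at k) (measurable_insert_at i)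
  (insert_at_law m1_iid k i) (F := fun t => (a (tnth t i))%:E)) //.
- by under eq_integral do rewrite tnth_insert_at; exact: mu_snd.
- by apply/measurable_EFinP; exact: mcoord.
- by move=> t; rewrite lee_fin.
Qed.

Let mu_coord_integrable (a : Z -> R) k i : m2.-integrable setT (EFin \o a) ->
  mu.-integrable setT (fun q => (a (tnth (insert_at k q) i))%:E).
Proof.
move=> /integrableP[/measurable_EFinP ma aoo]; apply/integrableP; split.
  by apply/measurable_EFinP; exact: measurableT_comp (mcoord i ma) (measurable_insert_at k).
under eq_integral do rewrite -[`|_|]/(`|a (tnth (insert_at k _) i)|%R%:E).
by rewrite (mu_coord (a := fun z => `|a z|%R)) //; exact: measurableT_comp.
Qed.

Let zeta_sqr_integrable : m2.-integrable setT (fun z => (zeta z ^+ 2)%:E).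
Proof.
apply/integrableP; split.
  by apply/measurable_EFinP; exact: measurable_funX.
have := noise_var (psi := fun=> 1%R) (measurable_cst _) (fun=> ler01).
under eq_integral do rewrite mul1r.
move=> h; apply: (@le_lt_trans _ _ (\int[m2]_z (zeta z ^+ 2)%:E)).
  rewrite le_eqVlt; apply/orP; left; apply/eqP; apply: eq_integral => z _.
  by rewrite gee0_abs // lee_fin sqr_ge0.
apply: (le_lt_trans h); rewrite integral_cst // mul1e.
by rewrite [X in _ * X](probability_setT m2) mule1 ltry.
Qed.


Let term_integrable k i j : m2.-integrable setT (EFin \o bias) ->
  mu.-integrable setT (fun q => (term (insert_at k q) i j)%:E).
Proof.
move=> ibias.
pose a z := (12 * zeta z ^+ 2 + (8 + 8 * bias z))%R.
pose b z := (4 * zeta z ^+ 2)%R.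
have iz c : m2.-integrable setT (EFin \o (fun z => c * zeta z ^+ 2)%R).
  exact: (integrableZl measurableT c zeta_sqr_integrable).
have ia : m2.-integrable setT (EFin \o a).
  have i8 : m2.-integrable setT (EFin \o cst 8%R).
    exact: finite_measure_integrable_cst.
  by apply: eq_integrable (integrableD measurableT (iz 12%R)
    (integrableD measurableT i8 (integrableZl measurableT 8%R ibias))).
have iab := integrableD measurableT (mu_coord_integrable k i ia)
  (mu_coord_integrable k j (iz 4%R)).
apply: le_integrable iab => //.
  by apply/measurable_EFinP; exact: measurableT_comp (mterm i j) (measurable_insert_at k).
move=> q _ /=; rewrite lee_fin.
set t := insert_at k q; rewrite /term /a.
have projH : orthogonal_projection (design_proj phi (points t)) by exact: design_projP.
have h1 : (`|lev t i j| <= 1)%R by exact: proj_entry_le1.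
have h2 : (0 <= lev t i i)%R by exact: proj_diag_ge0.
have h3 : (lev t i i <= 1)%R by exact: proj_diag_le1.
have b0 : (0 <= bias (tnth t i))%R by exact: sqr_ge0.
move: b0 h1 h2 h3; set hij := lev t i j; set hii := lev t i i; set B := bias _.
set zi := zeta _; set zj := zeta _ => b0 h1 h2 h3.
have zi0 : (0 <= zi ^+ 2)%R by exact: sqr_ge0.
have zj0 : (0 <= zj ^+ 2)%R by exact: sqr_ge0.
rewrite [leRHS]ger0_norm; last lra.
apply: (le_trans (ler_normD _ _)).
have k1 : (`|8 * hij * zi * zj| <= 4 * zi ^+ 2 + 4 * zj ^+ 2)%R.
  rewrite !normrM (ger0_norm (ler0n R 8)).
  have : (0 <= (`|zi| - `|zj|) ^+ 2)%R by exact: sqr_ge0.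
  rewrite sqrrB !real_normK ?num_real // => k0.
  have k1 : (0 <= `|zi| * `|zj|)%R by rewrite mulr_ge0.
  have k2 : (`|hij| * (`|zi| * `|zj|) <= `|zi| * `|zj|)%R by rewrite ler_piMl.
  by rewrite -2!mulrA; lra.
have k2 : (hii * zi ^+ 2 <= zi ^+ 2)%R by rewrite ler_piMl.
have k3 : (0 <= hii * zi ^+ 2)%R by rewrite mulr_ge0.
have k4 : (`|(i == j)%:R * (8 * hii + 8 * B + 8 * (hii * zi ^+ 2))|
           <= 8 + 8 * B + 8 * zi ^+ 2)%R.
  case: eqP => _; last by rewrite mul0r normr0; lra.
  by rewrite mul1r ger0_norm; lra.
by lra.
Qed.

(* The leverages of the sample s completed by a new point u. *)
Let lev_insert (i j : 'I_N.+1) (s : N.-tuple Z) (u : U) : R :=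
  design_proj phi (fun k => if unlift i k is Some l then (tnth s l).1 else u) i j.

Let lev_insertE i j s z : lev (insert_at i (s, z)) i j = lev_insert i j s z.1.
Proof.
rewrite /lev /lev_insert; congr (design_proj phi _ i j); apply/funext => k.
by rewrite tnth_mktuple; case: unlift.
Qed.

Let mlev_insert i j s : measurable_fun setT (lev_insert i j s).
Proof.
by apply: mdesign => k; case: unlift => [l|]; [exact: measurable_cst|exact: measurable_id].
Qed.

(* For i != j the noise at i is the new one, and everything else in the term
is a bounded function of its design point once the sample is fixed. *)
Let term_offdiag i j : i != j -> m2.-integrable setT (EFin \o bias) ->
  \int[mu]_q (term (insert_at i q) i j)%:E = 0.
Proof.
move=> ij ibias; rewrite -integral12_prod_meas1; last exact: term_integrable.
rewrite (eq_integral (cst 0)) ?integral0 // => s _.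
rewrite /fubini_F /=.
have [l jE] : exists l, j = lift i l.
  by case: (unliftP i j) => [l ->|ji]; [exists l|rewrite ji eqxx in ij].
pose c := (8 * zeta (tnth s l))%R.
rewrite -[RHS](@noise_mean (fun u => c * lev_insert i j s u)%R `|c|%R).
- apply: eq_integral => z _; rewrite /term (negbTE ij) mul0r addr0 lev_insertE.
  by rewrite tnth_insert_at jE tnth_insert_at_lift /c /=; congr (_%:E); ring.
- by apply: measurable_funM => //; exact: mlev_insert.
- move=> u; rewrite normrM ler_piMr //.
  by apply: proj_entry_le1; exact: design_projP.
Qed.

Let term_diag i : m2.-integrable setT (EFin \o bias) ->
  \int[mu]_q (term (insert_at i q) i i)%:E <=
  (16 * sig2 + 8)%:E * \int[mu]_q (lev (insert_at i q) i i)%:E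
  + 8%:E * \int[m2]_z (bias z)%:E.
Proof.
move=> ibias.
have lev0 t : (0 <= lev t i i)%R by apply: proj_diag_ge0; exact: design_projP.
have mins : measurable_fun setT (@insert_at _ Z N i) by exact: measurable_insert_at.
have mlevi : measurable_fun setT (fun q => (lev (insert_at i q) i i)%:E).
  by apply/measurable_EFinP; exact: measurableT_comp (mlev i i) mins.
have mzi : measurable_fun setT (fun q =>
    (lev (insert_at i q) i i * zeta (tnth (insert_at i q) i) ^+ 2)%:E).
  apply/measurable_EFinP.
  apply: measurable_funM; first exact: measurableT_comp (mlev i i) mins.
  by apply: measurable_funX; exact: measurableT_comp (mcoord i mzeta) mins.
have mbi : measurable_fun setT (fun q => (bias (tnth (insert_at i q) i))%:E).
  by apply/measurable_EFinP; exact: measurableT_comp (mcoord i mbias) mins.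
have levz : \int[mu]_q (lev (insert_at i q) i i * zeta (tnth (insert_at i q) i) ^+ 2)%:E
    <= sig2%:E * \int[mu]_q (lev (insert_at i q) i i)%:E.
  rewrite fubini_tonelli1 //; last first.
    by move=> q; rewrite lee_fin mulr_ge0 // sqr_ge0.
  rewrite fubini_tonelli1 //; last by move=> q; rewrite lee_fin.
  rewrite -ge0_integralZl //; last 2 first.
  - apply: (measurable_fun_fubini_tonelli_F (m2 := m2)) => // q.
    by rewrite lee_fin.
  - by move=> s _; apply: integral_ge0 => z _; rewrite lee_fin.
  apply: ge0_le_integral => //.
  - by move=> s _; apply: integral_ge0 => z _; rewrite lee_fin mulr_ge0 // sqr_ge0.
  - apply: (measurable_fun_fubini_tonelli_F (m2 := m2)) => // q.
    by rewrite lee_fin mulr_ge0 // sqr_ge0.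
  - apply: measurable_funeM.
    apply: (measurable_fun_fubini_tonelli_F (m2 := m2)) => // q.
    by rewrite lee_fin.
  - move=> s _; rewrite /fubini_F /=.
    under eq_integral do rewrite tnth_insert_at lev_insertE /=.
    under [X in _ <= _ * X]eq_integral do rewrite lev_insertE /=.
    apply: noise_var; first exact: mlev_insert.
    by move=> u; apply: proj_diag_ge0; exact: design_projP.
have termE q : (term (insert_at i q) i i)%:E =
    16%:E * (lev (insert_at i q) i i * zeta (tnth (insert_at i q) i) ^+ 2)%:E
    + (8%:E * (lev (insert_at i q) i i)%:E + 8%:E * (bias (tnth (insert_at i q) i))%:E).
  by rewrite -!EFinM -!EFinD /term eqxx mul1r; congr (_%:E); ring.
under eq_integral do rewrite termE.
have lz0 q : 0 <= (lev (insert_at i q) i i * zeta (tnth (insert_at i q) i) ^+ 2)%:E.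
  by rewrite lee_fin mulr_ge0 // sqr_ge0.
have l0 q : 0 <= (lev (insert_at i q) i i)%:E by rewrite lee_fin.
have b0 q : 0 <= (bias (tnth (insert_at i q) i))%:E by rewrite lee_fin sqr_ge0.
rewrite ge0_integralD //; last 4 first.
- by move=> q _; rewrite mule_ge0 // lee_fin.
- exact: measurable_funeM.
- by move=> q _; rewrite adde_ge0 // mule_ge0 // lee_fin.
- by apply: emeasurable_funD; exact: measurable_funeM.
rewrite ge0_integralD //; last 4 first.
- by move=> q _; rewrite mule_ge0 // lee_fin.
- exact: measurable_funeM.
- by move=> q _; rewrite mule_ge0 // lee_fin.
- exact: measurable_funeM.
rewrite !ge0_integralZl_EFin // mu_coord //; last by move=> z; exact: sqr_ge0.
rewrite addeA leeD2r // (EFinD (16 * sig2)%R 8%R) ge0_muleDl ?lee_fin ?mulr_ge0 //.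
by rewrite leeD2r // (EFinM 16%R sig2) -muleA lee_wpmul2l // lee_fin.
Qed.

(** Averaging over which of N + 1 observations is predicted from the others turns
the risk into an expected sum of leave-one-out errors, and these are dominated by
the in-sample errors of the fit to all N + 1 observations. The off-diagonal noise
terms have mean zero and the leverages sum to at most K, which leaves a variance
of order K / (N + 1). *)
Theorem truncated_least_squares_risk :
  \int[mu]_q (loss q)%:E <=
  8%:E * \int[m2]_z (bias z)%:E + ((8 + 16 * sig2) * K%:R / N.+1%:R)%:E.
Proof.
have bias0 z : (0 <= bias z)%R by exact: sqr_ge0.
have loss0 q : (0 <= loss q)%R by exact: sqr_ge0.
have [biasoo|biasoo] := eqVneq (\int[m2]_z (bias z)%:E) +oo.
  by rewrite biasoo gt0_muley ?lte_fin // addye ?leey // -ltNye ltNyr.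
have ibias : m2.-integrable setT (EFin \o bias).
  apply/integrableP; split; first exact/measurable_EFinP.
  rewrite (eq_integral (fun z => (bias z)%:E)) ?ltey // => z _.
  by rewrite /= ger0_norm.
pose i0 : 'I_N.+1 := ord0.
have mins i : measurable_fun setT (@insert_at _ Z N i) by exact: measurable_insert_at.
have mlossi i : measurable_fun setT
    (fun t : N.+1.-tuple Z => (loss (remove_at i t, tnth t i))%:E).
  apply/measurable_EFinP; apply: measurableT_comp mloss _.
  by apply: measurable_fun_pair; [exact: measurable_remove_at|exact: measurable_tnth].
have lev0 t i : (0 <= lev t i i)%R by apply: proj_diag_ge0; exact: design_projP.
have lossE i : \int[mu]_q (loss q)%:E =
    \int[mu]_q (loss (remove_at i (insert_at i0 q), tnth (insert_at i0 q) i))%:E.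
  rewrite (ge0_integral_transfer (mins i0) (mins i) (insert_at_law m1_iid i0 i) (mlossi i)).
    by apply: eq_integral => -[s z] _; rewrite insert_atK tnth_insert_at.
  by move=> t; rewrite lee_fin.
have sum_loss : N.+1%:R%:E * \int[mu]_q (loss q)%:E <=
    \sum_i \sum_j \int[mu]_q (term (insert_at i0 q) i j)%:E.
  have -> : N.+1%:R%:E * \int[mu]_q (loss q)%:E = \int[mu]_q
      (\sum_i (loss (remove_at i (insert_at i0 q), tnth (insert_at i0 q) i))%:E).
    rewrite ge0_integral_sum //; last 2 first.
    - by move=> i; exact: measurableT_comp (mlossi i) (mins i0).
    - by move=> i q _; rewrite lee_fin.
    under eq_bigr do rewrite -lossE.
    by rewrite sumr_const card_ord mule_natl.
  have -> : \sum_i \sum_j \int[mu]_q (term (insert_at i0 q) i j)%:E =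
      \int[mu]_q \sum_i \sum_j (term (insert_at i0 q) i j)%:E.
    rewrite integral_sum //; last first.
      by move=> i; apply: integrable_sum => // j _; exact: term_integrable.
    by apply: eq_bigr => i _; rewrite integral_sum // => j; exact: term_integrable.
  apply: ge0_le_integral => //.
  - by move=> q _; rewrite sume_ge0 // => i _; rewrite lee_fin.
  - by apply: emeasurable_sum => i; exact: measurableT_comp (mlossi i) (mins i0).
  - apply: emeasurable_sum => i; apply: emeasurable_sum => j.
    by apply/measurable_EFinP; exact: measurableT_comp (mterm i j) (mins i0).
  - move=> q _; under [leRHS]eq_bigr do rewrite sumEFin.
    by rewrite !sumEFin lee_fin; exact: loss_sum_le.
have termE i j : \int[mu]_q (term (insert_at i0 q) i j)%:E =
    \int[mu]_q (term (insert_at i q) i j)%:E.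
  apply: (integral_transfer (mins i0) (mins i) (insert_at_law m1_iid i0 i)
    (F := fun t => (term t i j)%:E)).
  by apply/measurable_EFinP; exact: mterm.
have levE i : \int[mu]_q (lev (insert_at i q) i i)%:E =
    \int[mu]_q (lev (insert_at i0 q) i i)%:E.
  apply: (integral_transfer (mins i) (mins i0) (insert_at_law m1_iid i i0)
    (F := fun t => (lev t i i)%:E)).
  by apply/measurable_EFinP; exact: mlev.
set B := \int[m2]_z (bias z)%:E in biasoo *.
have diag : \sum_i \sum_j \int[mu]_q (term (insert_at i0 q) i j)%:E <=
    (16 * sig2 + 8)%:E * \sum_i \int[mu]_q (lev (insert_at i0 q) i i)%:E
    + N.+1%:R%:E * (8%:E * B).
  rewrite ge0_sume_distrr; last first.
    by move=> i _; apply: integral_ge0 => q _; rewrite lee_fin.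
  have -> : N.+1%:R%:E * (8%:E * B) = \sum_(i < N.+1) 8%:E * B.
    by rewrite sumr_const card_ord mule_natl.
  rewrite -big_split /=; apply: lee_sum => i _.
  rewrite (bigD1 i) //= big1 ?adde0.
    by rewrite termE -levE; exact: term_diag.
  by move=> j ij; rewrite termE term_offdiag // eq_sym.
have trace : \sum_i \int[mu]_q (lev (insert_at i0 q) i i)%:E <= K%:R%:E.
  rewrite -ge0_integral_sum //; last 2 first.
  - by move=> i; apply/measurable_EFinP; exact: measurableT_comp (mlev i i) (mins i0).
  - by move=> i q _; rewrite lee_fin.
  apply: (@le_trans _ _ (\int[mu]_q (cst K%:R%:E q))).
    apply: ge0_le_integral => //.
    - by move=> q _; rewrite sume_ge0 // => i _; rewrite lee_fin.
    - apply: emeasurable_sum => i; apply/measurable_EFinP.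
      exact: measurableT_comp (mlev i i) (mins i0).
    - by move=> q _; rewrite sumEFin lee_fin; exact: design_proj_trace.
  have mu1 : mu setT = 1.
    rewrite -setXTT product_measure1E //.
    by rewrite [X in X * _](probability_setT m1) [X in _ * X](probability_setT m2) mul1e.
  by rewrite integral_cst // [X in _ * X]mu1 mule1.
have Bfin : B \is a fin_num.
  by rewrite ge0_fin_numE ?ltey // integral_ge0 // => z _; rewrite lee_fin.
have := le_trans sum_loss diag; move: trace.
have : 0 <= \int[mu]_q (loss q)%:E by apply: integral_ge0 => q _; rewrite lee_fin.
move=> E0 trace total.
have {}total : N.+1%:R%:E * \int[mu]_q (loss q)%:E <=
    (16 * sig2 + 8)%:E * K%:R%:E + N.+1%:R%:E * (8%:E * B).
  apply: (le_trans total); rewrite leeD2r // lee_wpmul2l // lee_fin.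
  by rewrite addr_ge0 // mulr_ge0.
move: total E0; rewrite -(fineK Bfin).
case: (\int[mu]_q _) => [r| |] //; last by rewrite gt0_muley ?lte_fin ?ltr0n.
rewrite -!EFinM -!EFinD !lee_fin => total r0.
have N0 : (0 < N.+1%:R :> R)%R by rewrite ltr0n.
rewrite -(ler_pM2l N0) (le_trans total) // le_eqVlt; apply/orP; left; apply/eqP.
by move: N0; set n := (N.+1%:R)%R => N0; field; rewrite gt_eqF.
Qed.

End TruncatedLeastSquaresRisk.

(** * Conditional moments of the noise *)

Section ConditionalMoments.
Local Open Scope ereal_scope.
Context {R : realType} {d1 d2 : measure_display}.
Context {T : measurableType d1} {U : measurableType d2}.
Variable P : probability T R.
Variable X : T -> U.
Hypothesis mX : measurable_fun setT X.

Let mpre (B : set U) : measurable B -> measurable (X @^-1` B).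
Proof. by move=> mB; rewrite -[X in measurable X]setTI; exact: mX. Qed.

Import HBNNSimple.

(** The comparison extends from indicators to simple functions by linearity and
then to all weights by monotone convergence. *)
Lemma le_integral_weighted (W1 W2 : T -> R) :
  measurable_fun setT W1 -> measurable_fun setT W2 ->
  (forall w, (0 <= W1 w)%R) -> (forall w, (0 <= W2 w)%R) ->
  (forall B, measurable B ->
    \int[P]_(w in X @^-1` B) (W1 w)%:E <= \int[P]_(w in X @^-1` B) (W2 w)%:E) ->
  forall psi : U -> R, measurable_fun setT psi -> (forall x, (0 <= psi x)%R) ->
  \int[P]_w (psi (X w) * W1 w)%:E <= \int[P]_w (psi (X w) * W2 w)%:E.
Proof.
move=> mW1 mW2 W1_ge0 W2_ge0 W12 psi mpsi psi0.
have mpsiE : measurable_fun setT (EFin \o psi) by exact/measurable_EFinP.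
pose g := nnsfun_approx measurableT mpsiE.
have gcvg x : EFin \o g ^~ x @ \oo --> (psi x)%:E.
  by apply: cvg_nnsfun_approx => // y _; rewrite lee_fin.
have gnd : nondecreasing_seq (g : (U -> R)^nat) by exact: nd_nnsfun_approx.
have g_le n x : (g n x <= psi x)%R.
  rewrite -lee_fin -(cvg_lim _ (gcvg x)) //.
  apply: lime_ge; first by apply/cvg_ex; exists (psi x)%:E.
  by exists n => // m /= nm; rewrite lee_fin; exact/lefP/gnd.
have mgX n : measurable_fun setT (fun w => g n (X w)) by exact: measurableT_comp.
have g0 n x : (0 <= g n x)%R by exact: fun_ge0.
have simple n (W : T -> R) : measurable_fun setT W -> (forall w, (0 <= W w)%R) ->
    \int[P]_w (g n (X w) * W w)%:E = \sum_(y \in range (g n))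
      (y%:E * \int[P]_(w in X @^-1` (g n @^-1` [set y])) (W w)%:E).
  move=> mW W0.
  under eq_integral => w _.
    rewrite fimfunE mulrC fsbig_finite //= mulr_sumr -sumEFin.
    over.
  have mgy y : measurable (g n @^-1` [set y]).
    by rewrite -[X in measurable X]setTI; exact: measurable_funP.
  have m1y y : measurable_fun setT (fun w => \1_(g n @^-1` [set y]) (X w) : R).
    by apply: measurableT_comp mX; exact: measurable_indic.
  rewrite ge0_integral_sum //; last 2 first.
  - move=> y; apply/measurable_EFinP; apply: measurable_funM => //.
    exact: measurable_funM.
  - move=> y w _; rewrite lee_fin mulr_ge0 // indicE.
    by case: (boolP (_ \in _)) => [|_]; rewrite ?mulr0 // inE /= mulr1 => <-.
  rewrite fsbig_finite //=; apply: eq_big_seq => y.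
  rewrite in_fset_set // inE => -[x _ yE].
  rewrite (integral_mkcond (X @^-1` _)) -ge0_integralZl //; last 3 first.
  - apply/(measurable_restrictT _ (mpre (mgy y))).
    exact/measurable_EFinP/measurable_funTS.
  - move=> w _; rewrite patchE; case: ifP => // _.
    by rewrite lee_fin.
  - by rewrite lee_fin -yE.
  apply: eq_integral => w _; rewrite patchE indicE.
  have -> : (w \in X @^-1` (g n @^-1` [set y])) = (X w \in g n @^-1` [set y]).
    by apply/idP/idP; rewrite !inE.
  by case: (_ \in _); rewrite ?mulr1 ?mulr0 ?mule0 // -EFinM mulrC.
have le_simple n : \int[P]_w (g n (X w) * W1 w)%:E <= \int[P]_w (g n (X w) * W2 w)%:E.
  rewrite !simple // !fsbig_finite //=; rewrite big_seq [leRHS]big_seq.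
  apply: lee_sum => y; rewrite in_fset_set // inE => -[x _ <-].
  rewrite lee_wpmul2l ?lee_fin //; apply: W12.
  by rewrite -[X in measurable X]setTI; exact: measurable_funP.
have mono (W : T -> R) : measurable_fun setT W -> (forall w, (0 <= W w)%R) ->
    \int[P]_w (g n (X w) * W w)%:E @[n --> \oo] --> \int[P]_w (psi (X w) * W w)%:E.
  move=> mW W0.
  have -> : \int[P]_w (psi (X w) * W w)%:E =
      \int[P]_w limn (fun n => (g n (X w) * W w)%:E).
    apply: eq_integral => w _; apply/esym/cvg_lim => //.
    rewrite EFinM; under eq_fun do rewrite EFinM.
    apply: cvgeZr => //; exact: gcvg.
  apply: cvg_monotone_convergence => //.
  - by move=> n; apply/measurable_EFinP; exact: measurable_funM.
  - by move=> n w _; rewrite lee_fin mulr_ge0.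
  - move=> w _ a b ab; rewrite lee_fin ler_wpM2r //.
    by move/lefP: (gnd _ _ ab); exact.
rewrite -(cvg_lim _ (mono _ mW1 W1_ge0)) // -(cvg_lim _ (mono _ mW2 W2_ge0)) //.
apply: lee_lim.
- by apply/cvg_ex; eexists; exact: mono mW1 W1_ge0.
- by apply/cvg_ex; eexists; exact: mono mW2 W2_ge0.
- exact: nearW.
Qed.


(** Positive and negative part of W have the same integrals over the sets of
the sigma-algebra of X, hence against all nonnegative weights; a bounded weight
is a nonnegative one up to a constant. *)
Lemma integral_weighted_eq0 (W : T -> R) :
  P.-integrable setT (EFin \o W) ->
  (forall B, measurable B -> \int[P]_(w in X @^-1` B) (W w)%:E = 0) ->
  forall (psi : U -> R) (C : R), measurable_fun setT psi ->
  (forall x, (`|psi x| <= C)%R) ->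
  \int[P]_w (psi (X w) * W w)%:E = 0.
Proof.
move=> iW W0 psi C mpsi psiC.
have mW : measurable_fun setT W by apply/measurable_EFinP; exact: measurable_int iW.
pose Wp w := Num.max (W w) 0%R; pose Wn w := Num.max (- W w)%R 0%R.
have mWp : measurable_fun setT Wp by apply: measurable_maxr => //; exact: measurable_cst.
have mWn : measurable_fun setT Wn.
  by apply: measurable_maxr; [exact: measurable_funN|exact: measurable_cst].
have Wp0 w : (0 <= Wp w)%R by rewrite le_max lexx orbT.
have Wn0 w : (0 <= Wn w)%R by rewrite le_max lexx orbT.
have WE w : W w = (Wp w - Wn w)%R.
  by rewrite /Wp /Wn; case: (leP (W w) 0%R) => h; case: (leP (- W w)%R 0%R) => h'; lra.
have iWp : P.-integrable setT (EFin \o Wp).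
  apply: le_integrable iW => //; first exact/measurable_EFinP.
  move=> w _ /=; rewrite lee_fin (ger0_norm (Wp0 w)) /Wp.
  by case: (leP (W w) 0%R) => h //; exact: ler_norm.
have iWn : P.-integrable setT (EFin \o Wn).
  apply: le_integrable iW => //; first exact/measurable_EFinP.
  move=> w _ /=; rewrite lee_fin (ger0_norm (Wn0 w)) /Wn -normrN.
  by case: (leP (- W w)%R 0%R) => h //; exact: ler_norm.
have Wpn B : measurable B ->
    \int[P]_(w in X @^-1` B) (Wp w)%:E = \int[P]_(w in X @^-1` B) (Wn w)%:E.
  move=> mB; have := W0 B mB.
  under eq_integral do rewrite WE EFinB.
  have ip : P.-integrable (X @^-1` B) (EFin \o Wp).
    by apply: integrableS iWp => //; exact: mpre.
  have in_ : P.-integrable (X @^-1` B) (EFin \o Wn).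
    by apply: integrableS iWn => //; exact: mpre.
  rewrite integralB //=; last exact: mpre.
  have pfin : \int[P]_(w in X @^-1` B) (Wp w)%:E \is a fin_num.
    by apply: integrable_fin_num => //; exact: mpre.
  have nfin : \int[P]_(w in X @^-1` B) (Wn w)%:E \is a fin_num.
    by apply: integrable_fin_num => //; exact: mpre.
  by rewrite -(fineK pfin) -(fineK nfin) -EFinB => -[] /subr0_eq ->.
pose psi' x := (psi x + C)%R.
have psi'0 x : (0 <= psi' x)%R by have := psiC x; rewrite ler_norml /psi'; lra.
have mpsi' : measurable_fun setT psi' by apply: measurable_funD.
have e1 : \int[P]_w (psi' (X w) * Wp w)%:E = \int[P]_w (psi' (X w) * Wn w)%:E.
  by apply/eqP; rewrite eq_le; apply/andP; split; apply: le_integral_weighted => // B mB;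
    rewrite Wpn.
have iweight (V : T -> R) : P.-integrable setT (EFin \o V) -> (forall w, (0 <= V w)%R) ->
    P.-integrable setT (fun w => (psi' (X w) * V w)%:E).
  move=> iV V0; apply: le_integrable (integrableZl measurableT (2 * C)%R iV) => //.
    apply/measurable_EFinP; apply: measurable_funM; first exact: measurableT_comp.
    by apply/measurable_EFinP; exact: measurable_int iV.
  move=> w _ /=; rewrite lee_fin !normrM ler_wpM2r // (ger0_norm (psi'0 _)).
  have := psiC (X w); rewrite ler_norml /psi' => /andP[h1 h2].
  by rewrite -normrM; apply: (le_trans _ (ler_norm _)); lra.
have e2 : \int[P]_w (Wp w)%:E = \int[P]_w (Wn w)%:E.
  by have := Wpn setT measurableT; rewrite preimage_setT.
have -> : \int[P]_w (psi (X w) * W w)%:E = \int[P]_w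
    ((((psi' (X w) * Wp w)%:E - (psi' (X w) * Wn w)%:E)) - C%:E * ((Wp w)%:E - (Wn w)%:E)).
  apply: eq_integral => w _; rewrite WE.
  by have -> : (psi (X w) * (Wp w - Wn w) =
    psi' (X w) * Wp w - psi' (X w) * Wn w - C * (Wp w - Wn w))%R by rewrite /psi'; ring.
have ipn : P.-integrable setT (fun w => (Wp w)%:E - (Wn w)%:E) by exact: integrableB.
have i1 := iweight _ iWp Wp0; have i2 := iweight _ iWn Wn0.
rewrite integralB //; last 2 first.
- exact: integrableB.
- exact: integrableZl.
rewrite integralB // integralZl // integralB // e1 e2.
by rewrite !subee ?mule0 ?sub0e ?oppe0 //; apply: integrable_fin_num.
Qed.

(** With E[zeta | X] = 0 the conditional mean subtracted in the conditional
variance vanishes almost surely, whichever version of it was used. *)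
Lemma cond_var_second_moment (zeta e v : T -> R) (s2 : R) :
  is_cond_exp P X zeta e -> {ae P, forall w, e w = 0%R} ->
  is_cond_var P X zeta v -> {ae P, forall w, (v w <= s2)%R} ->
  [/\ P.-integrable setT (EFin \o zeta),
      (forall B, measurable B -> \int[P]_(w in X @^-1` B) (zeta w)%:E = 0) &
      forall B, measurable B ->
        \int[P]_(w in X @^-1` B) (zeta w ^+ 2)%:E <= \int[P]_(w in X @^-1` B) s2%:E].
Proof.
move=> [izeta ie _ eE] e0 [M [_ iM mM ME]] [iz2 iv _ vE] vs2.
have sX B : measurable B -> g_sigma_algebra_preimage X (X @^-1` B).
  by move=> mB; exists B => //; rewrite setTI.
have msX A : g_sigma_algebra_preimage X A -> measurable A.
  by move=> [B mB <-]; rewrite setTI; exact: mpre.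
have zeta0 A : g_sigma_algebra_preimage X A -> \int[P]_(w in A) (zeta w)%:E = 0.
  move=> sA; rewrite -eE //; have mA := msX _ sA.
  rewrite (ae_eq_integral (cst 0)) ?integral0 //.
  - apply/measurable_funTS; exact: measurable_int ie.
  - by apply: filterS e0 => w /= -> .
have M0half (b : bool) : {ae P, forall w, (0 <= (-1) ^+ b * M w)%R -> M w = 0%R}.
  pose A := [set w | (0 <= (-1) ^+ b * M w)%R].
  have sA : g_sigma_algebra_preimage X A.
    have -> : A = M @^-1` [set x | (0 <= (-1) ^+ b * x)%R] by [].
    apply: mM; rewrite -[X in measurable X]setTI.
    rewrite (_ : [set x | _] = (fun x => (-1) ^+ b * x)%R @^-1` `[0%R, +oo[%classic).
      by apply: mulrl_measurable => //; exact: measurable_itv.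
    by apply/seteqP; split => x /=; rewrite in_itv /= andbT.
  have mA := msX _ sA.
  have iMA : P.-integrable A (EFin \o M) by apply: integrableS iM.
  have : \int[P]_(w in A) `|(M w)%:E| = 0.
    rewrite (eq_integral (fun w => ((-1) ^+ b)%:E * (M w)%:E)).
      by rewrite integralZl // ME // zeta0 // mule0.
    move=> w; rewrite inE /A /= => Mw; rewrite -EFinM; congr (_%:E).
    by rewrite -(ger0_norm Mw) normrM normrX normrN1 expr1n mul1r.
  move/ae_eq_integral_abs => /(_ mA).
  have mMA : measurable_fun A (EFin \o M) by exact: measurable_int iMA.
  move=> /(_ mMA); apply: filterS => w /= h Mw.
  by have := h Mw => -[].
have M0 : {ae P, forall w, M w = 0%R}.
  have := M0half true; have := M0half false; apply: filterS2 => w.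
  rewrite expr0 expr1 mul1r mulN1r oppr_ge0 => h1 h2.
  by case: (leP 0%R (M w)) => [/h1|/ltW /h2].
split => // [B mB|B mB]; first by apply: zeta0; exact: sX.
have mzeta : measurable_fun setT zeta by apply/measurable_EFinP; exact: measurable_int izeta.
have mB' := mpre mB.
have mv : measurable_fun setT v by apply/measurable_EFinP; exact: measurable_int iv.
have mM' : measurable_fun setT M by apply/measurable_EFinP; exact: measurable_int iM.
have -> : \int[P]_(w in X @^-1` B) (zeta w ^+ 2)%:E =
    \int[P]_(w in X @^-1` B) ((zeta w - M w) ^+ 2)%:E.
  apply: ge0_ae_eq_integral => //.
  - by apply/measurable_funTS/measurable_EFinP; exact: measurable_funX.
  - apply/measurable_funTS/measurable_EFinP; apply: measurable_funX.
    exact: measurable_funB.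
  - by move=> w _; rewrite lee_fin sqr_ge0.
  - by move=> w _; rewrite lee_fin sqr_ge0.
  - by apply: filterS M0 => w /= -> _; rewrite subr0.
rewrite -vE; last exact: sX.
have -> : \int[P]_(w in X @^-1` B) (v w)%:E =
    \int[P]_(w in X @^-1` B) (Num.min (v w) s2)%:E.
  apply: ae_eq_integral => //.
  - by apply/measurable_funTS/measurable_EFinP.
  - by apply/measurable_funTS/measurable_EFinP; apply: measurable_minr.
  - by apply: filterS vs2 => w /= vw _; rewrite min_l.
have ivB : P.-integrable (X @^-1` B) (EFin \o v) by exact: integrableS iv.
have is2 : P.-integrable (X @^-1` B) (EFin \o cst s2).
  by apply: finite_measure_integrable_cst.
apply: le_integral => //; last by move=> w _; rewrite lee_fin ge_min lexx orbT.
apply: le_integrable (integrableD _ (integrable_abse ivB) (integrable_abse is2)) => //.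
  by apply/measurable_funTS/measurable_EFinP; apply: measurable_minr.
move=> w _ /=; rewrite lee_fin [leRHS]ger0_norm ?addr_ge0 //.
by rewrite minEle; case: ifP => _; rewrite ?lerDl ?lerDr.
Qed.

End ConditionalMoments.

(** * Measurability in Euclidean coordinates *)

Section MeasurableColumns.
Context {R : realType}.

Lemma measurable_coord n (i : 'I_n) : measurable_fun setT (fun x : 'cV[R]_n => x i 0).
Proof.
move=> _ Y mY; rewrite setTI; apply: sub_sigma_algebra => /=.
rewrite -bigcup_seq/=; exists i => /=; first by rewrite mem_index_enum.
by exists Y => //; rewrite setTI.
Qed.

Lemma measurable_fun_column d (T : measurableType d) n (f : T -> 'cV[R]_n) :
  (forall i, measurable_fun setT (fun w => f w i 0)) -> measurable_fun setT f.
Proof.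
move=> mf; apply: (measurability
  (\big[setU/set0]_(i < n) preimage_set_system setT (fun x : 'cV[R]_n => x i 0) measurable)).
  by [].
move=> _ [B + <-]; rewrite -bigcup_seq => -[i _ [C mC <-]].
by rewrite !setTI -[X in measurable X]setTI; exact: mf.
Qed.

Lemma measurable_mulmx d (T : measurableType d) m n (M : 'M[R]_(m, n)) (f : T -> 'cV[R]_n) :
  measurable_fun setT f -> measurable_fun setT (fun w => M *m f w).
Proof.
move=> mf; apply: measurable_fun_column => i.
under eq_fun do rewrite mxE.
apply: measurable_sum => j; apply: measurable_funM => //.
exact: measurableT_comp (measurable_coord j) mf.
Qed.

Lemma measurable_sqnorm n : measurable_fun setT (@sqnorm R n).
Proof.
by apply: measurable_sum => i; apply: measurable_funX; exact: measurable_coord.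
Qed.

Lemma enormE n (x : 'cV[R]_n) : enorm x = Num.sqrt (sqnorm x).
Proof. by []. Qed.

Lemma enorm_ge0 n (x : 'cV[R]_n) : 0 <= enorm x.
Proof. exact: sqrtr_ge0. Qed.

Lemma sqr_enorm n (x : 'cV[R]_n) : enorm x ^+ 2 = sqnorm x.
Proof. by rewrite sqr_sqrtr // sqnorm_ge0. Qed.

Lemma eball_sqrt n (a : R) (x : 'cV[R]_n) : 0 <= a ->
  eball (Num.sqrt a) x <-> sqnorm x <= a.
Proof. by move=> a0; rewrite /eball /= enormE ler_sqrt. Qed.

End MeasurableColumns.

(** * Sub-Gaussian vectors *)

(** Jensen, through the tangent of exp at the average of its arguments. *)
Lemma expR_mean_le (R : realType) (n : nat) (y : 'I_n -> R) : (0 < n)%N ->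
  expR ((\sum_j y j) / n%:R) <= (\sum_j expR (y j)) / n%:R.
Proof.
move=> n0; have n0R : 0 < n%:R :> R by rewrite ltr0n.
set m := _ / _.
rewrite ler_pdivlMr //.
have -> : expR m * n%:R = \sum_(j < n) expR m * (1 + (y j - m)).
  rewrite -mulr_sumr big_split /= sumrB !sumr_const card_ord -[m *+ n]mulr_natr.
  by rewrite /m divfK ?gt_eqF // subrr addr0.
apply: ler_sum => j _.
have -> : expR (y j) = expR m * expR (y j - m) by rewrite -expRD addrC subrK.
by rewrite ler_wpM2l ?expR_ge0 // expR_ge1Dx.
Qed.

Section SubGaussianVectors.
Context {R : realType} {d : measure_display} {T : measurableType d}.
Context (P : probability T R) {D : nat} (X : T -> 'cV[R]_D).
Hypotheses (D0 : (0 < D)%N) (mX : measurable_fun setT X) (sX : sub_gaussian P X).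
Local Open Scope ereal_scope.

Let psi := fine (psi2_vec P X).

Lemma psi2_ge0 (Z : T -> R) : 0 <= psi2 P Z.
Proof. by apply: le_ereal_inf_tmp => _ [t [t0 _] <-]; rewrite lee_fin ltW. Qed.

Let psi2_coord (j : 'I_D) : psi2 P (fun w => X w j ord0) <= psi2_vec P X.
Proof.
apply: ereal_sup_ubound; exists (delta_mx j ord0) => /=.
  rewrite enormE /sqnorm (bigD1 j) //= mxE !eqxx expr1n big1 ?addr0 ?sqrtr1 //.
  by move=> i /negbTE ij; rewrite mxE ij expr0n.
congr psi2; apply/funext => w; rewrite mxE (bigD1 j) //= !mxE !eqxx mul1r.
by rewrite big1 ?addr0 // => i /negbTE ij; rewrite !mxE ij mul0r.
Qed.

Let psiE : psi2_vec P X = psi%:E.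
Proof.
rewrite fineK // ge0_fin_numE //.
exact: le_trans (psi2_ge0 _) (psi2_coord (Ordinal D0)).
Qed.

Lemma psi2_vec_ge0 : (0 <= psi)%R.
Proof.
rewrite -lee_fin -psiE.
exact: le_trans (psi2_ge0 _) (psi2_coord (Ordinal D0)).
Qed.

Let mcoordX j : measurable_fun setT (fun w => X w j ord0).
Proof. exact: measurableT_comp (measurable_coord j) mX. Qed.

Let exp_coord j (t : R) : (psi < t)%R ->
  \int[P]_w (expR (X w j ord0 ^+ 2 / t ^+ 2))%:E <= 2%:E.
Proof.
move=> psit; have : psi2 P (fun w => X w j ord0) < t%:E.
  by apply: (le_lt_trans (psi2_coord j)); rewrite psiE lte_fin.
move=> /ereal_inf_lt[_ [u [u0 uE] <-]]; rewrite lte_fin => ut.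
have mexp c : measurable_fun setT (fun w => (expR (X w j ord0 ^+ 2 / c))%:E).
  apply/measurable_EFinP; apply: measurableT_comp; first exact: measurable_expR.
  by apply: measurable_funM => //; apply: measurable_funX.
apply: le_trans uE; rewrite unlock; apply: ge0_le_integral => //.
move=> w _; rewrite lee_fin ler_expR ler_wpM2l ?sqr_ge0 //.
rewrite lef_pV2 ?posrE ?exprn_gt0 //; last exact: lt_trans ut.
by rewrite lerXn2r ?nnegrE ?ltW // (lt_trans u0).
Qed.

(** The squared norm divided by D is the mean of the squared coordinates, each of
which is the square of a one-dimensional projection of X. *)
Lemma sub_gaussian_exp_sqnorm (t : R) : (psi < t)%R ->
  \int[P]_w (expR (sqnorm (X w) / (D%:R * t ^+ 2)))%:E <= 2%:E.
Proof.
move=> psit; have D0R : (0 < D%:R :> R)%R by rewrite ltr0n.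
have mexp j : measurable_fun setT (fun w => (expR (X w j ord0 ^+ 2 / t ^+ 2))%:E).
  apply/measurable_EFinP; apply: measurableT_comp; first exact: measurable_expR.
  by apply: measurable_funM => //; apply: measurable_funX.
apply: (@le_trans _ _ (\int[P]_w (D%:R^-1%:E * \sum_j (expR (X w j ord0 ^+ 2 / t ^+ 2))%:E))).
  apply: ge0_le_integral => //.
  - apply/measurable_EFinP; apply: measurableT_comp; first exact: measurable_expR.
    by apply: measurable_funM => //; exact: measurableT_comp (@measurable_sqnorm _ _) mX.
  - by apply: measurable_funeM; exact: emeasurable_sum.
  - move=> w _; rewrite sumEFin -EFinM lee_fin.
    have -> : (sqnorm (X w) / (D%:R * t ^+ 2) =
        (\sum_j X w j ord0 ^+ 2 / t ^+ 2) / D%:R)%R.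
      by rewrite -mulr_suml invfM mulrA mulrAC.
    by rewrite [leRHS]mulrC; exact: (expR_mean_le _ D0).
rewrite ge0_integralZl_EFin ?invr_ge0 //; last 2 first.
- by move=> w _; rewrite sume_ge0 // => j _; rewrite lee_fin expR_ge0.
- exact: emeasurable_sum.
rewrite ge0_integral_sum //.
apply: (@le_trans _ _ (D%:R^-1%:E * \sum_(j < D) 2%:E)).
  by rewrite lee_wpmul2l ?lee_fin ?invr_ge0 // lee_sum // => j _; exact: exp_coord.
rewrite sumEFin -EFinM lee_fin sumr_const card_ord -[(2 *+ D)%R]mulr_natl mulrA mulVf ?mul1r //.
by rewrite gt_eqF.
Qed.


(** Markov's inequality for the exponential moment with parameter t > psi; letting
t decrease to psi reaches the radius at psi itself and also covers psi = 0. *)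
Lemma sub_gaussian_tail (N : nat) : (1 < N)%N ->
  P [set w | (D%:R * psi ^+ 2 * ln N%:R < sqnorm (X w))%R] <= (2 / N%:R)%:E.
Proof.
move=> N1; have N0R : (0 < N%:R :> R)%R by rewrite ltr0n (ltn_trans _ N1).
have D0R : (0 < D%:R :> R)%R by rewrite ltr0n.
have lnN : (0 < ln N%:R :> R)%R by rewrite ln_gt0 // ltr1n.
have mS a : measurable [set w | (a < sqnorm (X w))%R].
  rewrite -[X in measurable X]setTI.
  rewrite (_ : [set w | _] = (sqnorm \o X) @^-1` `]a, +oo[%classic).
    exact: (measurableT_comp (@measurable_sqnorm _ _) mX).
  by apply/seteqP; split => w /=; rewrite in_itv /= andbT.
have tail t : (psi < t)%R ->
    P [set w | (D%:R * t ^+ 2 * ln N%:R < sqnorm (X w))%R] <= (2 / N%:R)%:E.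
  move=> psit; have t0 : (0 < t)%R by exact: le_lt_trans psi2_vec_ge0 psit.
  have Dt0 : (0 < D%:R * t ^+ 2)%R by rewrite mulr_gt0 // exprn_gt0.
  set S := [set w | _].
  have /le_trans : N%:R%:E * P S <= \int[P]_w (expR (sqnorm (X w) / (D%:R * t ^+ 2)))%:E.
    have mexp : measurable_fun setT (fun w => (expR (sqnorm (X w) / (D%:R * t ^+ 2)))%:E).
      apply/measurable_EFinP; apply: measurableT_comp; first exact: measurable_expR.
      by apply: measurable_funM => //; exact: measurableT_comp (@measurable_sqnorm _ _) mX.
    rewrite -integral_cst; last exact: mS.
    apply: (@le_trans _ _ (\int[P]_(w in S) (expR (sqnorm (X w) / (D%:R * t ^+ 2)))%:E)).
      apply: ge0_le_integral => //.
      - exact: mS.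
      - by move=> w _; rewrite /= lee_fin.
      - exact: measurable_funTS.
      move=> w /= Sw; rewrite lee_fin -[leLHS]lnK ?posrE // ler_expR ler_pdivlMr //.
      by rewrite mulrC ltW.
    by apply: ge0_subset_integral => //; exact: mS.
  move=> /(_ _ (sub_gaussian_exp_sqnorm psit)).
  have Sfin : P S \is a fin_num by apply: fin_num_measure; exact: mS.
  rewrite -(fineK Sfin) -EFinM !lee_fin => h.
  by rewrite ler_pdivlMr // mulrC.
pose t n := (psi + n.+1%:R^-1)%R.
pose F n := [set w | (D%:R * t n ^+ 2 * ln N%:R < sqnorm (X w))%R].
have ndF : nondecreasing_seq F.
  move=> m n mn; apply/subsetPset => w /=; apply: le_lt_trans.
  rewrite ler_pM2r // ler_pM2l // lerXn2r ?nnegrE ?addr_ge0 ?invr_ge0 ?psi2_vec_ge0 //.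
  by rewrite lerD2l lef_pV2 ?posrE // ler_nat.
have -> : [set w | (D%:R * psi ^+ 2 * ln N%:R < sqnorm (X w))%R] = \bigcup_n F n.
  apply/seteqP; split => w /=; last first.
    move=> [n _]; rewrite /F /=; apply: le_lt_trans.
    rewrite ler_pM2r // ler_pM2l // lerXn2r ?nnegrE ?addr_ge0 ?invr_ge0 ?psi2_vec_ge0 //.
    by rewrite lerDl invr_ge0.
  rewrite -mulrA mulrCA -ltr_pdivlMr ?mulr_gt0 // => h.
  set a := (_ / _)%R in h.
  have a0 : (0 <= a)%R by exact: le_trans (sqr_ge0 _) (ltW h).
  have : (psi < Num.sqrt a)%R.
    by rewrite -(ger0_norm psi2_vec_ge0) -sqrtr_sqr ltr_sqrt // (le_lt_trans _ h) // sqr_ge0.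
  move=> /ltr_add_invr[n hn]; exists n => //.
  rewrite /F /= -mulrA mulrCA -ltr_pdivlMr ?mulr_gt0 // -/a -[ltRHS]sqr_sqrtr //.
  by rewrite ltrXn2r // ?nnegrE ?sqrtr_ge0 // addr_ge0 ?invr_ge0 // psi2_vec_ge0.
have FU := nondecreasing_cvg_mu (mu := P) (fun n => mS _) (bigcup_measurable (fun n _ => mS _)) ndF.
rewrite -(cvg_lim _ FU) //; apply: lime_le.
  by apply/cvg_ex; eexists; exact: FU.
by apply: nearW => n; apply: tail; rewrite ltrDl invr_gt0.
Qed.

(** The exponential dominates every power. *)
Lemma sub_gaussian_moment (n : nat) :
  \int[P]_w ((1 + sqnorm (X w)) ^+ n)%:E < +oo.
Proof.
pose t := (psi + 1)%R.
have psit : (psi < t)%R by rewrite ltrDl.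
have t0 : (0 < t)%R by exact: le_lt_trans psi2_vec_ge0 psit.
have D0R : (0 < D%:R :> R)%R by rewrite ltr0n.
pose b := (D%:R * t ^+ 2)%R.
have b0 : (0 < b)%R by rewrite mulr_gt0 // exprn_gt0.
pose C := (b ^+ n * n`!%:R * expR b^-1)%R.
have C0 : (0 <= C)%R by rewrite !mulr_ge0 ?expR_ge0 // exprn_ge0 // ltW.
have mS : measurable_fun setT (fun w => sqnorm (X w)).
  exact: measurableT_comp (@measurable_sqnorm _ _) mX.
have mexp : measurable_fun setT (fun w => (expR (sqnorm (X w) / b))%:E).
  apply/measurable_EFinP; apply: measurableT_comp; first exact: measurable_expR.
  exact: measurable_funM.
apply: (@le_lt_trans _ _ (C%:E * \int[P]_w (expR (sqnorm (X w) / b))%:E)); last first.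
  have := sub_gaussian_exp_sqnorm psit; rewrite -/b => h.
  by apply: (@le_lt_trans _ _ (C%:E * 2%:E)); [rewrite lee_wpmul2l // lee_fin|rewrite -EFinM ltry].
rewrite -ge0_integralZl_EFin //.
apply: ge0_le_integral => //.
- by move=> w _; rewrite lee_fin exprn_ge0 // addr_ge0 // sqnorm_ge0.
- apply/measurable_EFinP; apply: measurable_funX; exact: measurable_funD.
- exact: measurable_funeM.
- move=> w _; rewrite -EFinM lee_fin.
  have s0 : (0 <= sqnorm (X w))%R by exact: sqnorm_ge0.
  set s := sqnorm (X w) in s0 *.
  have y0 : (0 <= (1 + s) / b)%R by rewrite divr_ge0 ?addr_ge0 // ltW.
  have -> : (C * expR (s / b) = b ^+ n * n`!%:R * expR ((1 + s) / b))%R.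
    by rewrite /C -mulrA -expRD mulrDl mul1r.
  have -> : ((1 + s) ^+ n = b ^+ n * ((1 + s) / b) ^+ n)%R.
    by rewrite -exprMn mulrC divfK // gt_eqF.
  rewrite -mulrA ler_wpM2l ?(exprn_ge0 n (ltW b0)) // [X in (_ <= X)%R]mulrC -ler_pdivrMr ?ltr0n ?fact_gt0 //.
  case: n C C0 => [|n] _ _; first by rewrite expr0 fact0 divr1 -[X in (X <= _)%R]expR0 ler_expR.
  by apply: le_trans (expR_ge1Dxn n y0); rewrite lerDr.
Qed.

End SubGaussianVectors.

(** * Taylor expansion of smooth functions *)

Section OneVariable.
Context {R : realType}.

Lemma mean_value_at0 (f df : R -> R) (x : R) :
  (forall y : R, is_derive y 1 f (df y)) ->
  exists2 c, `|c| <= `|x| & f x - f 0 = df c * x.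
Proof.
move=> fdf; have cf a b : {within `[a, b], continuous f}.
  by apply: derivable_within_continuous => y _; exact: (@ex_derive _ _ _ _ _ _ _ (fdf y)).
have [x0|x0] := leP 0 x.
  have [c] := MVT_segment x0 (fun y _ => fdf y) (cf _ _).
  rewrite in_itv /= => /andP[c0 cx] e; exists c; last by rewrite e subr0.
  by rewrite !ger0_norm.
have [c] := MVT_segment (ltW x0) (fun y _ => fdf y) (cf _ _).
rewrite in_itv /= => /andP[xc c0] e; exists c.
  by rewrite (ler0_norm c0) (ltr0_norm x0) lerN2.
by rewrite -opprB e sub0r mulrN opprK.
Qed.

(** Taylor's formula with remainder controlled by the oscillation of the last
derivative; the factorial gained by integrating is given away. *)
Lemma taylor_oscillation q (H : nat -> R -> R) (M rho : R) :
  (forall i (y : R), (i < q)%N -> is_derive y 1 (H i) (H i.+1 y)) ->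
  (forall y, `|y| <= rho -> `|H q y - H q 0| <= M) ->
  forall x, `|x| <= rho ->
  `|H 0%N x - \sum_(i < q.+1) H i 0 / i`!%:R * x ^+ i| <= M * `|x| ^+ q.
Proof.
elim: q H => [|q IH] H dH Hq x xrho.
  by rewrite big_ord1 fact0 divr1 !expr0 !mulr1; exact: Hq.
pose p := \poly_(i < q.+2) (H i 0 / i`!%:R).
pose p' := \poly_(i < q.+1) (H i.+1 0 / i`!%:R).
have dp : p^`() = p'.
  apply/polyP => i; rewrite coef_deriv !coef_poly ltnS; case: ifP => _; last exact: mul0rn.
  rewrite -[_ *+ i.+1]mulr_natr factS natrM invfM; field.
  by rewrite nat1r !pnatr_eq0 -lt0n fact_gt0.
pose r y := H 0%N y - p.[y]; pose r' y := H 1%N y - p'.[y].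
have dr (y : R) : is_derive y 1 r (r' y).
  have := is_deriveB (dH 0%N y isT) (is_derive_poly p y).
  by rewrite dp.
have [c cx] := mean_value_at0 x dr.
have -> : r x - r 0 = H 0%N x - \sum_(i < q.+2) H i 0 / i`!%:R * x ^+ i.
  rewrite /r !horner_poly [X in _ - (_ - X)]big_ord_recl /= expr0 fact0 divr1 mulr1.
  rewrite [X in _ - (_ - (_ + X))]big1 ?addr0 ?subrr ?subr0 // => i _.
  by rewrite expr0n /= mulr0.
move=> ->; rewrite normrM exprSr mulrA ler_wpM2r //.
have := IH (fun i => H i.+1) (fun i y iq => dH i.+1 y iq) Hq c (le_trans cx xrho).
rewrite -(horner_poly q.+1 (fun i => H i.+1 0 / i`!%:R)) => /le_trans; apply.
have M0 : 0 <= M.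
  by apply: le_trans (Hq 0 _) => //; rewrite normr0 (le_trans _ xrho).
by rewrite ler_wpM2l // lerXn2r ?nnegrE.
Qed.

(** The coefficients of a polynomial bounded on [-1, 1] are bounded: the
combination p(x) - 2^q p(x/2) loses the top coefficient and multiplies the
others by factors of modulus at least 1. *)
Lemma coef_bound q : exists2 C : R, 0 <= C & forall (c : nat -> R) (B : R),
  (forall x, `|x| <= 1 -> `|\sum_(i < q.+1) c i * x ^+ i| <= B) ->
  forall i, (i <= q)%N -> `|c i| <= C * B.
Proof.
elim: q => [|q [C C0 IH]].
  exists 1 => // c B cB i; rewrite leqn0 => /eqP ->; have := cB 0.
  by rewrite normr0 ler01 big_ord1 expr0 mulr1 mul1r; exact.
pose C' := C * (1 + 2 ^+ q.+1).
have C'0 : 0 <= C' by rewrite mulr_ge0 // addr_ge0 // exprn_ge0.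
exists (1 + C' *+ q.+1 + C'); first by rewrite addr_ge0 // addr_ge0 // mulrn_wge0.
move=> c B cB.
have B0 : 0 <= B by apply: le_trans (cB 0 _) => //; rewrite normr0.
have low i : (i <= q)%N -> `|c i| <= C' * B.
  move=> iq; pose c' i := c i * (1 - 2 ^+ (q.+1 - i)).
  have : `|c' i| <= C * ((1 + 2 ^+ q.+1) * B).
    apply: IH iq => x x1.
    have -> : \sum_(j < q.+1) c' j * x ^+ j = \sum_(j < q.+2) c j * x ^+ j -
        2 ^+ q.+1 * \sum_(j < q.+2) c j * (x / 2) ^+ j.
      rewrite mulr_sumr -sumrB [RHS]big_ord_recr /= -[LHS]addr0; congr (_ + _).
        apply: eq_bigr => j _; rewrite /c' expr_div_n.
        have -> : 2 ^+ q.+1 = 2 ^+ (q.+1 - j) * 2 ^+ j :> R.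
          by rewrite -exprD subnK // ltnW.
        by field; rewrite expf_neq0.
      by rewrite expr_div_n; field; rewrite expf_neq0.
    rewrite mulrDl mul1r; apply: (le_trans (ler_normB _ _)).
    rewrite lerD ?cB // normrM ger0_norm ?exprn_ge0 // ler_wpM2l ?exprn_ge0 //.
    apply: cB; rewrite normrM normfV (ger0_norm (ler0n R 2)) ler_pdivrMr // mul1r.
    by rewrite (le_trans x1) // ler1n.
  rewrite mulrA; apply: le_trans; rewrite /c' normrM ler_peMr //.
  rewrite -opprB normrN ger0_norm; last by rewrite subr_ge0 exprn_ege1 // ler1n.
  have : (2 : R) <= 2 ^+ (q.+1 - i) by rewrite -[leLHS]expr1 ler_eXn2l ?ltr1n ?subn_gt0.
  by move=> ?; lra.
move=> i; rewrite leq_eqVlt => /predU1P[->|]; last first.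
  rewrite ltnS => /low /le_trans; apply; rewrite ler_wpM2r // lerDr.
  by rewrite addr_ge0 // mulrn_wge0.
have := cB 1; rewrite normr1 lexx => /(_ isT).
rewrite big_ord_recr /= expr1n mulr1 => top.
have -> : c q.+1 = (\sum_(j < q.+1) c j * 1 ^+ j + c q.+1) - \sum_(j < q.+1) c j * 1 ^+ j.
  by rewrite addrC addrA addNr add0r.
apply: (le_trans (ler_normB _ _)).
apply: (@le_trans _ _ (B + C' * B *+ q.+1)).
  rewrite lerD //; apply: (le_trans (ler_norm_sum _ _ _)).
  apply: (@le_trans _ _ (\sum_(j < q.+1) C' * B)).
    by apply: ler_sum => j _; rewrite expr1n mulr1 low // -ltnS.
  by rewrite sumr_const card_ord.
rewrite -mulrnAl -{1}[B]mul1r -mulrDl ler_wpM2r // lerDl //.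
Qed.

End OneVariable.

Section Line.
Context {R : realType} {m : nat}.
Implicit Types (psi : 'cV[R]_m -> R) (w e : 'cV[R]_m).

Lemma is_derive_line psi w e (x : R) : derivable psi (w + x *: e) e ->
  is_derive x 1 (fun y => psi (w + y *: e)) ('D_e psi (w + x *: e)).
Proof.
have E : (fun h => h^-1 *: (((fun y => psi (w + y *: e)) \o shift x) (h *: 1) -
      psi (w + x *: e))) =
    (fun h : R => h^-1 *: ((psi \o shift (w + x *: e)) (h *: e) - psi (w + x *: e))).
  apply/funext => h /=; congr (_ *: (psi _ - _)).
  by rewrite /= scalerDl [h *: 1]mulr1 addrCA.
by move=> dpsi; split; rewrite /derivable /derive E.
Qed.

Lemma enorm_scale_delta (y : R) (j : 'I_m) : enorm (y *: delta_mx j 0 : 'cV[R]_m) = `|y|.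
Proof.
rewrite enormE /sqnorm (bigD1 j) //= !mxE !eqxx mulr1 big1 ?addr0 ?sqrtr_sqr //.
by move=> i /negbTE ij; rewrite !mxE ij mulr0 expr0n.
Qed.

End Line.

Section DirectionLists.
Context {m : nat}.
Implicit Types (t js : seq 'I_m) (a : {ffun 'I_m -> nat}).

Definition ordered t := pairwise (fun i j : 'I_m => (i <= j)%N) t.

Lemma ordered_enum : ordered (enum 'I_m).
Proof.
rewrite /ordered -sorted_pairwise; last by move=> ? ? ?; exact: leq_trans.
have : sorted leq (map val (enum 'I_m)) by rewrite val_enum_ord iota_sorted.
by rewrite sorted_map.
Qed.

Lemma ordered_flatten (n : 'I_m -> nat) js : ordered js ->
  ordered (flatten [seq nseq (n j) j | j <- js]).
Proof.
elim: js => [//|j js IH] /= /andP[/allP jjs ojs].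
rewrite /ordered pairwise_cat; apply/and3P; split; last exact: IH.
- apply/allrelP => x y /nseqP[-> _] /flatten_mapP[j' j'js /nseqP[-> _]].
  exact: jjs.
- by elim: (n j) => //= i ->; rewrite andbT; apply/allP => x /nseqP[->].
Qed.

Lemma count_flatten_nseq (n : 'I_m -> nat) js (i : 'I_m) : uniq js ->
  count_mem i (flatten [seq nseq (n j) j | j <- js]) = ((i \in js) * n i)%N.
Proof.
elim: js => [//|j js IH] /= /andP[jjs ujs].
rewrite count_cat IH // count_nseq inE /=.
have [<-|ji] := eqVneq j i.
  by rewrite mem_head (negbTE jjs) mul0n addn0.
by rewrite mul0n add0n in_cons eq_sym (negbTE ji).
Qed.

(** Smoothness speaks of multi-indices, Taylor expansion differentiates one
coordinate after the other and works with lists. *)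
Lemma ordered_directions t : ordered t ->
  exists2 a, t = directions a & mdegree a = size t.
Proof.
move=> ot; exists [ffun j => count_mem j t].
  apply: (@sorted_eq _ (fun i j : 'I_m => (i <= j)%N)).
  - by move=> ? ? ?; exact: leq_trans.
  - by move=> i j /anti_leq/val_inj.
  - by rewrite sorted_pairwise // => ? ? ?; exact: leq_trans.
  - rewrite sorted_pairwise; last by move=> ? ? ?; exact: leq_trans.
    by apply: ordered_flatten; exact: ordered_enum.
  - apply/allP => i _ /=; rewrite count_flatten_nseq ?enum_uniq // mem_enum ffunE mul1n.
    exact: eqxx.
rewrite /mdegree -sum1_size (eq_bigr (fun j => \sum_(x <- t | x == j) 1)%N).
  rewrite (exchange_big_dep xpredT) //=; apply: eq_bigr => x _.
  by rewrite (big_pred1 x) // => j; exact: eq_sym.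
by move=> j _; rewrite ffunE sum1_count; apply: eq_count => x.
Qed.

Lemma size_directions a : size (directions a) = mdegree a.
Proof.
rewrite /directions size_flatten /shape -map_comp /mdegree sumnE big_map big_enum /=.
by apply: eq_bigr => j _; rewrite size_nseq.
Qed.

Lemma ordered_directionsP a : ordered (directions a).
Proof. by apply: ordered_flatten; exact: ordered_enum. Qed.

Lemma ordered_nseq_cat i j js t : ordered t ->
  allrel (fun j x : 'I_m => (j <= x)%N) (j :: js) t ->
  pairwise (fun i j : 'I_m => (j <= i)%N) (j :: js) ->
  ordered (nseq i j ++ t) /\ allrel (fun j x : 'I_m => (j <= x)%N) js (nseq i j ++ t).
Proof.
move=> ot /allrelP jt /= /andP[/allP jjs _]; split.
  rewrite /ordered pairwise_cat; apply/and3P; split; last exact: ot.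
  - by apply/allrelP => x y /nseqP[-> _] yt; apply: jt => //; rewrite mem_head.
  - by elim: i => //= i ->; rewrite andbT; apply/allP => x /nseqP[->].
apply/allrelP => x y xjs; rewrite mem_cat => /orP[/nseqP[-> _]|yt].
  exact: jjs.
by apply: jt => //; rewrite inE xjs orbT.
Qed.

End DirectionLists.

Section MultivariateTaylor.
Context {R : realType} {m k : nat}.
Variables (g : 'cV[R]_m -> R) (L s2 : R).
Hypotheses (L0 : 0 <= L) (s2_gt0 : 0 < s2).
Hypothesis g_exists : forall t, ordered t -> (size t <= k)%N -> iter_partial_exists t g.
Hypothesis g_holder : forall t, ordered t -> size t = k -> forall z z',
  `|iter_partial t g z - iter_partial t g z'| <= L * enorm (z - z') `^ s2.

(** Taylor polynomial in u at z, expanding in one coordinate of the list js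
after the other, so that mixed derivatives are only ever taken in the order of
decreasing coordinates. *)
Fixpoint tay (js : seq 'I_m) (q : nat) (t : seq 'I_m) (u z : 'cV[R]_m) : R :=
  if js is j :: js' then
    \sum_(i < q.+1) tay js' (q - i) (nseq i j ++ t) u z / i`!%:R * u j 0 ^+ i
  else iter_partial t g z.

Let move (js : seq 'I_m) (u : 'cV[R]_m) : 'cV[R]_m :=
  \sum_(j <- js) u j 0 *: delta_mx j 0.

Let le_rel := fun j x : 'I_m => (j <= x)%N.
Let ge_rel := fun i j : 'I_m => (j <= i)%N.

Lemma inv_fact_le1 i : (i`!%:R : R)^-1 <= 1.
Proof. by rewrite invf_le1 ?ler1n ?ltr0n fact_gt0. Qed.

Lemma is_derive_iter_partial j i t w (y : R) :
  ordered (nseq i.+1 j ++ t) -> (i.+1 + size t <= k)%N ->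
  is_derive y 1 (fun x => iter_partial (nseq i j ++ t) g (w + x *: delta_mx j 0))
    (iter_partial (nseq i.+1 j ++ t) g (w + y *: delta_mx j 0)).
Proof.
move=> ot st; apply: is_derive_line.
have : iter_partial_exists (nseq i.+1 j ++ t) g.
  by apply: g_exists => //; rewrite size_cat size_nseq.
by move=> [_]; exact.
Qed.

(* Expanding in one more coordinate multiplies the number of remainders by at most
   k + 1 and adds its own, hence the powers of k + 2. *)
Let tay_error_js js q t (u z : 'cV[R]_m) (rho : R) : ordered t -> allrel le_rel js t ->
  pairwise ge_rel js -> (q + size t = k)%N -> (forall j, `|u j 0| <= rho) ->
  0 <= rho ->
  `|iter_partial t g (z + move js u) - tay js q t u z| <=
    k.+2%:R ^+ size js * (L * rho `^ s2 * rho ^+ q).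
Proof.
move=> + + + + urho rho0.
have Lr0 : 0 <= L * rho `^ s2 by rewrite mulr_ge0 // powR_ge0.
elim: js q t => [|j js IH] q t ot jt djs qk.
  by rewrite /move big_nil addr0 /= subrr normr0 expr0 mul1r mulr_ge0 // exprn_ge0.
set e := delta_mx j 0 : 'cV[R]_m; set w := z + move js u.
have -> : z + move (j :: js) u = w + u j 0 *: e by rewrite /move big_cons addrCA addrC.
pose H i (x : R) := iter_partial (nseq i j ++ t) g (w + x *: e).
have qlek : (q <= k)%N by rewrite -qk leq_addr.
have dH i (y : R) : (i < q)%N -> is_derive y 1 (H i) (H i.+1 y).
  move=> iq; apply: is_derive_iter_partial; last by rewrite -qk leq_add2r.
  by have [] := ordered_nseq_cat i.+1 ot jt djs.
have Hq y : `|y| <= `|u j 0| -> `|H q y - H q 0| <= L * rho `^ s2.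
  move=> yu; have [oq _] := ordered_nseq_cat q ot jt djs.
  apply: (le_trans (g_holder oq _ _ _)).
    by rewrite size_cat size_nseq.
  rewrite scale0r addr0 addrAC subrr add0r enorm_scale_delta ler_wpM2l //.
  apply: ge0_ler_powR; rewrite ?nnegrE //; [exact: ltW|exact: (le_trans yu (urho j))].
have := taylor_oscillation dH Hq (lexx _).
rewrite /H /= scale0r addr0 => tay1.
set E := iter_partial t g _.
set S := (\sum_(i < q.+1) _) in tay1.
have -> : E - tay (j :: js) q t u z = (E - S) + (S - tay (j :: js) q t u z).
  by rewrite addrA subrK.
apply: (le_trans (ler_normD _ _)).
set c : R := k.+2%:R ^+ size js; set B := L * rho `^ s2.
have c1 : 1 <= c by rewrite exprn_ege1 // ler1n.
have Brho : 0 <= B * rho ^+ q by rewrite mulr_ge0 // exprn_ge0.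
have second : `|S - tay (j :: js) q t u z| <= q.+1%:R * (c * (B * rho ^+ q)).
  rewrite /S /= -sumrB; apply: (le_trans (ler_norm_sum _ _ _)).
  rewrite -[q.+1 in X in _ <= X]card_ord mulr_natl -sumr_const.
  apply: ler_sum => i _.
  have iq : (i <= q)%N by rewrite -ltnS.
  rewrite -mulrBl -mulrBl !normrM.
  have [oi ri] := ordered_nseq_cat i ot jt djs.
  have /andP[_ djs'] : all (ge_rel j) js && pairwise ge_rel js by [].
  have := IH (q - i)%N (nseq i j ++ t) oi ri djs'.
  rewrite size_cat size_nseq addnA subnK // => /(_ qk) hi.
  rewrite -[X in rho ^+ X](subnK iq) exprD !mulrA ler_pM ?mulr_ge0 //; last first.
    by rewrite normrX lerXn2r ?nnegrE // (le_trans _ (urho j)).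
  rewrite -[leRHS]mulr1 ler_pM //; last by rewrite ger0_norm ?invr_ge0 // inv_fact_le1.
  by move: hi; rewrite !mulrA.
apply: (le_trans (lerD tay1 second)).
apply: (@le_trans _ _ ((1 + k.+1%:R * c) * (B * rho ^+ q))).
  rewrite mulrDl mul1r lerD //.
    by rewrite ler_wpM2l // lerXn2r ?nnegrE.
  rewrite mulrA ler_wpM2r // ler_wpM2r ?ler_nat //; exact: le_trans c1.
rewrite ler_wpM2r // exprS -/c -[k.+2%:R]natr1 mulrDl mul1r addrC lerD2l //.
Qed.

Let all_coords : seq 'I_m := rev (enum 'I_m).

Lemma move_all u : move all_coords u = u.
Proof.
rewrite /move /all_coords big_rev big_enum /=.
apply/colP => i; rewrite summxE (bigD1 i) //= !mxE !eqxx mulr1 big1 ?addr0 //.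
by move=> j /negbTE ji; rewrite !mxE eq_sym ji mulr0.
Qed.

Let desc_all : pairwise ge_rel all_coords.
Proof.
rewrite /all_coords -sorted_pairwise; last by move=> ? ? ? ji kj; exact: leq_trans kj ji.
rewrite rev_sorted sorted_pairwise; last by move=> ? ? ?; exact: leq_trans.
exact: ordered_enum.
Qed.

Definition taylor_poly (u z : 'cV[R]_m) : R := tay all_coords k [::] u z.

Lemma coord_le_enorm (u : 'cV[R]_m) j : `|u j 0| <= enorm u.
Proof.
rewrite -sqrtr_sqr enormE ler_wsqrtr // /sqnorm (bigD1 j) //= lerDl.
by apply: sumr_ge0 => i _; rewrite sqr_ge0.
Qed.

Lemma taylor_error u z :
  `|g (z + u) - taylor_poly u z| <=
    k.+2%:R ^+ m * (L * enorm u `^ s2 * enorm u ^+ k).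
Proof.
have := @tay_error_js all_coords k [::] u z (enorm u) isT _ desc_all (addn0 k)
  (coord_le_enorm u) (enorm_ge0 u).
rewrite /all_coords size_rev size_enum_ord move_all; apply.
by apply/allrelP.
Qed.

Let tay_increment_js (G : R) js q t (u z : 'cV[R]_m) (rho : R) : (forall t', ordered t' ->
    (0 < size t' <= k)%N -> `|iter_partial t' g z| <= G) ->
  ordered t -> allrel le_rel js t ->
  pairwise ge_rel js -> (q + size t = k)%N -> (forall j, `|u j 0| <= rho) ->
  0 <= rho <= 1 -> 0 <= G ->
  `|tay js q t u z - iter_partial t g z| <= (k.+1%:R ^+ size js - 1) * (rho * G).
Proof.
move=> hG + + + + urho /andP[rho0 rho1] G0.
elim: js q t => [|j js IH] q t ot jt djs qk.
  by rewrite /= subrr normr0 expr0 subrr mul0r.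
have /andP[_ djs'] : all (ge_rel j) js && pairwise ge_rel js by [].
have rG : 0 <= rho * G by rewrite mulr_ge0.
set c : R := k.+1%:R ^+ size js - 1.
have c0 : 0 <= c by rewrite subr_ge0 exprn_ege1 // ler1n.
have qlek : (q <= k)%N by rewrite -qk leq_addr.
rewrite /= big_ord_recl /= subn0 fact0 divr1 expr0 mulr1 addrAC.
apply: (le_trans (ler_normD _ _)).
have [ot0 jt0] := ordered_nseq_cat 0 ot jt djs.
have h0 := IH q t ot jt0 djs' qk.
have hsum : `|\sum_(i < q) tay js (q - bump 0 i) (j :: nseq (0 + i) j ++ t) u z /
     (bump 0 i)`!%:R * u j 0 ^+ bump 0 i| <= q%:R * ((1 + c) * (rho * G)).
  apply: (le_trans (ler_norm_sum _ _ _)).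
  rewrite -[q in X in _ <= X]card_ord mulr_natl -sumr_const; apply: ler_sum => i _.
  rewrite /bump /= add1n add0n.
  have [oi ri] := ordered_nseq_cat i.+1 ot jt djs.
  have hi : `|tay js (q - i.+1) (nseq i.+1 j ++ t) u z| <= (1 + c) * G.
    have qi : (q - i.+1 + size (nseq i.+1 j ++ t))%N = k.
      by rewrite size_cat size_nseq addnA subnK.
    have := IH _ _ oi ri djs' qi.
    have szi : (0 < size (nseq i.+1 j ++ t) <= k)%N.
      by rewrite size_cat size_nseq addSn /= -addSn -qk leq_add2r ltn_ord.
    have := hG _ oi szi.
    set a := tay _ _ _ _ _; set b := iter_partial (nseq i.+1 j ++ t) g z => hb hab.
    have -> : a = (a - b) + b by rewrite subrK.
    apply: (le_trans (ler_normD _ _)).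
    rewrite mulrDl mul1r addrC lerD // (le_trans hab) // ler_wpM2l //.
    by rewrite ler_piMl.
  rewrite !normrM [leRHS]mulrCA [leRHS]mulrC ler_pM ?mulr_ge0 //.
    rewrite -[leRHS]mulr1 ler_pM // ger0_norm ?invr_ge0 // inv_fact_le1 //.
  rewrite normrX exprS -[leRHS]mulr1 ler_pM ?exprn_ge0 // exprn_ile1 //.
  exact: le_trans (urho j) rho1.
apply: (le_trans (lerD h0 hsum)).
rewrite -/c mulrA -mulrDl ler_wpM2r //.
have -> : k.+1%:R ^+ size (j :: js) - 1 = c + k%:R * (1 + c) :> R.
  by rewrite /c exprS -natr1; ring.
rewrite lerD2l; apply: ler_wpM2r; first by rewrite addr_ge0.
by rewrite ler_nat.
Qed.

(** All monomials of degree 1 to k in u are at most |u| on the unit ball, and the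
rest is the Taylor remainder. *)
Lemma smooth_increment (G : R) (u z : 'cV[R]_m) : (forall t', ordered t' ->
    (0 < size t' <= k)%N -> `|iter_partial t' g z| <= G) -> 0 <= G ->
  enorm u <= 1 ->
  `|g (z + u) - g z| <= k.+2%:R ^+ m * (L * enorm u `^ s2 * enorm u ^+ k)
    + k.+1%:R ^+ m * (enorm u * G).
Proof.
move=> hG G0 u1; set p := taylor_poly u z.
have -> : g (z + u) - g z = (g (z + u) - p) + (p - g z) by rewrite addrA subrK.
apply: (le_trans (ler_normD _ _)); rewrite lerD ?taylor_error //.
have := @tay_increment_js G all_coords k [::] u z (enorm u) hG isT _ desc_all
  (addn0 k) (coord_le_enorm u).
rewrite enorm_ge0 u1 => /(_ _ isT G0) h; apply: (le_trans (h _)).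
  by apply/allrelP.
rewrite /all_coords size_rev size_enum_ord ler_wpM2r ?mulr_ge0 ?enorm_ge0 //.
by rewrite gerBl.
Qed.

End MultivariateTaylor.

Section TaylorPolynomialGrowth.
Context {R : realType} {m k : nat}.
Variable g : 'cV[R]_m -> R.

(** Substituting affine forms for the increments keeps the total degree. *)
Lemma tay_mpoly n (l : 'I_m -> mpoly n R) js q t z :
  (forall j, (msize (l j) <= 2)%N) ->
  exists2 p : mpoly n R, (msize p <= q.+1)%N &
    forall v, meval v p = tay g js q t (\col_j meval v (l j)) z.
Proof.
move=> hl; elim: js q t => [|j js IH] q t.
  exists (mpolyC n (iter_partial t g z)) => [|v]; last by rewrite mevalC.
  by rewrite msizeC; case: eqP.
have [P hP] := choice (fun i : 'I_q.+1 =>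
  let: ex_intro2 p p1 p2 := IH (q - i)%N (nseq i j ++ t) in ex_intro _ p (conj p1 p2)).
exists (\sum_(i < q.+1) (i`!%:R)^-1 *: (P i * l j ^+ i)).
  apply: (leq_trans (msize_sum _ _ _)); apply/bigmax_leqP => i _.
  apply: (leq_trans (msizeZ_le _ _)).
  have [-> | P0] := eqVneq (P i) 0; first by rewrite mul0r msize0.
  have [-> | l0] := eqVneq (l j ^+ i) 0; first by rewrite mulr0 msize0.
  have li : (msize (l j ^+ i) <= i.+1)%N.
    elim: {+}(nat_of_ord i) => [|e IHe]; first by rewrite expr0 msize1.
    have [-> | h0] := eqVneq (l j) 0; first by rewrite expr0n /= msize0.
    rewrite exprS msizeM ?expf_neq0 //.
    by rewrite -ltnS prednK; [apply: leq_add (hl j) IHe|rewrite addn_gt0 lt0n msize_poly_eq0 h0].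
  have [Pi _] := hP i.
  rewrite msizeM // -ltnS prednK ?addn_gt0 ?lt0n ?msize_poly_eq0 ?P0 //.
  apply: (leq_trans (leq_add Pi li)).
  by rewrite addSn addnS subnK // -ltnS.
move=> v; rewrite [tay _ _ _ _ _ _]/= raddf_sum /=; apply: eq_bigr => i _.
have [_ Pv] := hP i.
rewrite mevalZ mevalM rmorphXn /= Pv mxE; ring.
Qed.

Lemma tay_growth js q t z : exists2 C : R, 0 <= C &
  forall (u : 'cV[R]_m) rho, 0 <= rho -> (forall j, `|u j 0| <= rho) ->
    `|tay g js q t u z| <= C * (1 + rho) ^+ q.
Proof.
elim: js q t => [|j js IH] q t.
  exists `|iter_partial t g z| => // u rho rho0 _ /=.
  by rewrite ler_peMr // exprn_ege1 // lerDl.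
have [C hC] := choice (fun i : 'I_q.+1 =>
  let: ex_intro2 p p1 p2 := IH (q - i)%N (nseq i j ++ t) in ex_intro _ p (conj p1 p2)).
exists (\sum_i C i); first by apply: sumr_ge0 => i _; case: (hC i).
move=> u rho rho0 urho; rewrite [tay _ _ _ _ _ _]/=.
apply: (le_trans (ler_norm_sum _ _ _)); rewrite mulr_suml; apply: ler_sum => i _.
have [C0 h] := hC i.
have iq : (i <= q)%N by rewrite -ltnS.
rewrite !normrM -[X in _ <= _ * _ ^+ X](subnK iq) exprD mulrA ler_pM ?mulr_ge0 //; last first.
  rewrite normrX lerXn2r ?nnegrE ?addr_ge0 //.
  by rewrite (le_trans (urho j)) // lerDr.
rewrite -[leRHS]mulr1 ler_pM ?h //.
by rewrite ger0_norm ?invr_ge0 // inv_fact_le1.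
Qed.

Lemma eq_tay (js : seq 'I_m) q t (u u' z : 'cV[R]_m) : (forall j, j \in js -> u j 0 = u' j 0) ->
  tay g js q t u z = tay g js q t u' z.
Proof.
elim: js q t => [//|j js IH] q t uu' /=; apply: eq_bigr => i _.
rewrite uu' ?mem_head // IH // => j' j'js.
by apply: uu'; rewrite inE j'js orbT.
Qed.

(** Induction on the coordinates: for fixed values of the others, the polynomial in
the first one has bounded coefficients, and these are again Taylor polynomials. *)
Lemma tay_coef_bound js : uniq js -> exists2 C : nat -> R, (forall q, 0 <= C q) &
  forall q t z B, 0 <= B ->
  (forall u : 'cV[R]_m, (forall j, `|u j 0| <= 1) -> `|tay g js q t u z| <= B) ->
  forall n : 'I_m -> nat, (\sum_(j <- js) n j <= q)%N ->
  `|iter_partial (flatten [seq nseq (n j) j | j <- rev js] ++ t) g z| <= C q * B.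
Proof.
have [c hc] := choice (fun q =>
  let: ex_intro2 p p1 p2 := @coef_bound R q in ex_intro _ p (conj p1 p2)).
elim: js => [_|j js IH /= /andP[jjs ujs]].
  exists (fun=> 1) => // q t z B B0 hB n _; rewrite mul1r.
  by apply: (hB 0) => j; rewrite mxE normr0.
have [C C0 hC] := IH ujs.
exists (fun q => \sum_(i < q.+1) C (q - i)%N * (q`!%:R * c q)).
  by move=> q; apply: sumr_ge0 => i _; rewrite !mulr_ge0 //; case: (hc q).
move=> q t z B B0 hB n; rewrite big_cons => nq.
have njq : (n j <= q)%N by apply: leq_trans nq; exact: leq_addr.
have [cq0 hcq] := hc q.
rewrite rev_cons map_rcons flatten_rcons -catA.
have B'0 : 0 <= q`!%:R * c q * B by rewrite !mulr_ge0.
apply: (@le_trans _ _ (C (q - n j)%N * (q`!%:R * c q * B))); last first.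
  have jn : (n j < q.+1)%N by [].
  rewrite mulrA ler_wpM2r // (bigD1 (Ordinal jn)) //= lerDl.
  by apply: sumr_ge0 => i _; rewrite !mulr_ge0.
apply: hC => //; last by rewrite leq_subRL.
move=> u u1.
pose a i := tay g js (q - i) (nseq i j ++ t) u z / i`!%:R.
have : `|a (n j)| <= c q * B.
  apply: hcq njq => x x1.
  pose u' : 'cV[R]_m := \col_i if i == j then x else u i 0.
  have <- : tay g (j :: js) q t u' z = \sum_(i < q.+1) a i * x ^+ i.
    rewrite /=; apply: eq_bigr => i _; rewrite mxE eqxx /a.
    congr (_ / _ * _); apply: eq_tay => j' j'js; rewrite mxE.
    by case: eqP j'js => // -> h; rewrite h in jjs.
  by apply: hB => i; rewrite mxE; case: eqP.
rewrite /a normrM normfV (ger0_norm (ler0n _ _)) ler_pdivrMr ?ltr0n ?fact_gt0 //.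
move/le_trans; apply; rewrite mulrC -mulrA ler_wpM2r ?mulr_ge0 // ler_nat.
by apply: leq_fact.
Qed.

Variables (L s2 : R).
Hypotheses (L0 : 0 <= L) (s2_01 : 0 < s2 <= 1).
Hypothesis g_exists : forall t, ordered t -> (size t <= k)%N -> iter_partial_exists t g.
Hypothesis g_holder : forall t, ordered t -> size t = k -> forall z z',
  `|iter_partial t g z - iter_partial t g z'| <= L * enorm (z - z') `^ s2.

Let s2_gt0 : 0 < s2. Proof. by case/andP: s2_01. Qed.

Let powR_le_1D (x : R) : 0 <= x -> x `^ s2 <= 1 + x.
Proof.
move=> x0; apply: (@le_trans _ _ ((1 + x) `^ s2)).
  by apply: ge0_ler_powR; rewrite ?nnegrE ?addr_ge0 ?lerDr // ltW.
by rewrite ler1_powR ?lerDl //; case/andP: s2_01.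
Qed.

Let enorm_le_1D (u : 'cV[R]_m) : 1 + enorm u <= 2 * (1 + sqnorm u).
Proof. by rewrite -sqr_enorm; have := sqr_ge0 (enorm u - 1); have := sqr_ge0 (enorm u); nra. Qed.

Let holder_term_le (u : 'cV[R]_m) :
  k.+2%:R ^+ m * (L * enorm u `^ s2 * enorm u ^+ k) <=
  k.+2%:R ^+ m * L * 2 ^+ k.+1 * (1 + sqnorm u) ^+ k.+1.
Proof.
rewrite -!mulrA ler_wpM2l ?exprn_ge0 // ler_wpM2l // -exprMn.
apply: (@le_trans _ _ ((1 + enorm u) ^+ k.+1)).
  rewrite exprS ler_pM ?powR_ge0 ?exprn_ge0 ?enorm_ge0 ?powR_le_1D ?enorm_ge0 //.
  by rewrite lerXn2r ?nnegrE ?addr_ge0 ?enorm_ge0 // lerDr.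
rewrite lerXn2r ?nnegrE ?enorm_le_1D ?addr_ge0 ?enorm_ge0 // mulr_ge0 //.
by rewrite addr_ge0 // sqnorm_ge0.
Qed.

Let g_growth : exists2 C : R, 0 <= C & forall z, `|g z| <= C * (1 + sqnorm z) ^+ k.+1.
Proof.
have [C C0 hC] := tay_growth (rev (enum 'I_m)) k [::] 0.
exists (C * 2 ^+ k + k.+2%:R ^+ m * L * 2 ^+ k.+1).
  by rewrite addr_ge0 // !mulr_ge0 // exprn_ge0.
move=> z; have := taylor_error L0 s2_gt0 g_exists g_holder z 0.
rewrite add0r => err.
rewrite -[g z](subrK (taylor_poly (k := k) g z 0)) addrC.
have s1 : 1 <= 1 + sqnorm z by rewrite lerDl sqnorm_ge0.
apply: (le_trans (ler_normD _ _)); rewrite mulrDl lerD //; last first.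
  exact: le_trans err (holder_term_le z).
apply: (le_trans (hC z (enorm z) (enorm_ge0 z) (coord_le_enorm z))).
rewrite -mulrA ler_wpM2l //.
apply: (@le_trans _ _ ((2 * (1 + sqnorm z)) ^+ k)).
  rewrite lerXn2r ?nnegrE ?enorm_le_1D ?addr_ge0 ?enorm_ge0 // mulr_ge0 //.
  exact: le_trans s1.
by rewrite exprMn ler_wpM2l ?exprn_ge0 // ler_weXn2l.
Qed.

(** A Taylor polynomial is bounded on a box by the values of g there, and so are
its coefficients: the derivatives inherit the polynomial growth of g. *)
Lemma pderiv_growth : exists2 C : R, 0 <= C & forall a, (mdegree a <= k)%N ->
  forall z, `|pderiv a g z| <= C * (1 + sqnorm z) ^+ k.+1.
Proof.
have [C C0 hC] := g_growth.
have [|c c0 hc] := @tay_coef_bound (rev (enum 'I_m)).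
  by rewrite rev_uniq enum_uniq.
pose E := k.+2%:R ^+ m * L * 2 ^+ k.+1 * (1 + m%:R) ^+ k.+1.
have E0 : 0 <= E by rewrite !mulr_ge0 ?exprn_ge0 // addr_ge0.
pose C' := C * (2 * (1 + m%:R)) ^+ k.+1 + E.
have C'0 : 0 <= C' by rewrite addr_ge0 // mulr_ge0 // exprn_ge0 // mulr_ge0 // addr_ge0.
exists (c k * C'); first by rewrite mulr_ge0.
move=> a ak z.
have s0 := sqnorm_ge0 z.
have B0 : 0 <= C' * (1 + sqnorm z) ^+ k.+1 by rewrite mulr_ge0 // exprn_ge0 // addr_ge0.
have := hc k [::] z (C' * (1 + sqnorm z) ^+ k.+1) B0 _ (fun j => a j) _.
rewrite revK cats0 mulrA; apply; last by rewrite big_rev big_enum.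
move=> u u1.
have um : sqnorm u <= m%:R.
  rewrite /sqnorm -[m in leRHS]card_ord -sumr_const; apply: ler_sum => j _.
  by rewrite -real_normK ?num_real // exprn_ile1.
have := taylor_error L0 s2_gt0 g_exists g_holder u z.
rewrite distrC => err.
rewrite -[tay _ _ _ _ _ _](subrK (g (z + u))).
apply: (le_trans (ler_normD _ _)); rewrite addrC mulrDl lerD //.
  apply: (le_trans (hC _)); rewrite -mulrA ler_wpM2l // -exprMn.
  rewrite lerXn2r ?nnegrE ?addr_ge0 ?sqnorm_ge0 ?mulr_ge0 ?addr_ge0 //.
  rewrite sqnormD.
  have d : 2 * dot z u <= sqnorm z + sqnorm u.
    have := sqnorm_ge0 (z - u); rewrite sqnormD dotNr sqnormN.
    by move=> ?; lra.
  have m0 : 0 <= m%:R :> R by [].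
  by nra.
apply: (le_trans err); apply: (le_trans (holder_term_le u)).
rewrite /E -!mulrA ler_wpM2l ?exprn_ge0 // ler_wpM2l // ler_wpM2l ?exprn_ge0 //.
apply: (@le_trans _ _ ((1 + m%:R) ^+ k.+1)).
  by rewrite lerXn2r ?nnegrE ?addr_ge0 ?sqnorm_ge0 // lerD2l.
by rewrite ler_peMr ?exprn_ge0 ?addr_ge0 // exprn_ege1 // lerDl.
Qed.

End TaylorPolynomialGrowth.

(** * Measurability and moments of the derivatives *)

Section MeasurableDerivatives.
Context {R : realType} {m : nat}.
Implicit Types (psi : 'cV[R]_m -> R).

(** Rounding takes countably many values, each on a measurable set. *)
Lemma measurable_rounding (h : 'cV[int]_m -> R) (c : R) :
  measurable_fun setT (fun z : 'cV[R]_m => h (\col_i Num.floor (c * z i 0))).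
Proof.
pose idx (z : 'cV[R]_m) := \col_i Num.floor (c * z i 0).
have midx v : measurable (idx @^-1` [set v]).
  have -> : idx @^-1` [set v] = \bigcap_(i in [set: 'I_m])
      (fun z : 'cV[R]_m => c * z i 0) @^-1` `[(v i 0)%:~R, (v i 0 + 1)%:~R[%classic.
    apply/seteqP; split => [z /= vE i _|z hz] /=.
      by rewrite -vE mxE in_itv /= floor_itv.
    apply/colP => i; rewrite mxE; apply/floor_def.
    by have := hz i Logic.I; rewrite /= in_itv.
  apply: fin_bigcap_measurable; first exact: finite_finset.
  move=> i _; rewrite -[X in measurable X]setTI.
  by apply: measurable_funM => //; exact: measurable_coord.
move=> _ B mB; rewrite setTI.
rewrite (_ : _ @^-1` B = \bigcup_(v in h @^-1` B) (idx @^-1` [set v])); last first.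
  apply/seteqP; split => [z Bz|z [v Bv /= vE]]; first by exists (idx z).
  by move: Bv; rewrite -vE.
rewrite bigcup_mkcond; apply: countable_bigcupT_measurable => [|v].
  exact: countableP.
by case: ifP => // _; exact: measurable0.
Qed.

(** A continuous function is the limit of its values at dyadic points. *)
Lemma measurable_continuous psi :
  (forall z (e : R), 0 < e -> exists2 r, 0 < r &
     forall u, sqnorm u <= r -> `|psi (z + u) - psi z| <= e) ->
  measurable_fun setT psi.
Proof.
move=> cpsi.
pose round n (z : 'cV[R]_m) : 'cV[R]_m :=
  \col_i (((\col_j Num.floor (2 ^+ n * z j 0)) i 0 : int)%:~R / 2 ^+ n).
apply: (measurable_fun_cvg (h := fun n z => psi (round n z))).
  move=> n; exact: (measurable_rounding
    (fun v => psi (\col_i ((v i 0)%:~R / 2 ^+ n))) (2 ^+ n)).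
move=> z _; apply/cvgrPdist_le => e e0.
have [r r0 hr] := cpsi z e e0.
pose e' := Num.min 1 (r / (1 + m%:R)).
have m1 : 0 < 1 + m%:R :> R by rewrite ltr_pwDl.
have e'0 : 0 < e' by rewrite lt_min ltr01 divr_gt0.
near=> n.
have n2 : (0 : R) < 2 ^+ n by rewrite exprn_gt0.
have hn : 1 / 2 ^+ n < e'.
  by near: n; exact: (near_infty_natSinv_expn_lt (PosNum e'0)).
have -> : round n z = z + (round n z - z) by rewrite addrC subrK.
rewrite distrC; apply: hr.
apply: (@le_trans _ _ (\sum_(i < m) e')).
  apply: ler_sum => i _; rewrite !mxE.
  have /andP[f1 f2] := floor_itv (2 ^+ n * z i 0).
  set F := (Num.floor _)%:~R in f1 f2 *.
  rewrite intrD mulr1z in f2.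
  have -> : F / 2 ^+ n - z i 0 = (F - 2 ^+ n * z i 0) / 2 ^+ n by field; rewrite gt_eqF.
  rewrite expr_div_n.
  have k1 : (F - 2 ^+ n * z i 0) ^+ 2 <= 1 by nra.
  have k2 : (2 ^+ n)^-1 ^+ 2 <= e'.
    rewrite -div1r; have : e' <= 1 by rewrite ge_min lexx.
    have : 0 <= 1 / 2 ^+ n :> R by rewrite divr_ge0 // ltW.
    by nra.
  rewrite -exprVn; apply: (le_trans (ler_pM _ _ k1 k2)); rewrite ?sqr_ge0 ?mul1r //.
rewrite sumr_const card_ord -mulr_natl.
apply: (@le_trans _ _ ((1 + m%:R) * (r / (1 + m%:R)))); last by rewrite mulrC divfK // gt_eqF.
by rewrite ler_pM ?(ltW e'0) // ?lerDr // ge_min lexx orbT.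
Unshelve. all: by end_near. Qed.

(** A pointwise limit of difference quotients. *)
Lemma measurable_derive psi (e : 'cV[R]_m) : measurable_fun setT psi ->
  (forall z, derivable psi z e) -> measurable_fun setT (fun z => 'D_e psi z).
Proof.
move=> mpsi dpsi.
pose quot n (z : 'cV[R]_m) : R :=
  (@harmonic R n)^-1 * (psi (@harmonic R n *: e + z) - psi z).
apply: (measurable_fun_cvg (h := quot)).
  move=> n; apply: measurable_funM => //; apply: measurable_funB => //.
  apply: measurableT_comp => //.
  apply: measurable_fun_column => i; under eq_fun do rewrite mxE.
  by apply: measurable_funD => //; exact: measurable_coord.
move=> z _.
have h0 : @harmonic R @ \oo --> 0^'.
  move=> A A0; suff : \forall n \near \oo, A (@harmonic R n) by [].
  have near0 : \forall n \near \oo, @harmonic R n != 0 -> A (@harmonic R n).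
    exact: (@cvg_harmonic R _ A0).
  apply: filterS near0 => n; apply.
  by rewrite invr_eq0 pnatr_eq0.
exact: (cvg_comp _ _ h0 (dpsi z)).
Qed.

End MeasurableDerivatives.

Section SmoothFunctions.
Context {R : realType} {m k : nat}.
Variables (g : 'cV[R]_m -> R) (L s2 : R).
Hypotheses (L0 : 0 <= L) (s2_01 : 0 < s2 <= 1) (g_smooth : smooth L k s2 g).

Lemma smooth_exists t : ordered t -> (size t <= k)%N -> iter_partial_exists t g.
Proof.
move=> /ordered_directions[a -> asz] tk.
by case: g_smooth => h _; apply: h; rewrite -(size_directions a).
Qed.

Lemma smooth_holder t : ordered t -> size t = k -> forall z z',
  `|iter_partial t g z - iter_partial t g z'| <= L * enorm (z - z') `^ s2.
Proof.
move=> /ordered_directions[a -> asz] tk z z'.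
by case: g_smooth => _ h; apply: h; rewrite -(size_directions a).
Qed.

(** A square root of a sum of squares rather than a maximum, so that the second
moment is the sum of those of the derivatives. *)
Definition gradient_size (z : 'cV[R]_m) : R :=
  Num.sqrt (\sum_(a : {ffun 'I_m -> 'I_k.+1} | (0 < \sum_j a j <= k)%N)
    pderiv [ffun j => a j : nat] g z ^+ 2).

Lemma gradient_size_sqr z : gradient_size z ^+ 2 =
  \sum_(a : {ffun 'I_m -> 'I_k.+1} | (0 < \sum_j a j <= k)%N)
    pderiv [ffun j => a j : nat] g z ^+ 2.
Proof. by rewrite sqr_sqrtr //; apply: sumr_ge0 => a _; rewrite sqr_ge0. Qed.

Lemma gradient_sizeP z t : ordered t -> (0 < size t <= k)%N ->
  `|iter_partial t g z| <= gradient_size z.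
Proof.
move=> /ordered_directions[a -> asz]; rewrite size_directions => ak.
have aj j : (a j < k.+1)%N.
  rewrite ltnS; apply: (@leq_trans (mdegree a)); last by case/andP: ak.
  by rewrite /mdegree (bigD1 j) //= leq_addr.
pose b : {ffun 'I_m -> 'I_k.+1} := [ffun j => Ordinal (aj j)].
have bE : [ffun j => b j : nat] = a by apply/ffunP => j; rewrite !ffunE.
rewrite -sqrtr_sqr ler_wsqrtr // (bigD1 b) /=; last first.
  by rewrite (eq_bigr a) // => j _; rewrite ffunE.
rewrite bE lerDl; apply: sumr_ge0 => c _; exact: sqr_ge0.
Qed.

(** Partial derivatives alone do not give continuity; the Hoelder condition on the
last ones does, through Taylor's formula. *)
Lemma smooth_continuous z (e : R) : 0 < e -> exists2 r, 0 < r &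
  forall u, sqnorm u <= r -> `|g (z + u) - g z| <= e.
Proof.
move=> e0; have /andP[s20 s21] := s2_01.
pose M := k.+2%:R ^+ m * L + k.+1%:R ^+ m * gradient_size z + 1.
have M0 : 0 < M by rewrite ltr_wpDl // addr_ge0 // mulr_ge0 ?exprn_ge0 ?sqrtr_ge0.
pose r := Num.min 1 ((e / M) `^ s2^-1).
have eM : 0 < e / M by rewrite divr_gt0.
have r0 : 0 < r by rewrite lt_min ltr01 powR_gt0.
exists (r ^+ 2); first by rewrite exprn_gt0.
move=> u; rewrite -sqr_enorm => ur.
have {}ur : enorm u <= r by rewrite -(@ler_pXn2r _ 2) ?nnegrE ?enorm_ge0 // ltW.
have u1 : enorm u <= 1 by apply: le_trans ur _; rewrite ge_min lexx.
have us : enorm u `^ s2 <= e / M.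
  apply: (@le_trans _ _ (((e / M) `^ s2^-1) `^ s2)).
    apply: ge0_ler_powR; rewrite ?nnegrE ?enorm_ge0 ?powR_ge0 ?(ltW s20) //.
    by apply: le_trans ur _; rewrite ge_min lexx orbT.
  by rewrite -powRrM mulVf ?gt_eqF // powRr1 // ltW.
have uu : enorm u <= enorm u `^ s2.
  have [->|un0] := eqVneq (enorm u) 0; first exact: powR_ge0.
  by rewrite ger1_powR // u1 andbT lt_def un0 enorm_ge0.
have := smooth_increment L0 s20 smooth_exists smooth_holder (gradient_sizeP z)
  (sqrtr_ge0 _) u1.
move/le_trans; apply.
apply: (@le_trans _ _ (M * enorm u `^ s2)).
  rewrite /M 2!mulrDl mul1r -[leLHS]addr0 lerD ?powR_ge0 // lerD //.
    rewrite -[leRHS]mulr1 !mulrA ler_pM // ?mulr_ge0 ?exprn_ge0 ?powR_ge0 ?enorm_ge0 //.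
    by rewrite exprn_ile1 ?enorm_ge0.
  by rewrite mulrCA [leRHS]mulrC ler_pM ?mulr_ge0 ?exprn_ge0 ?enorm_ge0 ?sqrtr_ge0.
by rewrite mulrC -ler_pdivlMr.
Qed.

Lemma smooth_measurable : measurable_fun setT g.
Proof. exact: measurable_continuous smooth_continuous. Qed.

Lemma measurable_pderiv a : (mdegree a <= k)%N -> measurable_fun setT (pderiv a g).
Proof.
rewrite -(size_directions a) => ak.
have : iter_partial_exists (directions a) g.
  by apply: smooth_exists => //; exact: ordered_directionsP.
rewrite /pderiv; elim: (directions a) => [_|j t IH /= [/IH mt dt]].
  exact: smooth_measurable.
exact: measurable_derive.
Qed.

Context {d : measure_display} {T : measurableType d} (P : probability T R).
Context (Z : T -> 'cV[R]_m).
Hypothesis mZ : measurable_fun setT Z.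
Hypothesis Z_moments : forall n, (\int[P]_w ((1 + sqnorm (Z w)) ^+ n)%:E < +oo)%E.

Let mpZ a : (mdegree a <= k)%N -> measurable_fun setT (fun w => pderiv a g (Z w)).
Proof. by move=> ak; exact: measurableT_comp (measurable_pderiv ak) mZ. Qed.

Let fourth_moment : exists2 C : R, 0 <= C & forall a, (mdegree a <= k)%N ->
  (\int[P]_w (pderiv a g (Z w) ^+ 4)%:E <= C%:E)%E.
Proof.
have [C C0 hC] := pderiv_growth L0 s2_01 smooth_exists smooth_holder.
have moo := Z_moments (k.+1 * 4).
have m0 : (0 <= \int[P]_w ((1 + sqnorm (Z w)) ^+ (k.+1 * 4))%:E)%E.
  by apply: integral_ge0 => w _; rewrite lee_fin exprn_ge0 // addr_ge0 // sqnorm_ge0.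
have mS : measurable_fun setT (fun w => ((1 + sqnorm (Z w)) ^+ (k.+1 * 4))%:E).
  apply/measurable_EFinP; apply: measurable_funX; apply: measurable_funD => //.
  exact: measurableT_comp (@measurable_sqnorm _ _) mZ.
have mfin : (\int[P]_w ((1 + sqnorm (Z w)) ^+ (k.+1 * 4))%:E)%E \is a fin_num.
  by rewrite ge0_fin_numE.
exists (C ^+ 4 * fine (\int[P]_w ((1 + sqnorm (Z w)) ^+ (k.+1 * 4))%:E)%E).
  by rewrite mulr_ge0 ?exprn_ge0 // fine_ge0.
move=> a ak; rewrite EFinM fineK // -ge0_integralZl_EFin ?exprn_ge0 //; last first.
  by move=> w _; rewrite lee_fin exprn_ge0 // addr_ge0 // sqnorm_ge0.
apply: ge0_le_integral => //.
- by move=> w _; rewrite lee_fin exprn_even_ge0.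
- by apply/measurable_EFinP; apply: measurable_funX; exact: mpZ.
- exact: measurable_funeM.
- move=> w _; rewrite -EFinM lee_fin exprM -exprMn.
  rewrite -[leLHS]ger0_norm ?exprn_even_ge0 // normrX lerXn2r ?nnegrE //.
    by rewrite mulr_ge0 // exprn_ge0 // addr_ge0 // sqnorm_ge0.
  exact: hC.
Qed.

Let fourth_ge0 a : (0 <= \int[P]_w (pderiv a g (Z w) ^+ 4)%:E)%E.
Proof. by apply: integral_ge0 => w _; rewrite lee_fin exprn_even_ge0. Qed.

Let fourth_le a : (0 < mdegree a <= k)%N ->
  (\int[P]_w (pderiv a g (Z w) ^+ 4)%:E <= (deriv_moment P k g Z)%:E)%E.
Proof.
move=> ak; have [C C0 hC] := fourth_moment.
have fin b : (mdegree b <= k)%N ->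
    (\int[P]_w (pderiv b g (Z w) ^+ 4)%:E)%E \is a fin_num.
  move=> bk; rewrite ge0_fin_numE ?fourth_ge0 //.
  by apply: le_lt_trans (hC _ bk) _; rewrite ltry.
have /andP[_ ak'] := ak.
rewrite -(fineK (fin a ak')) lee_fin /deriv_moment.
apply: ub_le_sup; last by exists a => //; rewrite unlock.
exists C => _ [b /andP[_ bk] <-]; rewrite unlock -lee_fin fineK ?fin //.
exact: hC.
Qed.

Lemma deriv_moment_ge0 : 0 <= deriv_moment P k g Z.
Proof.
have [[a ak]|none] := pselect (exists a : {ffun 'I_m -> nat}, (0 < mdegree a <= k)%N).
  by rewrite -lee_fin; exact: le_trans (fourth_ge0 a) (fourth_le ak).
rewrite /deriv_moment (_ : [set fine _ | _ in _] = set0) ?sup0 //.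
by apply/seteqP; split => // t [a ak _]; apply: none; exists a.
Qed.

(** Fourth moments control second ones by x^2 <= 1 + x^4. *)
Lemma gradient_size_moment :
  (\int[P]_w (gradient_size (Z w) ^+ 2)%:E <=
   (k.+1%:R ^+ m * (1 + deriv_moment P k g Z))%:E)%E.
Proof.
pose s := [seq a : {ffun 'I_m -> 'I_k.+1} <- index_enum _ | (0 < \sum_j a j <= k)%N].
rewrite (eq_integral (fun w =>
    (\sum_(a <- s) (pderiv [ffun j => a j : nat] g (Z w) ^+ 2)%:E)%E)); last first.
  by move=> w _; rewrite gradient_size_sqr sumEFin /s big_filter.
have sP a : a \in s -> (0 < mdegree [ffun j => a j : nat] <= k)%N.
  rewrite mem_filter => /andP[ak _].
  have -> // : mdegree [ffun j => a j : nat] = (\sum_j a j)%N.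
  by apply: eq_bigr => j _; rewrite ffunE.
have -> : (\int[P]_w (\sum_(a <- s) (pderiv [ffun j => a j : nat] g (Z w) ^+ 2)%:E))%E =
    (\sum_(a <- s) \int[P]_w (pderiv [ffun j => a j : nat] g (Z w) ^+ 2)%:E)%E.
  elim: (s) sP => [|a r IH] sP.
    by under eq_integral do rewrite big_nil; rewrite integral0 big_nil.
  have msum (l : seq {ffun 'I_m -> 'I_k.+1}) : {subset l <= a :: r} -> measurable_fun setT
      (fun w => (\sum_(a <- l) (pderiv [ffun j => a j : nat] g (Z w) ^+ 2)%:E)%E).
    elim: l => [|b l IHl] ls; first by under eq_fun do rewrite big_nil; exact: measurable_cst.
    under eq_fun do rewrite big_cons; apply: emeasurable_funD.
      apply/measurable_EFinP/measurable_funX/mpZ.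
      by have /sP/andP[] : b \in a :: r by apply: ls; rewrite mem_head.
    by apply: IHl => c cl; apply: ls; rewrite inE cl orbT.
  under eq_integral do rewrite big_cons.
  rewrite big_cons ge0_integralD //.
  - by rewrite IH // => c cs; apply: sP; rewrite inE cs orbT.
  - by move=> w _; rewrite lee_fin sqr_ge0.
  - apply/measurable_EFinP/measurable_funX/mpZ.
    by have /sP/andP[] : a \in a :: r by rewrite mem_head.
  - by move=> w _; rewrite sume_ge0 // => c _; rewrite lee_fin sqr_ge0.
  - by apply: msum => c cs; rewrite inE cs orbT.
have M0 := deriv_moment_ge0.
apply: (@le_trans _ _ (\sum_(a <- s) (1 + deriv_moment P k g Z)%:E)%E).
  rewrite big_seq [leRHS]big_seq; apply: lee_sum => a /sP ak.
  have /andP[_ ak'] := ak; have ma := mpZ ak'.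
  apply: (@le_trans _ _ (\int[P]_w (1 + (pderiv [ffun j => a j : nat] g (Z w) ^+ 4)%:E))%E).
    apply: ge0_le_integral => //.
    - by move=> w _; rewrite lee_fin sqr_ge0.
    - exact/measurable_EFinP/measurable_funX.
    - by apply: emeasurable_funD => //; exact/measurable_EFinP/measurable_funX.
    - move=> w _; rewrite -EFinD lee_fin.
      set x := pderiv _ _ _; have := sqr_ge0 (x ^+ 2 - 1); rewrite sqrrB -exprM.
      by have := sqr_ge0 x; lra.
  rewrite ge0_integralD //; last 2 first.
  - by move=> w _; rewrite lee_fin exprn_even_ge0.
  - exact/measurable_EFinP/measurable_funX.
  rewrite integral_cst // [X in (_ * X)%E](probability_setT P) mule1 EFinD.
  by rewrite leeD2l // fourth_le.
rewrite sumEFin lee_fin.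
have -> : \sum_(a <- s) (1 + deriv_moment P k g Z) = (size s)%:R * (1 + deriv_moment P k g Z).
  by rewrite -sum1_size natr_sum mulr_suml; apply: eq_bigr => a _; rewrite mul1r.
rewrite ler_wpM2r ?addr_ge0 //.
rewrite -natrX ler_nat size_filter.
apply: (leq_trans (count_size _ _)).
have -> : size (index_enum {ffun 'I_m -> 'I_k.+1}) = #|{ffun 'I_m -> 'I_k.+1}|.
  by rewrite cardT enumT /index_enum; case: index_enum_key.
by rewrite card_ffun !card_ord.
Qed.

End SmoothFunctions.

(** * The class of piecewise polynomials *)

Section DyadicCells.
Context {R : realType} {d : nat}.
Implicit Types (l : int) (y : 'cV[R]_d) (v : 'cV[int]_d).

Definition cell l y : 'cV[int]_d := \col_j Num.floor (2 ^ l * y j 0).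

Lemma exp2_gt0 (l : int) : 0 < 2 ^ l :> R.
Proof. exact: exprz_gt0. Qed.

Lemma dyadic_cubeP l v y : dyadic_cube l v y <-> cell l y = v.
Proof.
have E (j : 'I_d) (n : int) : (2 ^ (- l) * n%:~R <= y j 0) = (n%:~R <= 2 ^ l * y j 0).
  by rewrite -invr_expz ler_pdivrMl ?exp2_gt0.
have E' (j : 'I_d) (n : int) : (y j 0 < 2 ^ (- l) * n%:~R) = (2 ^ l * y j 0 < n%:~R).
  by rewrite -invr_expz ltr_pdivlMl ?exp2_gt0.
split => [yv|<- j]; last by rewrite E E' mxE floor_itv.
apply/colP => j; rewrite mxE; apply/floor_def.
by have := yv j; rewrite E E'.
Qed.

Lemma sqnorm_cell_corner l y :
  sqnorm (y - \col_j (2 ^ (- l) * (cell l y j 0)%:~R)) <= d%:R * (2 ^ (- l)) ^+ 2.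
Proof.
apply: (@le_trans _ _ (\sum_(j < d) (2 ^ (- l)) ^+ 2)); last first.
  by rewrite sumr_const card_ord mulr_natl.
apply: ler_sum => j _; rewrite !mxE.
have /andP[f1 f2] := floor_itv (2 ^ l * y j 0); rewrite intrD mulr1z in f2.
set F := (Num.floor _)%:~R in f1 f2 *.
have -> : y j 0 - 2 ^ (- l) * F = 2 ^ (- l) * (2 ^ l * y j 0 - F).
  by rewrite mulrBr mulrA -invr_expz mulVf ?mul1r // gt_eqF // exp2_gt0.
rewrite exprMn ler_piMr ?sqr_ge0 //; nra.
Qed.

End DyadicCells.

Section PiecewisePolynomials.
Context {R : realType} {D d : nat}.
Variables (Ahat : 'M[R]_(D, d)) (l : int) (k : nat) (r : R).

Local Notation proj x := (Ahat^T *m x).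

(** A point of the ball lies in exactly one cube, which then meets the ball. *)
Lemma piecewise_polyP h : piecewise_poly Ahat l k r h <->
  exists2 p : 'cV[int]_d -> mpoly d R, forall c, (msize (p c) <= k.+1)%N &
    forall x, h x = \1_(eball r) x *
      meval (fun j => proj x j 0) (p (cell l (proj x))).
Proof.
suff sumE (p : 'cV[int]_d -> mpoly d R) x : \1_(eball r) x *
       \sum_(c \in cubes_meeting Ahat l r)
         \1_(dyadic_cube l c) (proj x) * meval (fun j => proj x j 0) (p c) =
       \1_(eball r) x * meval (fun j => proj x j 0) (p (cell l (proj x))).
  by split => -[p pk hE]; exists p => // x; rewrite hE sumE.
rewrite indicE; have [|_] := boolP (x \in eball r); last by rewrite !mul0r.
rewrite inE => xr; rewrite !mul1r.
have xc : dyadic_cube l (cell l (proj x)) (proj x) by exact/dyadic_cubeP.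
rewrite -(fsbig_widen [set cell l (proj x)]).
- by rewrite fsbig_set1 indicE mem_set // mul1r.
- by move=> _ /= ->; exists x.
- move=> c /= [_ cx]; rewrite indicE memNset ?mul0r //.
  by move=> /dyadic_cubeP cE; apply: cx.
Qed.

(** The cells are those of a box that contains every cell meeting the ball, which
makes them easy to count; a cell that misses the ball gives the zero function. *)
Variable M : nat.
Definition cell_index : finType := {ffun 'I_d -> 'I_M.*2.+1}.
Definition feature_index : finType := (cell_index * bmultinom d k.+1)%type.

Definition cell_of_index (v : cell_index) : 'cV[int]_d := \col_j ((v j)%:Z - M%:Z).

Definition feature (i : feature_index) (x : 'cV[R]_D) : R :=
  \1_(eball r) x * (cell l (proj x) == cell_of_index i.1)%:R *
  \prod_j proj x j 0 ^+ (i.2 : multinom d) j.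

Definition features (j : 'I_#|feature_index|) := feature (enum_val j).

Lemma lincomb_features (c : feature_index -> R) x :
  lincomb features (fun j => c (enum_val j)) x = \sum_i c i * feature i x.
Proof.
by rewrite /lincomb /features -(big_enum_val (A := predT) (fun i => c i * feature i x)).
Qed.

Lemma lincomb_featuresP c : piecewise_poly Ahat l k r (lincomb features c).
Proof.
apply/piecewise_polyP.
pose c' (i : feature_index) := c (enum_rank i).
pose p (v : 'cV[int]_d) : mpoly d R :=
  \sum_(i : feature_index) ((v == cell_of_index i.1)%:R * c' i) *: mpolyX R i.2.
exists p => [v|x].
  apply: (leq_trans (msize_sum _ _ _)); apply/bigmax_leqP => i _.
  apply: (leq_trans (msizeZ_le _ _)); rewrite msizeX; exact: bmdeg.
have -> : lincomb features c x = lincomb features (fun j => c' (enum_val j)) x.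
  by apply: eq_bigr => j _; rewrite /c' enum_valK.
rewrite lincomb_features /p raddf_sum mulr_sumr; apply: eq_bigr => i _ /=.
by rewrite mevalZ mevalX /feature; ring.
Qed.

Hypotheses (r0 : 0 <= r) (rM : 2 ^ l * r <= M%:R).
Hypothesis Ahat_orth : orthonormal_cols Ahat.

Lemma orthonormal_projection m n (V : 'M[R]_(m, n)) : orthonormal_cols V ->
  orthogonal_projection (V *m V^T).
Proof.
move=> VV; split; first by rewrite trmx_mul trmxK.
by rewrite mulmxA -(mulmxA V) VV mulmx1.
Qed.

Lemma sqnorm_orthonormal m n (V : 'M[R]_(m, n)) u : orthonormal_cols V ->
  sqnorm (V *m u) = sqnorm u.
Proof. by move=> VV; rewrite -!sqnormE trmx_mul mulmxA -(mulmxA _ V^T) VV mulmx1. Qed.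

Lemma sqnorm_proj_le n (H : 'M[R]_n) x : orthogonal_projection H ->
  sqnorm (H *m x) <= sqnorm x.
Proof.
move=> projH; have [_ idemH] := projH.
rewrite -[in leRHS](subrK (H *m x) x) sqnormD.
have -> : dot (x - H *m x) (H *m x) = 0.
  by rewrite -dot_proj // mulmxBr mulmxA idemH subrr /dot big1 // => i _;
    rewrite mxE mul0r.
by rewrite mulr0 addr0 lerDr sqnorm_ge0.
Qed.

Lemma sqnorm_orthonormal_tr m n (V : 'M[R]_(m, n)) x : orthonormal_cols V ->
  sqnorm (V^T *m x) <= sqnorm x.
Proof.
move=> VV; rewrite -(sqnorm_orthonormal _ VV) mulmxA.
exact: sqnorm_proj_le (orthonormal_projection VV).
Qed.

Lemma ball_cell x : eball r x -> exists v, cell l (proj x) = cell_of_index v.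
Proof.
move=> xr.
have yj j : `|proj x j 0| <= r.
  apply: (le_trans (coord_le_enorm _ _)); apply: le_trans xr.
  by rewrite !enormE ler_wsqrtr // sqnorm_orthonormal_tr.
have fl j : (- M%:Z <= Num.floor (2 ^ l * proj x j 0) <= M%:Z)%R.
  have := yj j; rewrite ler_norml => /andP[y1 y2].
  have l0 := exp2_gt0 (R := R) l.
  have k2 : 2 ^ l * proj x j 0 <= 2 ^ l * r by rewrite ler_pM2l.
  have k1 : - (2 ^ l * r) <= 2 ^ l * proj x j 0 by rewrite -mulrN ler_pM2l.
  rewrite floor_ge_int -ltzD1 floor_lt_int.
  rewrite mulrNz intrD mulr1z -!pmulrn.
  move: k1 k2 rM; set a := 2 ^ l * r; set b := 2 ^ l * _ => k1 k2 aM.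
  by apply/andP; split; [rewrite (le_trans _ k1) // lerN2|rewrite (le_lt_trans k2) // ltr_pwDr].
have vP j : (`|(Num.floor (2 ^ l * proj x j 0) + M%:Z)%R|%N < M.*2.+1)%N.
  have /andP[f1 f2] := fl j.
  rewrite ltnS -lez_nat gez0_abs; last by rewrite -lerBlDr sub0r.
  by rewrite -addnn PoszD lerD2r.
exists [ffun j => Ordinal (vP j)]; apply/colP => j; rewrite [LHS]mxE [RHS]mxE ffunE /=.
have /andP[f1 f2] := fl j.
have F0 : 0 <= Num.floor (2 ^ l * proj x j 0) + M%:Z by rewrite -lerBlDr sub0r.
by rewrite gez0_abs // addrK.
Qed.

Lemma piecewise_poly_lincomb h : piecewise_poly Ahat l k r h ->
  exists c, forall x, h x = lincomb features c x.
Proof.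
move=> /piecewise_polyP[p pk hE].
pose c (i : feature_index) := mcoeff i.2 (p (cell_of_index i.1)).
exists (fun j => c (enum_val j)) => x; rewrite hE lincomb_features.
rewrite indicE; have [xr|xr] := boolP (x \in eball r); last first.
  rewrite mul0r big1 // => i _.
  by rewrite /feature indicE (negbTE xr) !mul0r mulr0.
move: (xr); rewrite mul1r inE => /ball_cell[v vE].
rewrite {1}(mpolywE (pk _)) raddf_sum /=.
rewrite -(pair_bigA _ (fun v' m => c (v', m) * feature (v', m) x)) /=.
rewrite (bigD1 v) //= [X in _ + X]big1 ?addr0 => [|v' vv'].
  apply: eq_bigr => m _; rewrite mevalZ mevalX /c /feature indicE xr vE eqxx /=.
  by rewrite !mul1r.
apply: big1 => m _; rewrite /feature vE /=.
case: eqP => [/colP e|_]; last by rewrite mulr0 mul0r mulr0.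
case/eqP: vv'; apply/ffunP => j; apply: val_inj => /=.
by have := e j; rewrite !mxE => /addIr [].
Qed.

Lemma measurable_features j : measurable_fun setT (features j).
Proof.
have mproj : measurable_fun setT (fun x : 'cV[R]_D => proj x).
  exact: measurable_mulmx (@measurable_id _ _ _).
apply: measurable_funM.
  apply: measurable_funM.
    apply: measurable_indic.
    rewrite (_ : eball r = (@sqnorm R D) @^-1` `]-oo, r ^+ 2]%classic).
      by rewrite -[X in measurable X]setTI; exact: measurable_sqnorm.
    apply/seteqP; split => x /=; rewrite in_itv /= -sqr_enorm => h.
      by rewrite lerXn2r ?nnegrE // enorm_ge0.
    by rewrite /eball /= -(@ler_pXn2r _ 2) ?nnegrE ?enorm_ge0.
  exact: (measurableT_comp (measurable_rounding
    (fun v => (v == cell_of_index (enum_val j).1)%:R) (2 ^ l)) mproj).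
apply: measurable_prod => i _; apply: measurable_funX.
exact: measurableT_comp (measurable_coord i) mproj.
Qed.

Lemma card_feature_index : (#|feature_index| <= M.*2.+1 ^ d * k.+1 ^ d)%N.
Proof.
rewrite card_prod card_ffun !card_ord leq_mul2l; apply/orP; right.
pose f (m : bmultinom d k.+1) : {ffun 'I_d -> 'I_k.+1} :=
  [ffun j => inord ((m : multinom d) j)].
have inj_f : injective f.
  move=> m m' /ffunP e; apply/val_inj/mnmP => j.
  have b (q : bmultinom d k.+1) : ((q : multinom d) j < k.+1)%N.
    by apply: leq_trans (bmdeg q); rewrite ltnS mdegE (bigD1 j) //= leq_addr.
  by have := congr1 val (e j); rewrite !ffunE /= !inordK.
by have := leq_card f inj_f; rewrite card_ffun !card_ord.
Qed.

End PiecewisePolynomials.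

(** * Approximation by piecewise polynomials of the estimated coordinates *)

Section Approximation.
Context {R : realType} {D d k : nat}.
Variables (A Ahat : 'M[R]_(D, d)) (g : 'cV[R]_d -> R) (L s2 : R).
Hypotheses (A_orth : orthonormal_cols A) (Ahat_orth : orthonormal_cols Ahat).
Hypotheses (L0 : 0 <= L) (s2_01 : 0 < s2 <= 1) (g_smooth : smooth L k s2 g).

Let B := A^T *m Ahat.

Let sqnorm_B w : sqnorm (B *m w) <= sqnorm w.
Proof.
rewrite -mulmxA; apply: (le_trans (sqnorm_orthonormal_tr _ A_orth)).
by rewrite sqnorm_orthonormal.
Qed.

Lemma enorm_le m n (u : 'cV[R]_m) (v : 'cV[R]_n) :
  sqnorm u <= sqnorm v -> enorm u <= enorm v.
Proof. by move=> uv; rewrite !enormE ler_wsqrtr. Qed.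

(** On each cell, the Taylor polynomial of g at the image of the corner of the
cell, composed with the linear map from the estimated to the true coordinates. *)
Lemma piecewise_poly_approximation (l : int) (r : R) :
  exists2 h, piecewise_poly Ahat l k r h &
  (forall x, eball r x -> `|h x - g (B *m (Ahat^T *m x))| <=
     k.+2%:R ^+ d * (L * (Num.sqrt d%:R * 2 ^ (- l)) `^ s2
                       * (Num.sqrt d%:R * 2 ^ (- l)) ^+ k)) /\
  (forall x, ~ eball r x -> h x = 0).
Proof.
pose corner (c : 'cV[int]_d) : 'cV[R]_d := \col_j (2 ^ (- l) * (c j 0)%:~R).
pose aff (c : 'cV[int]_d) (j : 'I_d) : mpoly d R :=
  \sum_i B j i *: (mpolyX R (mnm1 i) - mpolyC d (corner c i 0)).
have aff_size c j : (msize (aff c j) <= 2)%N.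
  apply: (leq_trans (msize_sum _ _ _)); apply/bigmax_leqP => i _.
  apply: (leq_trans (msizeZ_le _ _)); apply: (leq_trans (msizeD_le _ _)).
  by rewrite geq_max msizeX mdeg1 msizeN msizeC; case: (_ != _).
have affE c (v : 'cV[R]_d) j : meval (fun i => v i 0) (aff c j) = (B *m (v - corner c)) j 0.
  rewrite /aff raddf_sum /= [RHS]mxE; apply: eq_bigr => i _.
  have -> : (v - corner c) i 0 = v i 0 - corner c i 0 by rewrite mxE [(- corner c) i 0]mxE.
  by rewrite mevalZ mevalB mevalXU mevalC.
have [p hp] := choice (fun c => let: ex_intro2 p p1 p2 :=
  tay_mpoly g (rev (enum 'I_d)) k [::] (B *m corner c) (aff_size c) in
  ex_intro _ p (conj p1 p2)).
pose h x := \1_(eball r) x *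
  meval (fun j => (Ahat^T *m x) j 0) (p (cell l (Ahat^T *m x))).
exists h.
  by apply/piecewise_polyP; exists p => // c; case: (hp c).
split=> x xr; last by rewrite /h indicE memNset ?mul0r.
rewrite /h indicE mem_set // mul1r.
set y := Ahat^T *m x; set c := cell l y.
have [_ ->] := hp c.
pose u := B *m (y - corner c).
have -> : \col_j meval (fun i => y i 0) (aff c j) = u.
  by apply/colP => j; rewrite mxE affE.
have -> : g (B *m y) = g (B *m corner c + u) by rewrite /u mulmxBr addrC subrK.
rewrite distrC.
have := taylor_error L0 (proj1 (andP s2_01)) (smooth_exists g_smooth)
  (smooth_holder g_smooth) u (B *m corner c).
move/le_trans; apply.
have uy : enorm u <= Num.sqrt d%:R * 2 ^ (- l).
  have -> : Num.sqrt d%:R * 2 ^ (- l) = Num.sqrt (d%:R * (2 ^ (- l)) ^+ 2) :> R.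
    by rewrite sqrtrM // sqrtr_sqr gtr0_norm // exp2_gt0.
  rewrite enormE ler_wsqrtr //; apply: le_trans (sqnorm_B _) _.
  exact: sqnorm_cell_corner.
have e0 : 0 <= Num.sqrt d%:R * 2 ^ (- l) :> R by apply: le_trans uy; exact: enorm_ge0.
rewrite ler_wpM2l ?exprn_ge0 // ler_pM ?mulr_ge0 ?powR_ge0 ?exprn_ge0 ?enorm_ge0 //.
  rewrite ler_wpM2l //; apply: ge0_ler_powR; rewrite ?nnegrE ?enorm_ge0 //.
  by apply: ltW; case/andP: s2_01.
by rewrite lerXn2r ?nnegrE ?enorm_ge0.
Qed.

Let delta := opnorm (Ahat *m Ahat^T - A *m A^T).

Let diff_bound w : sqnorm ((Ahat *m Ahat^T - A *m A^T) *m w) <= 4 * sqnorm w.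
Proof.
rewrite mulmxBl sqnormD dotNr sqnormN.
have h1 := sqnorm_proj_le w (orthonormal_projection Ahat_orth).
have h2 := sqnorm_proj_le w (orthonormal_projection A_orth).
set a := Ahat *m Ahat^T *m w in h1 *; set b := A *m A^T *m w in h2 *.
have := sqnorm_ge0 (a + b); rewrite sqnormD => ?; lra.
Qed.

Let delta_set := [set enorm ((Ahat *m Ahat^T - A *m A^T) *m x) |
  x in [set x : 'cV[R]_D | enorm x <= 1]].

Let delta_ub : has_sup delta_set.
Proof.
split; first by exists (enorm ((Ahat *m Ahat^T - A *m A^T) *m 0)); exists 0 => //=;
  rewrite enormE /sqnorm big1 ?sqrtr0 // => i _; rewrite mxE expr0n.
exists 2 => _ [x /= x1 <-].
rewrite -(@ler_pXn2r _ 2) ?nnegrE ?enorm_ge0 // sqr_enorm.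
apply: (le_trans (diff_bound x)); rewrite -sqr_enorm.
by have := enorm_ge0 x; nra.
Qed.

Lemma opnorm_ge0 : 0 <= delta.
Proof.
apply: (@le_trans _ _ (enorm ((Ahat *m Ahat^T - A *m A^T) *m 0))); first exact: enorm_ge0.
apply: ub_le_sup; first by case: delta_ub.
by exists 0 => //=; rewrite enormE /sqnorm big1 ?sqrtr0 // => i _; rewrite mxE expr0n.
Qed.

Lemma enormZ n (c : R) (x : 'cV[R]_n) : 0 <= c -> enorm (c *: x) = c * enorm x.
Proof.
move=> c0; rewrite !enormE -{2}(ger0_norm c0) -sqrtr_sqr -sqrtrM ?sqr_ge0 //.
by congr Num.sqrt; rewrite /sqnorm mulr_sumr; apply: eq_bigr => i _; rewrite mxE exprMn.
Qed.

Lemma opnorm_bound x :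
  enorm ((Ahat *m Ahat^T - A *m A^T) *m x) <= delta * enorm x.
Proof.
have [x0|x0] := eqVneq (enorm x) 0.
  have := diff_bound x; rewrite -!sqr_enorm x0 expr0n mulr0 mulr0 /= => h.
  have : enorm ((Ahat *m Ahat^T - A *m A^T) *m x) ^+ 2 == 0.
    by rewrite eq_le h sqr_ge0.
  by rewrite sqrf_eq0 => /eqP ->.
have xp : 0 < enorm x by rewrite lt_def x0 enorm_ge0.
have i0 : 0 <= (enorm x)^-1 by rewrite invr_ge0 enorm_ge0.
rewrite -ler_pdivrMr // mulrC -enormZ // scalemxAr.
apply: ub_le_sup; first by case: delta_ub.
by exists ((enorm x)^-1 *: x) => //=; rewrite enormZ // mulVf.
Qed.

(** The component of x orthogonal to the estimated space is seen by A only
through the difference of the two projections. *)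
Lemma coordinate_error x :
  enorm (B *m (Ahat^T *m x) - A^T *m x) <= delta * enorm x.
Proof.
set w := x - Ahat *m (Ahat^T *m x).
have wx : sqnorm w <= sqnorm x.
  have projP := orthonormal_projection Ahat_orth; have [_ idem] := projP.
  have xE : x = w + Ahat *m Ahat^T *m x by rewrite -mulmxA subrK.
  rewrite [in leRHS]xE (sqnormD w) -(dot_proj w x projP).
  rewrite (_ : _ *m w = 0) ?[dot 0 _]big1 ?mulr0 ?addr0 ?lerDl ?sqnorm_ge0 //.
    by move=> i _; rewrite mxE mul0r.
  by rewrite /w mulmxBr !mulmxA -[in X in _ - X](mulmxA Ahat) Ahat_orth mulmx1 subrr.
have -> : B *m (Ahat^T *m x) - A^T *m x = - (A^T *m w).
  by rewrite /w mulmxBr opprB !mulmxA.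
have -> : enorm (- (A^T *m w)) = enorm ((Ahat *m Ahat^T - A *m A^T) *m w).
  rewrite !enormE; congr Num.sqrt.
  have -> : (Ahat *m Ahat^T - A *m A^T) *m w = - (A *m (A^T *m w)).
    rewrite mulmxBl (_ : Ahat *m Ahat^T *m w = 0) ?sub0r ?mulmxA //.
    by rewrite /w mulmxBr !mulmxA -[in X in _ - X](mulmxA Ahat) Ahat_orth mulmx1 subrr.
  by rewrite !sqnormN [RHS](sqnorm_orthonormal _ A_orth).
apply: (le_trans (opnorm_bound w)); rewrite ler_wpM2l ?opnorm_ge0 //.
exact: enorm_le.
Qed.

(** For k = 0 the Hoelder condition on g acts directly and gives the power s2 of
the displacement; for k > 0 the first order dominates. *)
Lemma projection_increment x rho : eball rho x -> 0 <= rho -> delta * rho <= 1 ->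
  (g (B *m (Ahat^T *m x)) - g (A^T *m x)) ^+ 2 <=
    ((delta * rho) ^+ 2) `^ (Num.min 1 (k%:R + s2)) *
    (2 * (k.+2%:R ^+ d * L) ^+ 2
     + 2 * (k.+1%:R ^+ d * gradient_size (k := k) g (A^T *m x)) ^+ 2).
Proof.
move=> xrho rho0 drho1.
have /andP[s20 s21] := s2_01.
set z := A^T *m x; set u := B *m (Ahat^T *m x) - z.
have -> : B *m (Ahat^T *m x) = z + u by rewrite /u addrC subrK.
set q := delta * rho in drho1 *.
have q0 : 0 <= q by rewrite mulr_ge0 // opnorm_ge0.
have uq : enorm u <= q.
  by apply: (le_trans (coordinate_error x)); rewrite ler_wpM2l ?opnorm_ge0.
have u1 : enorm u <= 1 by apply: le_trans uq drho1.
set G := gradient_size _ z.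
have G0 : 0 <= G by exact: sqrtr_ge0.
have inc := smooth_increment L0 s20 (smooth_exists g_smooth) (smooth_holder g_smooth)
  (@gradient_sizeP _ _ k g z) G0 u1.
pose tau := q `^ (Num.min 1 (k%:R + s2)).
have tau0 : 0 <= tau by exact: powR_ge0.
have tauE : (q ^+ 2) `^ (Num.min 1 (k%:R + s2)) = tau ^+ 2.
  by rewrite expr2 powRM // -expr2.
have holder : enorm u `^ s2 * enorm u ^+ k <= tau.
  apply: (@le_trans _ _ (q `^ s2 * q ^+ k)).
    rewrite ler_pM ?powR_ge0 ?exprn_ge0 ?enorm_ge0 //.
      by apply: ge0_ler_powR; rewrite ?nnegrE ?enorm_ge0 // ltW.
    by rewrite lerXn2r ?nnegrE ?enorm_ge0.
  rewrite /tau; case: (k) => [|k']; first by rewrite expr0 mulr1 add0r min_r.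
  rewrite min_l; last by rewrite -natr1 -addrA addrCA lerDl addr_ge0 // ltW.
  rewrite powRr1 // exprS mulrCA -[leRHS]mulr1 ler_wpM2l //.
  rewrite -[leRHS]mulr1 ler_pM ?powR_ge0 ?exprn_ge0 //; last by rewrite exprn_ile1.
  apply: (@le_trans _ _ (1 `^ s2)); last by rewrite powR1.
  by apply: ge0_ler_powR; rewrite ?nnegrE // ltW.
have grad : enorm u * G <= tau * G.
  case: (posnP k) => [k0|k0].
    suff -> : G = 0 by rewrite !mulr0.
    rewrite /G /gradient_size big_pred0 ?sqrtr0 // => a.
    by apply/negbTE/negP => /andP[h1 /(leq_trans h1)]; rewrite k0.
  rewrite ler_wpM2r // /tau min_l ?powRr1 //.
  by rewrite -[leLHS]addr0 lerD ?ler1n // ltW.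
rewrite tauE -real_normK ?num_real //.
set a := k.+2%:R ^+ d * L; set b := k.+1%:R ^+ d * G.
have a0 : 0 <= a by rewrite mulr_ge0 // exprn_ge0.
have b0 : 0 <= b by rewrite mulr_ge0 // exprn_ge0.
have {}inc : `|g (z + u) - g z| <= tau * (a + b).
  apply: (le_trans inc); rewrite mulrDr lerD //.
    rewrite -(mulrA L) (mulrA (_ ^+ d)) -/a [leRHS]mulrC.
    exact: (ler_wpM2l a0 holder).
  rewrite /b [leRHS]mulrCA; exact: (ler_wpM2l (exprn_ge0 d (ler0n R k.+1)) grad).
apply: (@le_trans _ _ ((tau * (a + b)) ^+ 2)).
  by rewrite lerXn2r ?nnegrE // mulr_ge0 // addr_ge0.
rewrite exprMn ler_wpM2l ?sqr_ge0 //.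
by have := sqr_ge0 (a - b); rewrite sqrrB sqrrD; lra.
Qed.

End Approximation.

(** * Regression with conditionally centred noise *)

Lemma measurable_clip1 {R : realType} d (W : measurableType d) (h : W -> R) :
  measurable_fun setT h -> measurable_fun setT (fun w => clip1 (h w)).
Proof.
move=> mh; under eq_fun do rewrite clip1E.
apply: measurable_maxr; first exact: measurable_cst.
by apply: measurable_minr; first exact: measurable_cst.
Qed.

Section Regression.
Context {R : realType} {disp dU : measure_display}.
Context {T : measurableType disp} {U : measurableType dU}.
Context (P : probability T R) {N K : nat}.
Variables (phi : 'I_K -> U -> R) (f : U -> R) (sigma : R).
Variables (X : {RV P >-> U}) (zeta Y : {RV P >-> R}) (e v : T -> R).
Variables (S : {RV P >-> N.-tuple (U * R)}) (ft : N.-tuple (U * R) -> U -> R).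
Hypothesis mphi : forall j, measurable_fun setT (phi j).
Hypothesis mf : measurable_fun setT f.
Hypothesis YE : forall w, Y w = f (X w) + zeta w.
Hypothesis zeta_mean : is_cond_exp P X zeta e.
Hypothesis e0 : {ae P, forall w, e w = 0}.
Hypothesis zeta_var : is_cond_var P X zeta v.
Hypothesis v_le : {ae P, forall w, v w <= sigma ^+ 2}.
Hypothesis f_le1 : {ae P, forall w, `|f (X w)| <= 1}.
Hypothesis S_indep : mutually_independent P (fun (i : 'I_N) w => tnth (S w) i).
Hypothesis S_law : forall i : 'I_N,
  same_law P (fun w => tnth (S w) i) (fun w => (X w, Y w)).
Hypothesis XS_indep : independent_pair P X S.
Hypothesis mft : measurable_fun setT (fun q : N.-tuple (U * R) * U => ft q.1 q.2).
Hypothesis ft_span : forall s, exists c, forall x, ft s x = lincomb phi c x.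
Hypothesis ft_min : forall (s : N.-tuple (U * R)) c,
  \sum_j (ft s (tnth s j).1 - (tnth s j).2) ^+ 2 <=
  \sum_j (lincomb phi c (tnth s j).1 - (tnth s j).2) ^+ 2.

Let mX : measurable_fun setT X. Proof. exact: measurable_funP. Qed.
Let mY : measurable_fun setT Y. Proof. exact: measurable_funP. Qed.
Let mS : measurable_fun setT S. Proof. exact: measurable_funP. Qed.

Let XY (w : T) : U * R := (X w, Y w).
Let mXY : measurable_fun setT XY. Proof. exact: measurable_fun_pair. Qed.

(* f is only almost surely bounded by 1 along X. *)
Let f0 (x : U) : R := clip1 (f x).

Let mf0 : measurable_fun setT f0. Proof. exact: measurable_clip1. Qed.

Let f0E : {ae P, forall w, f0 (X w) = f (X w)}.
Proof. by apply: filterS f_le1 => w; exact: clip1_id. Qed.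

Local Open Scope ereal_scope.

Let XY_mixin := isMeasurableFun.Build _ _ _ _ XY mXY.
Let XY_mfun : {mfun T >-> (U * R)%type} := HB.pack XY XY_mixin.

Let m1 : probability (N.-tuple (U * R)) R := distribution P S.
Let m2 : probability (U * R)%type R := distribution P XY_mfun.

Let int_m2 (F : U * R -> \bar R) : measurable_fun setT F ->
  \int[m2]_z F z = \int[P]_w F (X w, Y w).
Proof.
move=> mF.
have law A : measurable A -> m2 ((fun z : U * R => z) @^-1` A) = P (XY @^-1` A) by [].
have mid : measurable_fun setT (fun z : U * R => z) by exact: measurable_id.
exact: (integral_transfer mid mXY law mF).
Qed.

Let m1_iid B : (forall k, measurable (B k)) ->
  fine (m1 (box B)) = (\prod_k fine (m2 (B k)))%R.
Proof.
move=> mB; have -> : (\prod_k fine (m2 (B k)) =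
    \prod_(k in [set: 'I_N]%SET) fine (P ((fun w => tnth (S w) k) @^-1` B k)))%R.
  by apply: eq_big => [k|k _]; [rewrite finset.in_setT|rewrite (S_law k (mB k))].
rewrite -S_indep //; congr (fine (P _)); apply/seteqP; split => w /= Sw k.
  by move=> _; exact: Sw.
by apply: Sw; rewrite /= finset.in_setT.
Qed.

Let cond := cond_var_second_moment mX zeta_mean e0 zeta_var v_le.
Let izeta : P.-integrable setT (EFin \o zeta). Proof. by case: cond. Qed.
Let mzeta : measurable_fun setT zeta. Proof. exact: measurable_funP. Qed.

Let noiseE : {ae P, forall w, (Y w - f0 (X w) = zeta w)%R}.
Proof. by apply: filterS f0E => w ->; rewrite YE addrAC subrr add0r. Qed.

Let mnoise : measurable_fun setT (fun z : U * R => (z.2 - f0 z.1)%R).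
Proof.
apply: measurable_funB; first exact: measurable_snd.
exact: measurableT_comp mf0 measurable_fst.
Qed.

Let noise_mean (psi : U -> R) (C : R) : measurable_fun setT psi ->
  (forall x, `|psi x| <= C)%R -> \int[m2]_z (psi z.1 * (z.2 - f0 z.1))%:E = 0.
Proof.
move=> mpsi psiC; have [_ zeta0 _] := cond.
have mpsi1 : measurable_fun setT (fun z : U * R => psi z.1).
  exact: measurableT_comp mpsi measurable_fst.
rewrite int_m2; last by apply/measurable_EFinP; exact: measurable_funM.
rewrite -[RHS](integral_weighted_eq0 mX izeta zeta0 mpsi psiC).
have mpsiX : measurable_fun setT (fun w => psi (X w)) by exact: measurableT_comp.
apply: ae_eq_integral => //.
- apply/measurable_EFinP; apply: measurable_funM => //.
  by apply: measurable_funB => //; exact: measurableT_comp.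
- by apply/measurable_EFinP; exact: measurable_funM.
- by apply: filterS noiseE => w /= ->.
Qed.

Let noise_var (psi : U -> R) : measurable_fun setT psi ->
  (forall x, 0 <= psi x)%R ->
  \int[m2]_z (psi z.1 * (z.2 - f0 z.1) ^+ 2)%:E <=
    (sigma ^+ 2)%:E * \int[m2]_z (psi z.1)%:E.
Proof.
move=> mpsi psi0; have [_ _ zeta2] := cond.
have mpsi1 : measurable_fun setT (fun z : U * R => psi z.1).
  exact: measurableT_comp mpsi measurable_fst.
have mpsiX : measurable_fun setT (fun w => psi (X w)) by exact: measurableT_comp.
rewrite int_m2; last first.
  by apply/measurable_EFinP; apply: measurable_funM => //; exact: measurable_funX.
rewrite int_m2; last exact/measurable_EFinP.
rewrite -ge0_integralZl_EFin ?sqr_ge0 //; last 2 first.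
- by move=> w _; rewrite lee_fin.
- exact/measurable_EFinP.
rewrite [leLHS](ge0_ae_eq_integral (g := fun w => (psi (X w) * zeta w ^+ 2)%:E)) //.
- have := le_integral_weighted (P := P) mX (W1 := fun w => (zeta w ^+ 2)%R)
    (W2 := cst (sigma ^+ 2)%R) (measurable_funX _ mzeta) (measurable_cst _)
    (fun w => sqr_ge0 _) (fun w => sqr_ge0 _) zeta2 mpsi psi0.
  move=> /le_trans; apply; rewrite le_eqVlt; apply/orP; left; apply/eqP.
  by apply: eq_integral => w _; rewrite -EFinM mulrC.
- apply/measurable_EFinP; apply: measurable_funM => //; apply: measurable_funX.
  by apply: measurable_funB => //; exact: measurableT_comp.
- by apply/measurable_EFinP; apply: measurable_funM => //; exact: measurable_funX.
- by move=> w _; rewrite lee_fin mulr_ge0 // sqr_ge0.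
- by move=> w _; rewrite lee_fin mulr_ge0 // sqr_ge0.
- by apply: filterS noiseE => w /= -> _.
Qed.

Let risk (q : N.-tuple (U * R) * U) : R := ((clip1 (ft q.1 q.2) - f0 q.2) ^+ 2)%R.

Let mrisk : measurable_fun setT risk.
Proof.
apply: measurable_funX; apply: measurable_funB; first exact: measurable_clip1.
exact: measurableT_comp mf0 measurable_snd.
Qed.

Let risk_law : \int[P]_w (risk (S w, X w))%:E = \int[m1 \x m2]_q (risk (q.1, q.2.1))%:E.
Proof.
pose mX' : probability U R := distribution P X.
pose f1 (w : T) := (S w, X w).
pose f2 (q : N.-tuple (U * R) * (U * R)) := (q.1, q.2.1).
have mf1 : measurable_fun setT f1 by exact: measurable_fun_pair.
have mf2 : measurable_fun setT f2.
  apply: measurable_fun_pair; first exact: measurable_fst.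
  exact: measurableT_comp measurable_fst measurable_snd.
apply: (ge0_integral_transfer (m1 := P) (m2 := m1 \x m2) mf1 mf2 _
  (F := fun q => (risk q)%:E)); last 2 first.
- exact/measurable_EFinP.
- by move=> q; rewrite lee_fin sqr_ge0.
move=> C mC.
have h1 : (m1 \x mX') C = pushforward P f1 C.
  have u := product_measure_unique (m1 := m1) (m2 := mX') (m' := pushforward P f1).
  apply: (u mf1) => // B1 B2 mB1 mB2.
  have E : f1 @^-1` (B1 `*` B2) = (X @^-1` B2) `&` (S @^-1` B1).
    by apply/seteqP; split => w [].
  exact: etrans (congr1 P E) (etrans (XS_indep mB2 mB1) (muleC _ _)).
have h2 : (m1 \x mX') C = pushforward (m1 \x m2) f2 C.
  have u := product_measure_unique (m1 := m1) (m2 := mX')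
    (m' := pushforward (m1 \x m2) f2).
  apply: (u mf2) => // B1 B2 mB1 mB2.
  have E : f2 @^-1` (B1 `*` B2) = B1 `*` (fst @^-1` B2).
    by apply/seteqP; split => q [].
  apply: etrans (congr1 (m1 \x m2) E) _.
  rewrite product_measure1E //.
  by rewrite -[X in measurable X]setTI; exact: measurable_fst.
by rewrite -[LHS]h1 -[RHS]h2.
Qed.

(** Passing to the joint law of the observations, where the hypotheses on the
conditional moments become statements about integrals against weights that
depend on the design point only; there f may be replaced by its truncation. *)
Theorem regression_risk (c0 : 'I_K -> R) :
  'E_P[fun w => ((clip1 (ft (S w) (X w)) - f (X w)) ^+ 2)%R] <=
  8%:E * \int[P]_w ((lincomb phi c0 (X w) - f (X w)) ^+ 2)%:E
  + ((8 + 16 * sigma ^+ 2) * K%:R / N.+1%:R)%:E.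
Proof.
have mfX : measurable_fun setT (fun w => f (X w)) by exact: measurableT_comp.
have mf0X : measurable_fun setT (fun w => f0 (X w)) by exact: measurableT_comp.
have mftX : measurable_fun setT (fun w => ft (S w) (X w)).
  exact: measurableT_comp mft (measurable_fun_pair mS mX).
have mlin : measurable_fun setT (lincomb phi c0).
  by apply: measurable_sum => j; exact: measurable_funM.
have mlinX : measurable_fun setT (fun w => lincomb phi c0 (X w)).
  exact: measurableT_comp mlin mX.
rewrite unlock.
have -> : \int[P]_w ((clip1 (ft (S w) (X w)) - f (X w)) ^+ 2)%:E =
    \int[P]_w (risk (S w, X w))%:E.
  apply: ge0_ae_eq_integral => //.
  - by apply/measurable_EFinP/measurable_funX/measurable_funB => //; exact: measurable_clip1.
  - apply/measurable_EFinP.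
    exact: measurableT_comp mrisk (measurable_fun_pair mS mX).
  - by move=> w _; rewrite lee_fin sqr_ge0.
  - by move=> w _; rewrite lee_fin sqr_ge0.
  - by apply: filterS f0E => w /= fE _; rewrite /risk /= fE.
have -> : \int[P]_w ((lincomb phi c0 (X w) - f (X w)) ^+ 2)%:E =
    \int[m2]_z ((lincomb phi c0 z.1 - f0 z.1) ^+ 2)%:E.
  rewrite int_m2; last first.
    apply/measurable_EFinP/measurable_funX/measurable_funB.
      exact: measurableT_comp mlin measurable_fst.
    exact: measurableT_comp mf0 measurable_fst.
  apply: ge0_ae_eq_integral => //.
  - exact/measurable_EFinP/measurable_funX/measurable_funB.
  - exact/measurable_EFinP/measurable_funX/measurable_funB.
  - by move=> w _; rewrite lee_fin sqr_ge0.
  - by move=> w _; rewrite lee_fin sqr_ge0.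
  - by apply: filterS f0E => w /= fE _; rewrite fE.
rewrite risk_law.
apply: (truncated_least_squares_risk (m1 := m1) (m2 := m2)) => //.
- by move=> x; exact: clip1_le1.
- exact: sqr_ge0.
Qed.

End Regression.

(** * Rates *)

Section Rates.
Context {R : realType}.

Lemma le_powR2 (x y s : R) : 0 <= s -> 0 <= x -> x <= y -> x `^ s <= y `^ s.
Proof.
by move=> s0 x0 xy; apply: ge0_ler_powR; rewrite ?nnegrE // (le_trans x0).
Qed.

Lemma le_pow2 (x y : R) (m n : nat) : 1 <= x -> x <= y -> (m <= n)%N ->
  x ^+ m <= y ^+ n.
Proof.
move=> x1 xy mn; apply: (@le_trans _ _ (x ^+ n)); first by rewrite ler_weXn2l.
by rewrite lerXn2r ?nnegrE // ?(le_trans ler01) // (le_trans x1).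
Qed.

Lemma half_le_ln (N : nat) : (2 <= N)%N -> 2^-1 <= ln N%:R :> R.
Proof.
move=> N2; apply: (@le_trans _ _ (ln 2)); last first.
  by rewrite ler_ln ?posrE ?ltr0n ?ler_nat // (leq_trans _ N2).
have := @le_ln1Dx R (- 2^-1); rewrite ltrN2 invf_lt1 ?ltr1n // => /(_ isT).
have -> : 1 + - 2^-1 = 2^-1 :> R by field.
by rewrite lnV ?posrE // lerN2.
Qed.

Lemma exp2_ceil (x : R) :
  2 ^ Num.ceil x <= 2 * 2 `^ x /\ 2 ^ (- Num.ceil x) <= 2 `^ (- x).
Proof.
have /andP[c1 c2] := ceil_itv x; rewrite -!powR_intmul //; split.
  rewrite -[X in X * _]powRr1 // -powRD; last by rewrite pnatr_eq0 implybT.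
  by rewrite ler_powR ?ler1n // ltW // -ltrBlDl -[X in _ - X]mulr1z -intrB.
by rewrite mulrNz ler_powR ?ler1n // lerN2.
Qed.

Lemma powR2_log (x E : R) : 0 < x -> 2 `^ (ln x / ln 2 / E) = x `^ E^-1.
Proof.
move=> x0; rewrite /powR pnatr_eq0 /= gt_eqF //; congr expR.
have ln2 : ln 2 != 0 :> R by rewrite gt_eqF // ln_gt0 // ltr1n.
have [->|E0] := eqVneq E 0; first by rewrite invr0 mulr0 !mul0r.
by field; rewrite ln2 E0.
Qed.

Section FixedSample.
Variables (d k N : nat) (s2 L kappa : R).
Hypotheses (d0 : (0 < d)%N) (N2 : (2 <= N)%N) (s2_01 : 0 < s2 <= 1).
Hypotheses (L0 : 0 <= L) (kappa0 : 0 <= kappa).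

Let s : R := k%:R + s2.
Let n : R := N%:R.
Let E : R := 2 * s + d%:R.
Let l : int := Num.ceil (ln n / ln 2 / E).
Let rate : R := n `^ (- (2 * s / E)).
Let r : R := Num.sqrt (kappa * ln n).
Let logpow : R := ln n `^ (Num.max 1 (d%:R / 2)).

Let s20 : 0 < s2. Proof. by case/andP: s2_01. Qed.
Let s0 : 0 < s. Proof. by rewrite ltr_wpDl. Qed.
Let d0R : 0 < d%:R :> R. Proof. by rewrite ltr0n. Qed.
Let E0 : 0 < E. Proof. by rewrite addr_gt0 // mulr_gt0. Qed.
Let n0 : 0 < n. Proof. by rewrite ltr0n (leq_trans _ N2). Qed.
Let n1 : 1 <= n. Proof. by rewrite ler1n (leq_trans _ N2). Qed.
Let ln0 : 0 < ln n.
Proof. by apply: lt_le_trans (half_le_ln N2); rewrite invr_gt0. Qed.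

Let s2_ge0 : 0 <= s2. Proof. exact: ltW. Qed.
Let s_ge0 : 0 <= s. Proof. exact: ltW. Qed.
Let n_ge0 : 0 <= n. Proof. exact: ltW. Qed.
Let ln_ge0 : 0 <= ln n. Proof. exact: ltW. Qed.

Let l_up : 2 ^ l <= 2 * n `^ E^-1.
Proof. by have [h _] := exp2_ceil (ln n / ln 2 / E); rewrite -powR2_log. Qed.

Let l_down : 2 ^ (- l) <= n `^ (- E^-1).
Proof.
have [_ h] := exp2_ceil (ln n / ln 2 / E); apply: (le_trans h).
by rewrite [leRHS]powRN -powR2_log // -powRN.
Qed.

Lemma inv_le_rate : n^-1 <= rate.
Proof.
rewrite -powR_inv1 ?(ltW n0) // /rate; apply: ler_powR => //.
rewrite lerN2 ler_pdivrMr // mul1r.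
by rewrite lerDl ltW.
Qed.

Lemma one_le_logpow : 1 <= 2 ^+ d * logpow /\
  ln n `^ (d%:R / 2) <= 2 ^+ d * logpow.
Proof.
have d1 : 1 <= d%:R :> R by rewrite ler1n.
have x1 : 1 <= 2 * ln n by have := half_le_ln N2; rewrite -/n => ?; lra.
rewrite /logpow; set m := Num.max 1 (d%:R / 2).
have m0 : 0 <= m by rewrite le_max ler01.
have e1 : (2 * ln n) `^ m <= 2 ^+ d * ln n `^ m.
  rewrite powRM // ler_wpM2r ?powR_ge0 // -powR_mulrn //.
  by apply: ler_powR; rewrite ?ler1n // /m ge_max d1 /=; have := d1; lra.
split; apply: le_trans e1.
  by have := ler_powR x1 m0; rewrite powRr0.
apply: (@le_trans _ _ ((2 * ln n) `^ (d%:R / 2))).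
  apply: le_powR2; rewrite ?(ltW ln0) ?divr_ge0 //; have := ln0; lra.
by apply: ler_powR => //; rewrite /m le_max lexx orbT.
Qed.

(** The cells have diameter at most sqrt d * N `^ (- 1 / (2 s + d)), to be raised to
the power 2 s. *)
Lemma bias_rate :
  (k.+2%:R ^+ d * (L * (Num.sqrt d%:R * 2 ^ (- l)) `^ s2
                     * (Num.sqrt d%:R * 2 ^ (- l)) ^+ k)) ^+ 2 <=
  (s + 2) ^+ (2 * d) * (d%:R + 1) `^ s * L ^+ 2 * rate.
Proof.
set eta := Num.sqrt d%:R * 2 ^ (- l).
have sq0 : 0 < Num.sqrt d%:R :> R by rewrite sqrtr_gt0.
have eta0 : 0 < eta by rewrite mulr_gt0 // exp2_gt0.
have [sq_ge0 eta_ge0] : 0 <= Num.sqrt d%:R :> R /\ 0 <= eta by rewrite !ltW.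
have -> : L * eta `^ s2 * eta ^+ k = L * eta `^ s.
  rewrite -mulrA -powR_mulrn // -powRD; last by rewrite (gt_eqF eta0) implybT.
  by rewrite [s2 + _]addrC.
have eta2 : (eta `^ s) ^+ 2 <= (d%:R + 1) `^ s * rate.
  apply: (@le_trans _ _ (((Num.sqrt d%:R * n `^ (- E^-1)) `^ s) ^+ 2)).
    rewrite lerXn2r ?nnegrE ?powR_ge0 //; apply: le_powR2; rewrite //.
    by rewrite ler_pM2l.
  rewrite powRM ?powR_ge0 // exprMn ler_pM ?sqr_ge0 //.
    rewrite expr2 -powRM // -expr2 sqr_sqrtr //.
    by apply: le_powR2; rewrite ?lerDl //.
  rewrite -powRrM -powR_mulrn ?powR_ge0 // -powRrM /rate.
  by rewrite le_eqVlt; apply/orP; left; apply/eqP; congr (_ `^ _); field; rewrite (gt_eqF E0).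
have ks : k.+2%:R ^+ (2 * d) <= (s + 2) ^+ (2 * d).
  apply: lerXn2r; rewrite ?nnegrE //; first by have := s0; lra.
  by rewrite -[k.+2]addn2 natrD /s; have := s20; lra.
rewrite exprMn exprMn -exprM [(d * 2)%N]mulnC.
have -> : (s + 2) ^+ (2 * d) * (d%:R + 1) `^ s * L ^+ 2 * rate =
    (s + 2) ^+ (2 * d) * (L ^+ 2 * ((d%:R + 1) `^ s * rate)) by ring.
apply: ler_pM => //; first by rewrite mulr_ge0 ?sqr_ge0.
by apply: ler_wpM2l => //; rewrite sqr_ge0.
Qed.

Lemma add1_expn (y : R) : 0 <= y -> (1 + y) ^+ d <= 2 ^+ d * (1 + y ^+ d).
Proof.
move=> y0; have [y1|y1] := leP y 1.
  apply: (@le_trans _ _ (2 ^+ d)).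
    by apply: lerXn2r; rewrite ?nnegrE //; lra.
  by apply: ler_peMr; rewrite ?lerDl exprn_ge0.
apply: (@le_trans _ _ ((2 * y) ^+ d)).
  by apply: lerXn2r; rewrite ?nnegrE //; lra.
by rewrite exprMn; apply: ler_wpM2l; rewrite ?exprn_ge0 // lerDr.
Qed.

(** By the choice of l, 2^(l d) / N is at most 2^d times the rate. *)
Lemma cells_rate (M K : nat) : M%:R <= 2 ^ l * r + 1 ->
  (K <= M.*2.+1 ^ d * k.+1 ^ d)%N ->
  K%:R / N.+1%:R <= 2 ^+ d * ((s + 1) ^+ d * 12 ^+ d) *
    ((1 + kappa `^ (d%:R / 2)) * logpow * rate).
Proof.
move=> Mr Kle.
have y0 : 0 <= 2 ^ l * r by rewrite mulr_ge0 ?sqrtr_ge0 // ltW // exp2_gt0.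
set y := 2 ^ l * r in Mr y0.
have pow_y := add1_expn y0.
have rd : r ^+ d = kappa `^ (d%:R / 2) * ln n `^ (d%:R / 2).
  rewrite -powRM // -powR_mulrn ?sqrtr_ge0 // /r -powR12_sqrt ?mulr_ge0 //.
  by rewrite -powRrM [_^-1 * _]mulrC.
set kd := kappa `^ _ in rd *; set ld := ln n `^ _ in rd.
have kd0 : 0 <= kd by exact: powR_ge0.
have ld0 : 0 <= ld by exact: powR_ge0.
have rate0 : 0 <= rate by exact: powR_ge0.
have [log1 log2] := one_le_logpow; rewrite -/ld in log2.
have yd : y ^+ d / n <= 2 ^+ d * (kd * ld * rate).
  rewrite /y exprMn rd.
  apply: (@le_trans _ _ ((2 * n `^ E^-1) ^+ d * (kd * ld) / n)).
    rewrite ler_wpM2r ?invr_ge0 ?(ltW n0) // ler_wpM2r ?mulr_ge0 //.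
    by rewrite lerXn2r ?nnegrE ?mulr_ge0 ?powR_ge0 // ltW // exp2_gt0.
  have -> : rate = (n `^ E^-1) ^+ d / n.
    rewrite /rate -powR_mulrn ?powR_ge0 // -powRrM -[X in _ = _ / X]powRr1 //.
    rewrite -powRB; last by rewrite (gt_eqF n0) implybT.
    by congr (_ `^ _); rewrite /E; field; rewrite (gt_eqF E0).
  by rewrite exprMn le_eqVlt; apply/orP; left; apply/eqP; ring.
have K1 : K%:R <= 3 ^+ d * (1 + y) ^+ d * (s + 1) ^+ d.
  apply: (@le_trans _ _ ((M.*2.+1 ^ d * k.+1 ^ d)%N%:R)); first by rewrite ler_nat.
  have M3 : M.*2.+1%:R <= 3 * (1 + y).
    by rewrite -addn1 natrD -muln2 natrM; move: (y) y0 Mr => y' *; lra.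
  have k1 : k.+1%:R <= s + 1.
    by rewrite -[k.+1]addn1 natrD /s; have := s20; lra.
  rewrite natrM !natrX -[X in _ <= X * _]exprMn.
  by apply: ler_pM; rewrite ?exprn_ge0 //; apply: lerXn2r;
    rewrite ?nnegrE // (le_trans _ M3, le_trans _ k1).
have sd0 : 0 <= (s + 1) ^+ d by rewrite exprn_ge0 // addr_ge0 // ltW.
apply: (@le_trans _ _ (K%:R / n)).
  by apply: ler_wpM2l; rewrite ?ler0n // lef_pV2 ?posrE // /n ?ltr0n // ler_nat.
apply: (@le_trans _ _ ((6 ^+ d * (s + 1) ^+ d) * ((1 + y ^+ d) / n))).
  rewrite mulrA ler_wpM2r ?invr_ge0 ?(ltW n0) //; apply: (le_trans K1).
  have -> : 6 = 3 * 2 :> R by ring.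
  rewrite exprMn [leRHS]mulrAC ler_wpM2r // -mulrA.
  by rewrite ler_wpM2l ?exprn_ge0.
have hn : (1 + y ^+ d) / n <= 2 ^+ d * (1 + kd * ld) * rate.
  have e1 : n^-1 <= 2 ^+ d * rate.
    by apply: (le_trans inv_le_rate); rewrite ler_peMl // exprn_ege1 // ler1n.
  have := lerD e1 yd; rewrite -[X in X + _]mul1r -mulrDl => /le_trans; apply.
  by rewrite le_eqVlt; apply/orP; left; apply/eqP; ring.
have hl : 1 + kd * ld <= 2 ^+ d * ((1 + kd) * logpow).
  have -> : 2 ^+ d * ((1 + kd) * logpow) = 2 ^+ d * logpow + kd * (2 ^+ d * logpow).
    by ring.
  by apply: lerD => //; apply: ler_wpM2l.
have -> : 12 = 6 * 2 :> R by ring.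
rewrite [(6 * 2) ^+ d]exprMn.
apply: (@le_trans _ _ (6 ^+ d * (s + 1) ^+ d *
    (2 ^+ d * (2 ^+ d * ((1 + kd) * logpow)) * rate))).
  apply: ler_wpM2l; first by apply: mulr_ge0 => //; rewrite exprn_ge0.
  by apply: (le_trans hn); apply: ler_wpM2r => //; apply: ler_wpM2l;
    rewrite ?exprn_ge0.
by rewrite le_eqVlt; apply/orP; left; apply/eqP; ring.
Qed.

End FixedSample.
End Rates.

(** * Constants *)

Section Constants.
Context {R : realType}.

(** The summands stand for the approximation error, the mass outside the ball and
the dimension of the class over the sample size; [2 ^+ d] is the price of
replacing [1] and [ln N `^ (d / 2)] by [ln N `^ max 1 (d / 2)], as [ln N] may be
less than [1]. *)
Definition variance_constant (sigma : R) (d : nat) (s L : R) : R :=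
  2 ^+ d * (16 * ((s + 2) ^+ (2 * d) * (d%:R + 1) `^ s * L ^+ 2) + 16
            + (8 + 16 * sigma ^+ 2) * ((s + 1) ^+ d * 12 ^+ d)).

(** The [4] bounds the error outright when the projection error may move points of
the ball by more than [1]. *)
Definition projection_constant (M sigma : R) (d : nat) (s L : R) : R :=
  4 + 32 * ((s + 2) ^+ (2 * d) * L ^+ 2 + (s + 1) ^+ (3 * d) * (1 + M)).

Lemma variance_constant_mono (sigma sigma' : R) (d d' : nat) (s s' L L' : R) :
  0 <= sigma <= sigma' -> (d <= d')%N -> 0 < s <= s' -> 0 <= L <= L' ->
  variance_constant sigma d s L <= variance_constant sigma' d' s' L'.
Proof.
move=> /andP[sg0 sg] dd /andP[s0 ss] /andP[L0 LL].
have dR : d%:R + 1 <= d'%:R + 1 :> R by rewrite lerD2r ler_nat.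
have h2 : 2 ^+ d <= 2 ^+ d' :> R by apply: le_pow2; rewrite ?ler1n.
have hs2 : (s + 2) ^+ (2 * d) <= (s' + 2) ^+ (2 * d').
  by apply: le_pow2; rewrite ?leq_mul2l //; lra.
have hs1 : (s + 1) ^+ d <= (s' + 1) ^+ d' by apply: le_pow2 => //; lra.
have h12 : 12 ^+ d <= 12 ^+ d' :> R by apply: le_pow2; rewrite ?ler1n.
have hp : (d%:R + 1) `^ s <= (d'%:R + 1) `^ s'.
  apply: (@le_trans _ _ ((d'%:R + 1) `^ s)); first by apply: le_powR2 => //; exact: ltW.
  by apply: ler_powR => //; rewrite lerDr.
have hL : L ^+ 2 <= L' ^+ 2 by apply: lerXn2r; rewrite ?nnegrE ?(le_trans L0).
have hsg : sigma ^+ 2 <= sigma' ^+ 2.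
  by apply: lerXn2r; rewrite ?nnegrE ?(le_trans sg0).
have n2 : 0 <= (s + 2) ^+ (2 * d) by apply: exprn_ge0; lra.
have n1 : 0 <= (s + 1) ^+ d by apply: exprn_ge0; lra.
have np : 0 <= (d%:R + 1) `^ s by exact: powR_ge0.
have nL := sqr_ge0 L; have nsg := sqr_ge0 sigma.
have e1 : (s + 2) ^+ (2 * d) * (d%:R + 1) `^ s * L ^+ 2 <=
    (s' + 2) ^+ (2 * d') * (d'%:R + 1) `^ s' * L' ^+ 2.
  by apply: ler_pM => //; [exact: mulr_ge0 | exact: ler_pM].
have e2 : (8 + 16 * sigma ^+ 2) * ((s + 1) ^+ d * 12 ^+ d) <=
    (8 + 16 * sigma' ^+ 2) * ((s' + 1) ^+ d' * 12 ^+ d').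
  apply: ler_pM; [lra | exact: mulr_ge0 | lra | exact: ler_pM].
have n3 : 0 <= (s + 2) ^+ (2 * d) * (d%:R + 1) `^ s * L ^+ 2.
  by rewrite !mulr_ge0.
have n4 : 0 <= (8 + 16 * sigma ^+ 2) * ((s + 1) ^+ d * 12 ^+ d).
  by apply: mulr_ge0; [lra | exact: mulr_ge0].
rewrite /variance_constant; apply: ler_pM => //; first by lra.
by lra.
Qed.

Lemma projection_constant_mono (M M' sigma sigma' : R) (d d' : nat)
    (s s' L L' : R) :
  0 <= M <= M' -> 0 <= sigma <= sigma' -> (d <= d')%N -> 0 < s <= s' ->
  0 <= L <= L' ->
  projection_constant M sigma d s L <= projection_constant M' sigma' d' s' L'.
Proof.
move=> /andP[M0 MM] _ dd /andP[s0 ss] /andP[L0 LL].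
have hs2 : (s + 2) ^+ (2 * d) <= (s' + 2) ^+ (2 * d').
  by apply: le_pow2; rewrite ?leq_mul2l //; lra.
have hs1 : (s + 1) ^+ (3 * d) <= (s' + 1) ^+ (3 * d').
  by apply: le_pow2; rewrite ?leq_mul2l //; lra.
have hL : L ^+ 2 <= L' ^+ 2 by apply: lerXn2r; rewrite ?nnegrE ?(le_trans L0).
have n2 : 0 <= (s + 2) ^+ (2 * d) by apply: exprn_ge0; lra.
have n1 : 0 <= (s + 1) ^+ (3 * d) by apply: exprn_ge0; lra.
have e1 : (s + 2) ^+ (2 * d) * L ^+ 2 <= (s' + 2) ^+ (2 * d') * L' ^+ 2.
  by apply: ler_pM => //; exact: sqr_ge0.
have e2 : (s + 1) ^+ (3 * d) * (1 + M) <= (s' + 1) ^+ (3 * d') * (1 + M').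
  by apply: ler_pM => //; lra.
by rewrite /projection_constant; lra.
Qed.

Lemma variance_constant_ge0 (sigma : R) d (s L : R) :
  0 <= s -> 0 <= variance_constant sigma d s L.
Proof.
move=> s0.
have n2 : 0 <= (s + 2) ^+ (2 * d) by apply: exprn_ge0; lra.
have n1 : 0 <= (s + 1) ^+ d by apply: exprn_ge0; lra.
have e1 : 0 <= (s + 2) ^+ (2 * d) * (d%:R + 1) `^ s * L ^+ 2.
  by apply: mulr_ge0; [apply: mulr_ge0 => //; exact: powR_ge0 | exact: sqr_ge0].
have e2 : 0 <= (8 + 16 * sigma ^+ 2) * ((s + 1) ^+ d * 12 ^+ d).
  by apply: mulr_ge0; [have := sqr_ge0 sigma; lra | exact: mulr_ge0].
by apply: mulr_ge0 => //; lra.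
Qed.

Lemma projection_constant_ge4 (sigma : R) d (s L M : R) :
  0 <= s -> 0 <= M -> 4 <= projection_constant M sigma d s L.
Proof.
move=> s0 M0.
have n2 : 0 <= (s + 2) ^+ (2 * d) by apply: exprn_ge0; lra.
have n1 : 0 <= (s + 1) ^+ (3 * d) by apply: exprn_ge0; lra.
have e1 : 0 <= (s + 2) ^+ (2 * d) * L ^+ 2 by apply: mulr_ge0; rewrite ?sqr_ge0.
have e2 : 0 <= (s + 1) ^+ (3 * d) * (1 + M) by apply: mulr_ge0 => //; lra.
by rewrite /projection_constant; lra.
Qed.

(** Compare one derivative of order k at a basis vector and at the origin, which
have distance 1. *)
Lemma smooth_constant_ge0 (m k : nat) (g : 'cV[R]_m -> R) (L s2 : R) :
  (0 < m)%N -> smooth L k s2 g -> 0 <= L.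
Proof.
move=> m0 [_ g_holder]; pose j0 : 'I_m := Ordinal m0.
pose a : {ffun 'I_m -> nat} := [ffun j => if j == j0 then k else 0%N].
have ak : mdegree a = k.
  rewrite /mdegree (bigD1 j0) //= big1 ?addn0 ?ffunE ?eqxx // => j jj0.
  by rewrite ffunE (negPf jj0).
have := g_holder a ak (delta_mx j0 0) 0; rewrite subr0.
have -> : enorm (delta_mx j0 0 : 'cV[R]_m) = 1.
  rewrite /enorm (bigD1 j0) //= big1 ?addr0 ?mxE ?eqxx ?expr1n ?sqrtr1 // => j jj0.
  by rewrite mxE (negPf jj0) expr0n.
by rewrite powR1 mulr1; apply: le_trans.
Qed.

Lemma le_inflated_constant (d k : nat) (L s delta : R) :
  (0 < d)%N -> 0 <= L -> 0 <= s -> 0 <= delta < 1 ->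
  L <= L * d%:R `^ (k%:R / 2) * (1 - delta ^+ 2) `^ (- (s / 2)).
Proof.
move=> d0 L0 s0 /andP[de0 de1].
have h1 : 1 <= d%:R `^ (k%:R / 2) :> R.
  by rewrite -[leLHS](powRr0 d%:R); apply: ler_powR; rewrite ?ler1n ?divr_ge0.
have d2 : 0 <= delta ^+ 2 < 1 by rewrite sqr_ge0 exprn_ilt1.
have h2 : 1 <= (1 - delta ^+ 2) `^ (- (s / 2)).
  rewrite powRN invf_ge1 ?powR_gt0 //; last by lra.
  have := @le_powR2 R (1 - delta ^+ 2) 1 (s / 2).
  by rewrite powR1; apply; [rewrite divr_ge0 | lra | lra].
rewrite -mulrA; apply: ler_peMr => //.
by apply: mulr_ege1.
Qed.

End Constants.

(** * Bias of the class built on the estimated directions *)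

Section ProjectionBias.
Context {R : realType} {disp : measure_display} {T : measurableType disp}.
Variable P : probability T R.
Context {D d k N : nat}.
Variables (L s2 : R) (A Ahat : 'M[R]_(D, d)) (g : 'cV[R]_d -> R) (X : T -> 'cV[R]_D).
Hypotheses (D0 : (0 < D)%N) (N2 : (2 <= N)%N).
Hypotheses (A_orth : orthonormal_cols A) (Ahat_orth : orthonormal_cols Ahat).
Hypotheses (L0 : 0 <= L) (s2_01 : 0 < s2 <= 1) (g_smooth : smooth L k s2 g).
Hypotheses (mX : measurable_fun setT X) (sX : sub_gaussian P X).
Hypothesis f_le1 : {ae P, forall w, `|g (A^T *m X w)| <= 1}.

Let r := Num.sqrt (D%:R * fine (psi2_vec P X) ^+ 2 * ln N%:R).
Let delta := opnorm (Ahat *m Ahat^T - A *m A^T).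
Let tau := ((delta * r) ^+ 2) `^ Num.min 1 (k%:R + s2).
Let Z w := A^T *m X w.

Let r2_ge0 : 0 <= D%:R * fine (psi2_vec P X) ^+ 2 * ln N%:R.
Proof.
by apply: mulr_ge0; [rewrite mulr_ge0 ?sqr_ge0 | rewrite ln_ge0 // ler1n (leq_trans _ N2)].
Qed.

Let mZ : measurable_fun setT Z. Proof. exact: measurable_mulmx. Qed.

Lemma projected_moment n : (\int[P]_w ((1 + sqnorm (Z w)) ^+ n)%:E < +oo)%E.
Proof.
have sq0 m (x : 'cV[R]_m) : 0 <= 1 + sqnorm x.
  by rewrite addr_ge0 // sumr_ge0 // => i _; exact: sqr_ge0.
have msq m (V : T -> 'cV[R]_m) : measurable_fun setT V ->
    measurable_fun setT (fun w => ((1 + sqnorm (V w)) ^+ n)%:E).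
  move=> mV; apply/measurable_EFinP/measurable_funX/measurable_funD => //.
  exact: measurableT_comp (@measurable_sqnorm _ _) mV.
apply: le_lt_trans (sub_gaussian_moment D0 mX sX n).
apply: ge0_le_integral => //.
- by move=> w _; rewrite lee_fin exprn_ge0.
- exact: msq.
- exact: msq.
- move=> w _; rewrite lee_fin; apply: lerXn2r; rewrite ?nnegrE //.
  by rewrite lerD2l sqnorm_orthonormal_tr.
Qed.

Let measurable_gradient_size_sqr :
  measurable_fun setT (fun w => gradient_size (k := k) g (Z w) ^+ 2).
Proof.
under eq_fun do rewrite (@gradient_size_sqr R d k g).
under eq_fun do rewrite big_mkcond.
apply: measurable_sum => a; case: (boolP (0 < \sum_j a j <= k)%N) => ak;
  last exact: measurable_cst.
apply: measurable_funX.
apply: measurableT_comp mZ; apply: (measurable_pderiv L0 s2_01 g_smooth).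
have /andP[_ ak'] := ak; suff -> : mdegree [ffun j => a j : nat] = (\sum_j a j)%N by [].
by apply: eq_bigr => j _; rewrite ffunE.
Qed.

(** Inside the ball the error is that of the approximation plus the increment of g
from wrong coordinates, whose random factor is integrated with the moments of
the derivatives; outside, h vanishes, f is bounded by 1 and the mass is 2 / N. *)
Lemma projection_bias (h : 'cV[R]_D -> R) (b : R) :
  measurable_fun setT h ->
  (forall x, eball r x -> `|h x - g (A^T *m Ahat *m (Ahat^T *m x))| <= b) ->
  (forall x, ~ eball r x -> h x = 0) -> delta * r <= 1 ->
  (\int[P]_w ((h (X w) - g (A^T *m X w)) ^+ 2)%:E <=
   (2 * b ^+ 2 + 2 / N%:R + tau * (4 * (k.+2%:R ^+ d * L) ^+ 2 +
      4 * (k.+1%:R ^+ (3 * d) * (1 + deriv_moment P k g Z))))%:E)%E.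
Proof.
move=> mh hb h0 dr1.
pose C := [set w | D%:R * fine (psi2_vec P X) ^+ 2 * ln N%:R < sqnorm (X w)].
have mC : measurable C.
  have := measurable_fun_ltr (measurable_cst (D%:R * fine (psi2_vec P X) ^+ 2 * ln N%:R))
    (measurableT_comp (@measurable_sqnorm R D) mX).
  by move=> /(_ measurableT [set true] I); rewrite setTI.
have tau0 : 0 <= tau by exact: powR_ge0.
set a := k.+2%:R ^+ d * L; pose c : R := k.+1%:R ^+ d.
pose p := 2 * b ^+ 2 + 4 * tau * a ^+ 2; pose q := 4 * tau * c ^+ 2.
have p0 : 0 <= p.
  by apply: addr_ge0; [rewrite mulr_ge0 ?sqr_ge0 | rewrite -mulrA !mulr_ge0 ?sqr_ge0].
have q0 : 0 <= q by apply: mulr_ge0; [rewrite mulr_ge0 | rewrite sqr_ge0].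
pose G w := gradient_size (k := k) g (Z w).
have qG0 w : 0 <= q * G w ^+ 2 by apply: mulr_ge0; rewrite ?sqr_ge0.
have mg := smooth_measurable L0 s2_01 g_smooth.
have pointwise w : `|g (A^T *m X w)| <= 1 ->
    (h (X w) - g (A^T *m X w)) ^+ 2 <= p + q * G w ^+ 2 + \1_C w.
  move=> f1; have [xr|xr] := pselect (eball r (X w)).
    have := projection_increment A_orth Ahat_orth L0 s2_01 g_smooth xr (sqrtr_ge0 _) dr1.
    rewrite -/delta -/tau -/a -/c -/(Z w) -/(G w) => inc.
    have : (h (X w) - g (A^T *m Ahat *m (Ahat^T *m X w))) ^+ 2 <= b ^+ 2.
      by rewrite -real_normK ?num_real // lerXn2r ?nnegrE ?hb // (le_trans _ (hb _ xr)).
    move: inc; rewrite /Z; set u := g _; set v := g _; set y := h _ => inc hu.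
    have c0 : 0 <= \1_C w :> R by rewrite indicE.
    have twice (x z : R) : (x + z) ^+ 2 <= 2 * x ^+ 2 + 2 * z ^+ 2.
      by have := sqr_ge0 (x - z); rewrite sqrrB sqrrD; lra.
    have := twice (y - u) (u - v); rewrite addrA subrK /p /q.
    have -> : 2 * b ^+ 2 + 4 * tau * a ^+ 2 + 4 * tau * c ^+ 2 * G w ^+ 2 =
      2 * b ^+ 2 + 2 * (tau * (2 * a ^+ 2 + 2 * (c * G w) ^+ 2)) by ring.
    by move: inc hu c0; set U := tau * _; lra.
  rewrite h0 // sub0r sqrrN; have Cw : C w.
    by rewrite /C /=; rewrite ltNge; apply/negP => xk; apply: xr; apply/eball_sqrt.
  rewrite indicE mem_set // mulr1n.
  have : g (A^T *m X w) ^+ 2 <= 1.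
    by rewrite -real_normK ?num_real // exprn_ile1.
  have := qG0 w.
  by move: p0; set U := q * _; move: (p) (U) => *; lra.
have mG : measurable_fun setT (fun w => G w ^+ 2) := measurable_gradient_size_sqr.
have mqG : measurable_fun setT (fun w => q * G w ^+ 2) by exact: measurable_funM.
have mI : measurable_fun setT (\1_C : T -> R) by exact: measurable_indic.
apply: (@le_trans _ _ (\int[P]_w (p%:E + (q * G w ^+ 2)%:E + (\1_C w)%:E))%E).
  apply: ae_ge0_le_integral => //.
  - by move=> w _; rewrite lee_fin sqr_ge0.
  - apply/measurable_EFinP/measurable_funX/measurable_funB.
      exact: measurableT_comp mh mX.
    exact: measurableT_comp mg mZ.
  - by move=> w _; rewrite -!EFinD lee_fin; apply: addr_ge0 => //; exact: addr_ge0.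
  - by apply: emeasurable_funD; [apply: emeasurable_funD => // | ];
      exact/measurable_EFinP.
  - by apply: filterS f_le1 => w f1 _; rewrite -!EFinD lee_fin; exact: pointwise.
rewrite ge0_integralD //; last 3 first.
- by move=> w _; rewrite -EFinD lee_fin; exact: addr_ge0.
- by apply: emeasurable_funD => //; exact/measurable_EFinP.
- exact/measurable_EFinP.
rewrite ge0_integralD //; last 2 first.
- by move=> w _; rewrite lee_fin mulr_ge0 ?sqr_ge0.
- exact/measurable_EFinP.
rewrite integral_cst // [X in (_ * X)%E](probability_setT P) mule1.
rewrite integral_indic // setIT.
under eq_integral do rewrite EFinM.
rewrite ge0_integralZl_EFin //; last 2 first.
- by move=> w _; rewrite lee_fin sqr_ge0.
- exact/measurable_EFinP.
have e1 := gradient_size_moment L0 s2_01 g_smooth mZ projected_moment.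
have e2 := sub_gaussian_tail D0 mX sX N2.
apply: (@le_trans _ _ (p%:E + q%:E * (k.+1%:R ^+ d * (1 + deriv_moment P k g Z))%:E +
    (2 / N%:R)%:E)%E).
  by apply: leeD => //; apply: leeD2l; apply: lee_wpmul2l.
rewrite -EFinM -!EFinD lee_fin /p /q /c -exprM [(3 * d)%N]mulnC.
rewrite (_ : (d * 3 = d * 2 + d)%N) ?exprD; last by rewrite mulnSr.
by rewrite le_eqVlt; apply/orP; left; apply/eqP; ring.
Qed.

End ProjectionBias.

(** * The convergence rate *)

Lemma orthonormal_cols_height (R : realType) (D d : nat) (A : 'M[R]_(D, d)) :
  (0 < d)%N -> orthonormal_cols A -> (0 < D)%N.
Proof.
case: D A => // A d0 /matrixP/(_ (Ordinal d0) (Ordinal d0)).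
by rewrite !mxE eqxx big_ord0 => /esym/eqP; rewrite oner_eq0.
Qed.

Lemma projection_error_powE (R : realType) (kappa x delta s : R) :
  0 <= kappa -> 0 <= x -> 0 <= delta ->
  ((delta * Num.sqrt (kappa * x)) ^+ 2) `^ Num.min 1 s =
  kappa `^ Num.min 1 s * x `^ Num.min 1 s * delta `^ Num.min 2 (2 * s).
Proof.
move=> kappa0 x0 delta0.
rewrite exprMn sqr_sqrtr ?mulr_ge0 // powRM ?sqr_ge0 ?mulr_ge0 //.
rewrite powRM // mulrC; congr (_ * _).
by rewrite -powR_mulrn // -powRrM minr_pMr // mulr1.
Qed.

Lemma collect_rates (R : realType) (d k N : nat)
    (s L Ls sigma M b rate KN W tau : R) :
  0 <= L <= Ls -> 0 <= M -> k%:R <= s -> 0 <= tau ->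
  b ^+ 2 <= (s + 2) ^+ (2 * d) * (d%:R + 1) `^ s * L ^+ 2 * rate ->
  N%:R^-1 <= rate -> rate <= 2 ^+ d * W ->
  KN <= 2 ^+ d * ((s + 1) ^+ d * 12 ^+ d) * W ->
  8 * (2 * b ^+ 2 + 2 / N%:R + tau * (4 * (k.+2%:R ^+ d * L) ^+ 2 +
      4 * (k.+1%:R ^+ (3 * d) * (1 + M)))) + (8 + 16 * sigma ^+ 2) * KN
  <= variance_constant sigma d s Ls * W + projection_constant M sigma d s Ls * tau.
Proof.
move=> /andP[L0 LLs] M0 ks tau0 hb hN hW hK.
have k0 : 0 <= k%:R :> R by [].
have s0 : 0 <= s by lra.
have hL : L ^+ 2 <= Ls ^+ 2 by apply: lerXn2r; rewrite ?nnegrE ?(le_trans L0).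
have rate0 : 0 <= rate by apply: le_trans hN; rewrite invr_ge0.
have L2 := sqr_ge0 L; have Ls2 := sqr_ge0 Ls; have sg2 := sqr_ge0 sigma.
have s2d : 0 <= (s + 2) ^+ (2 * d) by apply: exprn_ge0; lra.
have e1 : b ^+ 2 <=
    (s + 2) ^+ (2 * d) * (d%:R + 1) `^ s * Ls ^+ 2 * (2 ^+ d * W).
  apply: (le_trans hb); apply: ler_pM => //.
    by rewrite !mulr_ge0 // powR_ge0.
  by apply: ler_wpM2l => //; rewrite mulr_ge0 // powR_ge0.
have e2 : (8 + 16 * sigma ^+ 2) * KN <=
    (8 + 16 * sigma ^+ 2) * (2 ^+ d * ((s + 1) ^+ d * 12 ^+ d) * W).
  by apply: ler_wpM2l => //; lra.
have e3 : (k.+2%:R ^+ d * L) ^+ 2 <= (s + 2) ^+ (2 * d) * Ls ^+ 2.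
  rewrite exprMn -exprM [(d * 2)%N]mulnC; apply: ler_pM => //.
  by apply: lerXn2r; rewrite ?nnegrE // -?[k.+2]addn2 ?natrD; lra.
have e4 : k.+1%:R ^+ (3 * d) * (1 + M) <= (s + 1) ^+ (3 * d) * (1 + M).
  apply: ler_wpM2r; first by lra.
  by apply: lerXn2r; rewrite ?nnegrE // -?[k.+1]addn1 ?natrD; lra.
have e5 := lerD e3 e4; have e6 := ler_wpM2r tau0 e5.
have -> : variance_constant sigma d s Ls * W =
    16 * ((s + 2) ^+ (2 * d) * (d%:R + 1) `^ s * Ls ^+ 2 * (2 ^+ d * W)) +
    16 * (2 ^+ d * W) +
    (8 + 16 * sigma ^+ 2) * (2 ^+ d * ((s + 1) ^+ d * 12 ^+ d) * W).
  by rewrite /variance_constant; ring.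
have -> : projection_constant M sigma d s Ls * tau = 4 * tau + 32 *
    (((s + 2) ^+ (2 * d) * Ls ^+ 2 + (s + 1) ^+ (3 * d) * (1 + M)) * tau).
  by rewrite /projection_constant; ring.
move: e1 e2 e6 hN hW tau0.
have -> : 8 * (2 * b ^+ 2 + 2 / N%:R + tau * (4 * (k.+2%:R ^+ d * L) ^+ 2 +
      4 * (k.+1%:R ^+ (3 * d) * (1 + M)))) = 16 * b ^+ 2 + 16 * N%:R^-1 +
   32 * (((k.+2%:R ^+ d * L) ^+ 2 + k.+1%:R ^+ (3 * d) * (1 + M)) * tau) by ring.
have arith (x1 x2 x3 x4 x5 x6 x7 x8 : R) : x1 <= x2 -> x3 <= x4 -> x5 <= x6 ->
    x8 <= rate -> rate <= x7 -> 0 <= tau ->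
    16 * x1 + 16 * x8 + 32 * x5 + x3 <= 16 * x2 + 16 * x7 + x4 + (4 * tau + 32 * x6).
  by lra.
exact: arith.
Qed.

Theorem theorem13 (R : realType) :
  exists (c1 : R -> nat -> R -> R -> R) (c2 : R -> R -> nat -> R -> R -> R),
  [/\ (forall sigma sigma' (d d' : nat) s s' L L',
         0 <= sigma <= sigma' -> (d <= d')%N -> 0 < s <= s' -> 0 <= L <= L' ->
         c1 sigma d s L <= c1 sigma' d' s' L'),
      (forall M M' sigma sigma' (d d' : nat) s s' L L',
         0 <= M <= M' -> 0 <= sigma <= sigma' -> (d <= d')%N -> 0 < s <= s' ->
         0 <= L <= L' ->
         c2 M sigma d s L <= c2 M' sigma' d' s' L') &
  forall (disp : measure_display) (T : measurableType disp)
    (P : probability T R) (D d N s1 : nat) (s2 L sigma : R)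
    (A Ahat : 'M[R]_(D, d)) (g : 'cV[R]_d -> R)
    (X : {RV P >-> 'cV[R]_D}) (zeta Y : {RV P >-> R}) (e v : T -> R)
    (S : {RV P >-> N.-tuple ('cV[R]_D * R)})
    (ftilde : N.-tuple ('cV[R]_D * R) -> 'cV[R]_D -> R),
  let s := s1%:R + s2 in
  let f := fun x : 'cV[R]_D => g (A^T *m x) in
  let delta := opnorm (Ahat *m Ahat^T - A *m A^T) in
  let kappa := D%:R * fine (psi2_vec P X) ^+ 2 in
  let logN := ln (N%:R : R) in
  let l := Num.ceil (logN / ln 2 / (2 * s + d%:R)) in
  let r := Num.sqrt (kappa * logN) in
  let Lstar := L * d%:R `^ (s1%:R / 2) * (1 - delta ^+ 2) `^ (- (s / 2)) in
  let Mg := deriv_moment P s1 g (fun w => A^T *m X w) in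
  (0 < d)%N -> (2 <= N)%N -> 0 <= sigma ->
  orthonormal_cols A -> orthonormal_cols Ahat -> delta < 1 ->
  0 < s2 <= 1 -> smooth L s1 s2 g ->
  (forall w, Y w = g (A^T *m X w) + zeta w) ->
  sub_gaussian P X ->
  is_cond_exp P X zeta e -> {ae P, forall w, e w = 0} ->
  is_cond_var P X zeta v -> {ae P, forall w, v w <= sigma ^+ 2} ->
  {ae P, forall w, `|f (X w)| <= 1} ->
  mutually_independent P (fun (i : 'I_N) w => tnth (S w) i) ->
  (forall i : 'I_N, same_law P (fun w => tnth (S w) i) (fun w => (X w, Y w))) ->
  independent_pair P X S ->
  (forall z, argmin (piecewise_poly Ahat l s1 r) (empirical_risk z) (ftilde z)) ->
  measurable_fun setT
    (fun q : N.-tuple ('cV[R]_D * R) * 'cV[R]_D => ftilde q.1 q.2) ->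
  ('E_P[fun w => ((clip1 (ftilde (S w) (X w)) - f (X w)) ^+ 2)%R] <=
   (c1 sigma d s Lstar * (1 + kappa `^ (d%:R / 2))
      * logN `^ (Num.max 1 (d%:R / 2)) * N%:R `^ (- (2 * s / (2 * s + d%:R)))
    + c2 Mg sigma d s Lstar * kappa `^ (Num.min 1 s)
      * logN `^ (Num.min 1 s) * delta `^ (Num.min 2 (2 * s)))%R%:E)%E].
Proof.
exists variance_constant, projection_constant; split.
- exact: variance_constant_mono.
- exact: projection_constant_mono.
move=> disp T P D d N k s2 L sigma A Ahat g X zeta Y e v S ft.
move=> s f delta kappa logN l r Lstar Mg d0 N2 sigma0 A_orth Ahat_orth delta1.
move=> s2_01 g_smooth YE sX zeta_mean e0 zeta_var v_le f_le1 S_indep S_law.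
move=> XS_indep ft_min mft.
have L0 : 0 <= L := smooth_constant_ge0 d0 g_smooth.
have D0 := orthonormal_cols_height d0 A_orth.
have delta0 : 0 <= delta := opnorm_ge0 A_orth Ahat_orth.
have mX : measurable_fun setT X by exact: measurable_funP.
have mZ : measurable_fun setT (fun w => A^T *m X w) by exact: measurable_mulmx.
have mg := smooth_measurable L0 s2_01 g_smooth.
have mf : measurable_fun setT f.
  by apply: measurableT_comp mg _; exact: measurable_mulmx (@measurable_id _ _ _).
have Mg0 : 0 <= Mg.
  have h := deriv_moment_ge0 L0 s2_01 g_smooth mZ (projected_moment D0 A_orth mX sX).
  exact: h.
have kappa0 : 0 <= kappa by rewrite mulr_ge0 ?sqr_ge0.
have logN0 : 0 <= logN by apply: le_trans (half_le_ln N2); rewrite invr_ge0.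
have s20 : 0 < s2 by case/andP: s2_01.
have k0 : 0 <= k%:R :> R by [].
have s0 : 0 < s by rewrite /s; lra.
have LLs : L <= Lstar by apply: le_inflated_constant => //; rewrite ?delta0 // ltW.
have r0 : 0 <= r by exact: sqrtr_ge0.
pose tau := ((delta * r) ^+ 2) `^ Num.min 1 s.
have tau0 : 0 <= tau by exact: powR_ge0.
pose W := (1 + kappa `^ (d%:R / 2)) * logN `^ (Num.max 1 (d%:R / 2))
  * N%:R `^ (- (2 * s / (2 * s + d%:R))).
have W0 : 0 <= W by rewrite !mulr_ge0 ?addr_ge0 ?powR_ge0.
pose target := variance_constant sigma d s Lstar * W
  + projection_constant Mg sigma d s Lstar * tau.
have -> : (variance_constant sigma d s Lstar * (1 + kappa `^ (d%:R / 2))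
      * logN `^ (Num.max 1 (d%:R / 2)) * N%:R `^ (- (2 * s / (2 * s + d%:R)))
    + projection_constant Mg sigma d s Lstar * kappa `^ (Num.min 1 s)
      * logN `^ (Num.min 1 s) * delta `^ (Num.min 2 (2 * s)))%R = target.
  by rewrite /target /W /tau projection_error_powE // !mulrA.
have c1_ge0 := variance_constant_ge0 sigma d Lstar (ltW s0).
have c2_ge4 := projection_constant_ge4 sigma d Lstar (ltW s0) Mg0.
have [dr1|dr1] := leP (delta * r) 1; last first.
  (* The projection term exceeds the largest possible error. *)
  rewrite unlock; apply: (@le_trans _ _ (\int[P]_w (4 : R)%:E)%E).
    apply: ae_ge0_le_integral => //.
    - by move=> w _; rewrite lee_fin sqr_ge0.
    - apply/measurable_EFinP/measurable_funX/measurable_funB.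
        apply: measurable_clip1.
        have mS : measurable_fun setT S by exact: measurable_funP.
        exact: measurableT_comp mft (measurable_fun_pair mS mX).
      exact: measurableT_comp mf mX.
    - by apply: filterS f_le1 => w f1 _; rewrite lee_fin; exact: clip1_dist.
  rewrite integral_cst // [X in (_ * X)%E](probability_setT P) mule1 lee_fin.
  have tau1 : 1 <= tau.
    have m0 : 0 <= Num.min 1 s by rewrite le_min ler01 ltW.
    have := @le_powR2 R 1 ((delta * r) ^+ 2) _ m0 ler01.
    by rewrite powR1; apply; rewrite exprn_ege1 // ltW.
  have h1 : 0 <= variance_constant sigma d s Lstar * W by exact: mulr_ge0.
  have h2 : 4 <= projection_constant Mg sigma d s Lstar * tau.
    by apply: (le_trans c2_ge4); rewrite ler_peMr // (le_trans _ c2_ge4).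
  by move: h1 h2; rewrite /target; set u := _ * W; set u' := _ * tau; lra.
(* M bounds the coordinates of the cells that meet the ball. *)
have [M Mge Mle] : exists2 M : nat, 2 ^ l * r <= M%:R & M%:R <= 2 ^ l * r + 1 :> R.
  have y0 : 0 <= 2 ^ l * r by rewrite mulr_ge0 // ltW // exp2_gt0.
  have ME : `|Num.ceil (2 ^ l * r)|%N%:R = (Num.ceil (2 ^ l * r))%:~R :> R.
    by rewrite natr_absz ger0_norm // ceil_ge0 (lt_le_trans _ y0) // ltrN10.
  have /andP[c1 c2] := ceil_itv (2 ^ l * r); rewrite intrB in c1.
  by exists `|Num.ceil (2 ^ l * r)|%N; rewrite ME // -lerBlDr ltW.
have [h h_class [h_in h_out]] :=
  piecewise_poly_approximation A_orth Ahat_orth L0 s2_01 g_smooth l r.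
have [c0 hE] := piecewise_poly_lincomb Mge Ahat_orth h_class.
have mphi := measurable_features Ahat l (k := k) (M := M) r0.
have mh : measurable_fun setT h.
  rewrite (_ : h = lincomb (features Ahat l r (M := M)) c0); last exact/funext.
  by apply: measurable_sum => j; apply: measurable_funM.
have ft_span z : exists c, forall x,
    ft z x = lincomb (features Ahat l (k := k) r (M := M)) c x.
  have [ft_class _] := ft_min z.
  by have [c cE] := piecewise_poly_lincomb Mge Ahat_orth ft_class; exists c.
have := regression_risk mphi mf YE zeta_mean e0 zeta_var v_le f_le1 S_indep S_law
  XS_indep mft ft_span _ c0.
move=> /(_ _)/le_trans; apply.
  move=> z c; have [_ ft_le] := ft_min z; apply: (ft_le (lincomb _ c)).
  exact: lincomb_featuresP.
have bias := projection_bias D0 N2 A_orth Ahat_orth L0 s2_01 g_smooth mX sX f_le1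
  mh h_in h_out dr1.
under eq_integral do rewrite -hE.
apply: le_trans (leeD2r _ (@lee_wpmul2l R 8%:E _ _ _ bias)) _; first by rewrite lee_fin.
rewrite -EFinM -EFinD lee_fin -[(8 + _) * _ / _]mulrA /target.
have [log1 _] := @one_le_logpow R d N d0 N2.
apply: collect_rates (bias_rate k L d0 N2 s2_01) (inv_le_rate k d0 N2 s2_01) _ _ => //.
- by rewrite L0.
- by rewrite lerDl ltW.
- have rate0 : 0 <= N%:R `^ (- (2 * s / (2 * s + d%:R))) :> R by exact: powR_ge0.
  have -> : 2 ^+ d * W = (1 + kappa `^ (d%:R / 2)) *
      (2 ^+ d * logN `^ Num.max 1 (d%:R / 2)) *
      N%:R `^ (- (2 * s / (2 * s + d%:R))) by rewrite /W; ring.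
  by apply: ler_peMl => //; apply: mulr_ege1 => //; rewrite lerDl powR_ge0.
have := cells_rate d0 N2 s2_01 kappa0 Mle (card_feature_index k M).
by rewrite -!mulrA.
Qed.
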